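(* Let $M$ be an $(n-1)$-connected and $2n$-dimensional closed PL-manifold. Then every combinatorial triangulation of $M$ has at least $3n+3+k$ vertices, where $k$ is the minimal integer for which $\binom{n+k+1}{k}\ge\mathrm{rank}\,H_n(M)$.
   Context: A triangulation of a manifold is combinatorial if the links of all vertices are combinatorial spheres. $H_n(M)$ denotes the $n$-th homology group of $M$.
   Formalization: n ≥ 1 is assumed (for n = 0 a point violates the bound), and k ranges over integers with n+k+1 ≥ 0, the binomial being 0 for k < 0; so when rank H_n(M) = 0 one has k = -(n+1) and the bound 2n+2, since otherwise k is undefined or the bound 3n+3 fails for the sphere. *)

(* Defs.v *)
From HB Require Import structures.
From mathcomp Require Import all_boot all_order all_algebra.
From mathcomp Require Import freeg.
From mathcomp Require Import all_classical reals topology normedtype.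

Set Implicit Arguments.
Unset Strict Implicit.
Unset Printing Implicit Defensive.

Import Order.TTheory GRing.Theory Num.Theory.
Import numFieldNormedType.Exports.

Local Open Scope classical_set_scope.
Local Open Scope ring_scope.

Section PiecewiseLinear.
Variable R : realType.

Definition polytope (a : nat) (C : set 'rV[R]_a) : Prop :=
  exists (k : nat) (p : 'I_k -> 'rV[R]_a),
    C = [set x | exists w : 'I_k -> R,
          [/\ forall i, 0 <= w i, \sum_i w i = 1 & x = \sum_i w i *: p i]].

Definition affine_on (a b : nat) (C : set 'rV[R]_a)
    (f : 'rV[R]_a -> 'rV[R]_b) : Prop :=
  exists (A : 'M[R]_(a, b)) (v : 'rV[R]_b), forall x, C x -> f x = x *m A + v.

(* Every point of X has a neighbourhood in X that is a finite union of
   polytopes contained in X, on each of which f is affine; f is then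
   automatically continuous on X. *)
Definition pl_on (a b : nat) (X : set 'rV[R]_a)
    (f : 'rV[R]_a -> 'rV[R]_b) : Prop :=
  forall x, X x -> exists (k : nat) (C : 'I_k -> set 'rV[R]_a),
    (forall i, [/\ polytope (C i), C i `<=` X & affine_on (C i) f]) /\
    (\forall y \near within X (nbhs x), exists i, C i y).

Definition pl_homeomorphic (a b : nat) (X : set 'rV[R]_a)
    (Y : set 'rV[R]_b) : Prop :=
  exists (f : 'rV[R]_a -> 'rV[R]_b) (g : 'rV[R]_b -> 'rV[R]_a),
    [/\ pl_on X f /\ (forall x, X x -> Y (f x)),
        pl_on Y g /\ (forall y, Y y -> X (g y)),
        forall x, X x -> g (f x) = x
      & forall y, Y y -> f (g y) = y].

End PiecewiseLinear.

Section PLManifold.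
Variables (R : realType) (d : nat) (M : topologicalType).

(* A chart is a pair of mutually inverse maps between the open set
   [chart_dom] and its image; values elsewhere are irrelevant. *)
Record chart := Chart {
  chart_dom : set M;
  chart_map : M -> 'rV[R]_d;
  chart_inv : 'rV[R]_d -> M
}.

Definition is_chart (c : chart) : Prop :=
  [/\ open (chart_dom c), open (chart_map c @` chart_dom c),
      {within chart_dom c, continuous (chart_map c)},
      {within chart_map c @` chart_dom c, continuous (chart_inv c)}
    & forall x, chart_dom c x -> chart_inv c (chart_map c x) = x].

Definition pl_atlas (A : set chart) : Prop :=
  [/\ forall c, A c -> is_chart c,
      forall x : M, exists2 c, A c & chart_dom c x
    & forall c c', A c -> A c' ->
        pl_on (chart_map c @` (chart_dom c `&` chart_dom c'))
              (chart_map c' \o chart_inv c)].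

(* Charts take values in open subsets of R^d, so there is no boundary. *)
Definition closed_pl_manifold (A : set chart) : Prop :=
  [/\ hausdorff_space M, @second_countable M, compact [set: M] & pl_atlas A].

End PLManifold.

Section Connectedness.
Variables (R : realType) (M : topologicalType).

Definition cube (i : nat) : set 'rV[R]_i :=
  [set x | forall j, 0 <= x ord0 j <= 1].
Arguments cube i : clear implicits.

Definition cube_boundary (i : nat) : set (cube i) :=
  [set x : cube i | exists j, (set_val x : 'rV[R]_i) ord0 j = 0 \/
                              (set_val x : 'rV[R]_i) ord0 j = 1].

Definition homotopic_rel (X Y : topologicalType) (A : set X)
    (f g : X -> Y) : Prop :=
  exists H : R * X -> Y,
    [/\ {within [set tx | 0 <= tx.1 <= 1], continuous H},
        forall x, H (0, x) = f x,
        forall x, H (1, x) = g x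
      & forall t a, 0 <= t <= 1 -> A a -> H (t, a) = f a].

(* pi_i(M, x) is trivial. For i = 0 the cube is a point with empty boundary,
   and the condition says that every point is joined to x by a path. *)
Definition trivial_homotopy_group (i : nat) (x : M) : Prop :=
  forall f : cube i -> M, continuous f ->
    (forall c, cube_boundary c -> f c = x) ->
    homotopic_rel (@cube_boundary i) f (cst x).

Definition n_connected (q : nat) : Prop :=
  [set: M] !=set0 /\
  forall i, (i <= q)%N -> forall x, trivial_homotopy_group i x.

End Connectedness.

Section SingularHomology.
Variable R : realType.

Definition std_simplex (m : nat) : set 'rV[R]_m.+1 :=
  [set x | (forall j, 0 <= x ord0 j) /\ \sum_j x ord0 j = 1].
Arguments std_simplex m : clear implicits.

(* The i-th face inclusion inserts a zero coordinate in position i. *)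
Definition face_row (m : nat) (i : 'I_m.+2) (x : 'rV[R]_m.+1) : 'rV[R]_m.+2 :=
  \row_j (if unlift i j is Some k then x ord0 k else 0).

Lemma face_row_std (m : nat) (i : 'I_m.+2) (x : std_simplex m) :
  face_row i (set_val x) \in std_simplex m.+1.
Proof.
have [x0 x1] : std_simplex m (set_val x) by exact: set_valP.
move: (set_val x) x0 x1 => {}x x0 x1; rewrite inE; split.
  by move=> j; rewrite mxE; case: unliftP.
rewrite (bigD1 i) //= mxE unlift_none add0r -x1.
rewrite (reindex (fintype.lift i)) /=; last first.
  exists (fun j => odflt ord0 (unlift i j)) => j; first by rewrite liftK.
  by rewrite inE; case: unliftP => [k ->|->]; rewrite ?eqxx.
apply: eq_big => [k|k _]; first by rewrite eq_sym neq_lift.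
by rewrite mxE liftK.
Qed.

Definition face (m : nat) (i : 'I_m.+2) (x : std_simplex m) :
  std_simplex m.+1 :=
  exist (fun y => y \in std_simplex m.+1) _ (face_row_std i x).

Lemma face_continuous (m : nat) (i : 'I_m.+2) : continuous (@face m i).
Proof.
apply: continuous_comp_initial => x.
have h : {for x, continuous (fun y : std_simplex m => set_val y)}.
  exact: (@initial_continuous _ _ set_val).
apply: (@continuous_comp _ _ _ (fun y : std_simplex m => set_val y)
  (face_row i)) => // {h}.
move: (set_val x) => {}x B /= [P Px PB].
exists (fun _ k => P ord0 (fintype.lift i k)) => [j k|y Py /=].
  by have := Px ord0 (fintype.lift i k); rewrite mxE liftK (ord1 j).
apply: PB => j k; rewrite (ord1 j) mxE.
case: unliftP => [l ->|->]; first exact: Py ord0 l.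
by have := Px ord0 i; rewrite mxE unlift_none => /nbhs_singleton.
Qed.

HB.instance Definition _ (m : nat) (i : 'I_m.+2) :=
  isContinuous.Build _ _ (@face m i) (@face_continuous m i).

Variable M : topologicalType.

Definition singular_simplex (m : nat) := continuousType (std_simplex m) M.

Definition singular_chain (m : nat) := {freeg (singular_simplex m) / int}.

Definition simplex_boundary (m : nat) (s : singular_simplex m.+1) :
  singular_chain m :=
  \sum_(i < m.+2) (-1) ^+ i *: << (s \o face i : singular_simplex m) >>.

Definition boundary (m : nat) (c : singular_chain m.+1) : singular_chain m :=
  fglift (@simplex_boundary m) c.

Definition singular_cycle (m : nat) : singular_chain m -> Prop :=
  match m with
  | 0 => fun _ => True
  | m'.+1 => fun c => boundary c = 0
  end.

Definition singular_bounding (m : nat) (c : singular_chain m) : Prop :=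
  exists b : singular_chain m.+1, boundary b = c.

(* The homology classes of the cycles z i are linearly independent
   over the integers in H_m(M) = cycles / boundaries. *)
Definition independent_classes (m r : nat) (z : 'I_r -> singular_chain m) :
  Prop :=
  (forall i, singular_cycle (z i)) /\
  (forall a : 'I_r -> int,
     singular_bounding (\sum_i a i *: z i) -> forall i, a i = 0).

(* The rank of an abelian group is the largest size of a linearly
   independent family. *)
Definition homology_rank (m r : nat) : Prop :=
  (exists z : 'I_r -> singular_chain m, independent_classes z) /\
  (forall (s : nat) (z : 'I_s -> singular_chain m),
     independent_classes z -> (s <= r)%N).

End SingularHomology.

Section SimplicialComplexes.
Variables (R : realType) (m : nat).
Implicit Types K L : {set {set 'I_m}}.

(* The empty face belongs to every complex, and some elements of 'I_m may
   fail to be vertices. *)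
Definition simplicial_complex K : Prop :=
  finset.set0 \in K /\
  forall s t : {set 'I_m}, s \in K -> t \subset s -> t \in K.

Definition vertices K : {set 'I_m} := [set v | [set v]%SET \in K]%SET.

Definition link K (v : 'I_m) : {set {set 'I_m}} :=
  [set s : {set 'I_m} | (v \notin s) && ((v |: s)%SET \in K)]%SET.

Definition realization K : set 'rV[R]_m :=
  [set x | [/\ forall i, 0 <= x ord0 i, \sum_i x ord0 i = 1
             & [set i | x ord0 i != 0]%SET \in K]].

End SimplicialComplexes.

Definition boundary_complex (d : nat) : {set {set 'I_d.+2}} :=
  [set s | s != [set: 'I_d.+2]]%SET.

Definition combinatorial_sphere (R : realType) (d m : nat)
    (L : {set {set 'I_m}}) : Prop :=
  simplicial_complex L /\
  pl_homeomorphic (@realization R m L)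
    (@realization R d.+2 (boundary_complex d)).

Definition homeomorphic (X Y : topologicalType) : Prop :=
  exists (f : X -> Y) (g : Y -> X),
    [/\ continuous f, continuous g, cancel f g & cancel g f].

(* For a d-manifold M with d >= 1, whose vertex links have dimension d - 1.
   The homeomorphism with M is not required to be PL. *)
Definition combinatorial_triangulation (R : realType) (d m : nat)
    (K : {set {set 'I_m}}) (M : topologicalType) : Prop :=
  [/\ simplicial_complex K,
      homeomorphic (@realization R m K : set _) M
    & forall v, v \in vertices K ->
        combinatorial_sphere R d.-1 (link K v)].

(* Binomial coefficient with integer entries: zero when the lower entry is
   negative. It is only used with a nonnegative upper entry. *)
Definition binz (a k : int) : nat :=
  match a, k with
  | Posz a', Posz k' => 'C(a', k')
  | _, _ => 0%N
  end.

(* k ranges over the integers, including negative ones, for which the upper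
   entry n + k + 1 is nonnegative. For r = 0 the minimum is -(n + 1), which
   gives the number 2n + 2 of vertices of the boundary of a simplex. *)
Definition admissible (n r : nat) (k : int) : Prop :=
  0 <= n%:Z + k + 1 /\ (r <= binz (n%:Z + k + 1) k)%N.

Definition minimal_admissible (n r : nat) (k : int) : Prop :=
  admissible n r k /\ forall j, admissible n r j -> k <= j.

(* Main.v *)
(* In a (2n-1)-sphere the complement of a closed simplex is acyclic: for a point
   the complement is contractible, and a convex set is swept out by slices of
   smaller dimension, with a Mayer-Vietoris argument at each slice.  Applied to
   the links, this pushes a simplicial n-cycle off the vertices of a 2n-simplex
   sigma one at a time: the part of the cycle through a vertex v is a cone over
   an (n-1)-cycle of the link of v that avoids the vertices already treated, and
   that cycle bounds in the link away from them.  So H_n is carried by the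
   subcomplex induced on the other N - 2n - 1 vertices, where the rank of H_n is
   at most C(N - 2n - 2, n + 1).  Singular chains are compared with simplicial
   ones by barycentric subdivision, sending a point to a vertex at which its
   barycentric coordinate is maximal. *)

Require Import Defs.
From mathcomp Require Import all_boot all_order all_algebra.
From mathcomp Require Import all_classical reals topology normedtype.
From HB Require Import structures.
From mathcomp Require Import freeg.
From mathcomp Require Import sequences derive.
From mathcomp Require Import ring lra zify.

Set Implicit Arguments.
Unset Strict Implicit.
Unset Printing Implicit Defensive.

Import Order.TTheory GRing.Theory Num.Theory.
Import numFieldNormedType.Exports.

Local Open Scope classical_set_scope.
Local Open Scope ring_scope.

(** * Chains of lists *)

(* Identities between sums of chains, checked on the integer coefficients. *)
Ltac chain_ring :=
  apply/eqP/freeg_eqP => ? /=; rewrite !(coeffD, coeffB, coeffN, coeff0); ring.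

(** Simplicial chains are free on all lists of vertices, in any order and with repetitions. Vertex
    maps, cones and subdivisions then need no convention on orientations or degenerate simplices,
    but ranks can no longer be read off the generators. A normal form, chain homotopic to the
    identity, repairs this: it sorts lists along a fixed enumeration and kills repetitions, and up
    to boundaries a cycle is determined by the coefficients of its normal form at sorted lists that
    avoid the first vertex. This spared vertex is why [N - 2n - 1] remaining vertices give
    [C(q, n + 1)] with [q = N - 2n - 2]. Since [C(q, n + 1) = C(q, q - n - 1)], the integer
    [q - n - 1] is admissible, and [k <= q - n - 1] is the bound to be proved. A second obstacle is
    dimension: a PL homeomorphism of a link with a sphere does not show how many vertices the
    simplices of the link have. That some simplex has [2n] vertices, from which [sigma] is obtained,
    is itself derived homologically in [sphere_facet]. *)

Section FreeAbelian.
Variables (K : choiceType) (V : lmodType int).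
Implicit Types (P Q : K -> Prop) (c : {freeg K / int}).

Definition ext (f : K -> V) c : V := fglift f c.

Lemma ext_is_zmod_morphism f : zmod_morphism (ext f).
Proof. exact: lift_is_additive. Qed.

HB.instance Definition _ f :=
  GRing.isZmodMorphism.Build {freeg K / int} V (ext f) (ext_is_zmod_morphism f).

Lemma extU f a x : ext f << a *g x >> = a *: f x.
Proof. exact: liftU. Qed.

Lemma ext1 f x : ext f << x >> = f x.
Proof. by rewrite extU scale1r. Qed.

Definition supp_in P c : Prop := forall x, x \in dom c -> P x.

Lemma supp_in0 P : supp_in P 0.
Proof. by move=> x; rewrite dom0. Qed.

Lemma supp_inU P a x : P x -> supp_in P << a *g x >>.
Proof.
move=> Px y; rewrite mem_dom coeffU; case: (x =P y) => [<- //|_].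
by rewrite mulr0 eqxx.
Qed.

Lemma supp_inN P c : supp_in P c -> supp_in P (- c).
Proof. by move=> Pc x; rewrite domN; exact: Pc. Qed.

Lemma supp_inD P c c' : supp_in P c -> supp_in P c' -> supp_in P (c + c').
Proof.
by move=> Pc Pc' x /domD_subset; rewrite mem_cat => /orP[/Pc|/Pc'].
Qed.

Lemma supp_inB P c c' : supp_in P c -> supp_in P c' -> supp_in P (c - c').
Proof. by move=> Pc Pc'; apply: supp_inD => //; exact: supp_inN. Qed.

Lemma supp_inZ P a c : supp_in P c -> supp_in P (a *: c).
Proof. by move=> Pc x /domZ_subset /Pc. Qed.

Lemma supp_in_sum P I (r : seq I) (p : pred I) F :
  (forall i, p i -> supp_in P (F i)) -> supp_in P (\sum_(i <- r | p i) F i).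
Proof.
move=> PF; elim/big_rec: _ => [|i x pi Px]; first exact: supp_in0.
by apply: supp_inD => //; exact: PF.
Qed.

Lemma supp_inW P Q c : (forall x, P x -> Q x) -> supp_in P c -> supp_in Q c.
Proof. by move=> PQ Pc x /Pc /PQ. Qed.

Lemma supp_inI P Q c : supp_in P c -> supp_in Q c ->
  supp_in (fun x => P x /\ Q x) c.
Proof. by move=> Pc Qc x xc; split; [exact: Pc|exact: Qc]. Qed.

Lemma supp_in_ind P (H : {freeg K / int} -> Prop) :
  H 0 -> (forall a x c, P x -> H c -> H (<< a *g x >> + c)) ->
  forall c, supp_in P c -> H c.
Proof.
move=> H0 HS c Pc; rewrite -[c]freeg_sumE big_seq.
by elim/big_rec: _ => [|x y /Pc Px Hy]; [exact: H0|exact: HS].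
Qed.

Lemma freegU_scale a (x : K) : << a *g x >> = a *: << x >> :> {freeg K / int}.
Proof.
by apply/eqP/freeg_eqP => y; rewrite coeffZ !coeffU mul1r.
Qed.

Lemma scale_mulz (W : lmodType int) (a : int) (v : W) : a *: v = v *~ a.
Proof. by rewrite -scaler_int intz. Qed.

(** Identities between chain maps are reduced to one generator through this; additivity alone gives
    compatibility with integer scalars. *)
Lemma eq_additive_in P (f g : {additive {freeg K / int} -> V}) :
  (forall x, P x -> f << x >> = g << x >>) -> forall c, supp_in P c -> f c = g c.
Proof.
move=> fg; apply: supp_in_ind => [|a x c Px IH]; first by rewrite !raddf0.
by rewrite !raddfD /= IH freegU_scale scale_mulz !raddfMz fg.
Qed.

Lemma eq_additive (f g : {additive {freeg K / int} -> V}) :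
  (forall x, f << x >> = g << x >>) -> f =1 g.
Proof. by move=> fg c; apply: (@eq_additive_in (fun=> True)). Qed.

(** Serves Mayer-Vietoris: a finely subdivided chain is cut into the simplices off one closed set
    and the rest. *)
Lemma supp_in_split P c : exists c1 c2,
  [/\ c = c1 + c2, supp_in (fun x => x \in dom c /\ P x) c1
    & supp_in (fun x => x \in dom c /\ ~ P x) c2].
Proof.
exists (\sum_(x <- dom c | (x \in dom c) && `[< P x >]) << coeff x c *g x >>).
exists (\sum_(x <- dom c | (x \in dom c) && ~~ `[< P x >]) << coeff x c *g x >>).
split.
- by rewrite -!big_seq_cond -[LHS]freeg_sumE (bigID (fun x => `[< P x >])).
- by apply: supp_in_sum => x /andP[xc /asboolP Px]; exact: supp_inU.
- by apply: supp_in_sum => x /andP[xc /asboolPn Px]; exact: supp_inU.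
Qed.

End FreeAbelian.

Lemma supp_in_ext (K K' : choiceType) (P : K -> Prop) (Q : K' -> Prop)
    (f : K -> {freeg K' / int}) c :
  (forall x, P x -> supp_in Q (f x)) -> supp_in P c -> supp_in Q (ext f c).
Proof.
move=> PQ; move: c; apply: supp_in_ind => [|a x c Px Qc].
  by rewrite raddf0; exact: supp_in0.
by rewrite raddfD /= extU; apply: supp_inD => //; apply: supp_inZ; exact: PQ.
Qed.

(** * Ordered chains, their reduced boundary, and cones *)

Section ListChains.
Variable T : choiceType.
Notation chain := {freeg (seq T) / int}.
Implicit Types (l : seq T) (c : chain).

Definition cone (x : T) : chain -> chain := ext (fun l => << x :: l >>).
HB.instance Definition _ x := GRing.Additive.on (cone x).

(* The empty list is a generator, in the degree below the points, so that
   cycles and boundaries are those of reduced homology. *)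
Fixpoint list_boundary l : chain :=
  if l is x :: l' then << l' >> - cone x (list_boundary l') else 0.

Definition bd : chain -> chain := ext list_boundary.
HB.instance Definition _ := GRing.Additive.on bd.

Lemma cone1 x l : cone x << l >> = << x :: l >>.
Proof. exact: ext1. Qed.

Lemma bd1 l : bd << l >> = list_boundary l.
Proof. exact: ext1. Qed.

Lemma bd_nil : bd << [::] >> = 0.
Proof. exact: bd1. Qed.

Lemma bd_cons x l : bd << x :: l >> = << l >> - cone x (bd << l >>).
Proof. by rewrite !bd1. Qed.

(** Coning is a contracting homotopy in every degree, the empty list included, so a cycle is the
    boundary of its cone; what matters later is only where the cone is allowed to lie. *)
Lemma bd_cone x c : bd (cone x c) = c - cone x (bd c).
Proof.
apply: (@eq_additive _ _ (bd \o cone x) (idfun \- (cone x \o bd))) => l /=.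
by rewrite cone1 bd_cons.
Qed.

Lemma bd_bd c : bd (bd c) = 0.
Proof.
apply: (@eq_additive _ _ (bd \o bd) \0) => l /=.
elim: l => [|x l IH]; first by rewrite bd_nil raddf0.
by rewrite bd_cons raddfB /= bd_cone IH raddf0 subr0 subrr.
Qed.

Definition of_size k c := supp_in (fun l => size l = k) c.

Lemma of_size_cone k x c : of_size k c -> of_size k.+1 (cone x c).
Proof. by apply: supp_in_ext => l <-; apply: supp_inU. Qed.

Lemma of_size0 c : of_size 0 c -> exists a, c = << a *g [::] >>.
Proof.
move: c; apply: supp_in_ind => [|a l c /size0nil-> [b ->]].
  by exists 0; rewrite freegU0.
by exists (a + b); rewrite freegUD.
Qed.

Lemma supp_in_list_boundary l :
  supp_in (fun l' => exists l1 x l2, l = l1 ++ x :: l2 /\ l' = l1 ++ l2)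
    (list_boundary l).
Proof.
elim: l => [|x l IH] /=; first exact: supp_in0.
apply: supp_inB; first by apply: supp_inU; exists [::], x, l.
apply: supp_in_ext IH => _ [l1 [y [l2 [-> ->]]]].
by apply: supp_inU; exists (x :: l1), y, l2.
Qed.

Lemma of_size_bd k c : of_size k.+1 c -> of_size k (bd c).
Proof.
apply: supp_in_ext => l El; apply: supp_inW (@supp_in_list_boundary l).
by move=> _ [l1 [x [l2 [E ->]]]]; move: El; rewrite E !size_cat /= addnS => -[].
Qed.

(* The acyclic carrier argument: the difference of [F] and the identity is
   coned off, degree by degree, from a chosen apex of each list. *)
Section Homotopy.
Variables (apex : seq T -> T) (F : {additive chain -> chain}).

(** [k] stands for the size of [l]: the faces of [l] are not structurally smaller, so the recursion
    runs on the size. *)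
Fixpoint homotopy_list k l : chain :=
  if k is k'.+1 then
    cone (apex l) (<< l >> - F << l >> - ext (homotopy_list k') (bd << l >>))
  else 0.

Definition homotopy k : chain -> chain := ext (homotopy_list k).
HB.instance Definition _ k := GRing.Additive.on (homotopy k).

Lemma homotopyS k l : homotopy k.+1 << l >> =
  cone (apex l) (<< l >> - F << l >> - homotopy k (bd << l >>)).
Proof. exact: ext1. Qed.

Hypothesis bdF : forall c, bd (F c) = F (bd c).
Hypothesis F_nil : F << [::] >> = << [::] >>.

Lemma bd_homotopy k c : of_size k c ->
  bd (homotopy k c) = c - F c - homotopy k.-1 (bd c).
Proof.
elim: k c => [|k IH] c.
  case/of_size0 => a ->; rewrite freegU_scale scale_mulz !raddfMz /=.
  rewrite F_nil !mulNrz subrr bd_nil /homotopy /= ext1 raddf0 mul0rz.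
  by rewrite raddf0 mul0rz subr0.
move: c; apply: (eq_additive_in
  (f := bd \o homotopy k.+1) (g := (idfun \- F) \- (homotopy k \o bd))) => l sl /=.
have sb : of_size k (bd << l >>) by apply: of_size_bd; exact: supp_inU.
(* The chain that gets coned is a cycle, so its cone bounds it exactly. *)
suff w0 : bd (<< l >> - F << l >> - homotopy k (bd << l >>)) = 0.
  by rewrite homotopyS bd_cone w0 raddf0 subr0.
by rewrite 2!raddfB /= bdF IH // bd_bd raddf0 subr0 subrr.
Qed.

(** The carrier [Q l] will be the set of entries of [l] for maps of vertices, and the convex hull of
    [l] for subdivision. *)
Lemma homotopy_carried (Q : seq T -> set T) k l :
  (forall l1 x l2, Q (l1 ++ l2) `<=` Q (l1 ++ x :: l2)) ->
  (forall l, (0 < size l)%N -> Q l (apex l)) ->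
  (forall l y, y \in l -> Q l y) ->
  (forall l, supp_in (fun l' => size l' = size l /\ {in l', forall y, Q l y})
     (F << l >>)) ->
  size l = k ->
  supp_in (fun l' => size l' = k.+1 /\ {in l', forall y, Q l y})
    (homotopy k << l >>).
Proof.
move=> Qmono Qapex Qid QF; elim: k l => [|k IH] l sl.
  by rewrite /homotopy ext1; exact: supp_in0.
rewrite homotopyS.
apply: (@supp_in_ext _ _
    (fun l' => size l' = k.+1 /\ {in l', forall y, Q l y})) => [l' [sl' Ql']|].
  apply: supp_inU; split; first by rewrite /= sl'.
  by move=> y; rewrite inE => /predU1P[->|/Ql' //]; apply: Qapex; rewrite sl.
apply: supp_inB; first apply: supp_inB.
- by apply: supp_inU; split => // y; exact: Qid.
- by apply: supp_inW (QF l) => l' []; rewrite sl.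
rewrite bd1; apply: supp_in_ext (@supp_in_list_boundary l).
move=> _ [l1 [x [l2 [El ->]]]].
have sl12 : size (l1 ++ l2) = k.
  by move: sl; rewrite El !size_cat /= addnS => -[].
have := IH _ sl12; rewrite /homotopy ext1; apply: supp_inW => l' [-> h].
by split => // y /h; rewrite El; exact: Qmono.
Qed.

End Homotopy.

End ListChains.
Arguments bd {T}.
Arguments cone {T}.

(** * Chain maps that create no new vertices *)

Section Carried.
Variables (T : choiceType) (t0 : T).
Notation chain := {freeg (seq T) / int}.
Implicit Types (l : seq T) (c : chain) (P : seq T -> Prop).

Definition subset_closed P :=
  forall l l', P l -> {subset l' <= l} -> P l'.

Definition carried (F : chain -> chain) :=
  forall l, supp_in (fun l' => size l' = size l /\ {subset l' <= l}) (F << l >>).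

Lemma carried_supp (F : {additive chain -> chain}) k P c :
  carried F -> subset_closed P -> of_size k c -> supp_in P c ->
  of_size k (F c) /\ supp_in P (F c).
Proof.
move=> cF cP kc Pc.
have : supp_in (fun l => size l = k /\ P l) (F c).
  move: c {kc Pc} (supp_inI kc Pc); apply: supp_in_ind.
    by rewrite raddf0; exact: supp_in0.
  move=> a l c [sl Pl] IH; rewrite raddfD /=; apply: supp_inD => //.
  rewrite freegU_scale scale_mulz raddfMz -scale_mulz; apply: supp_inZ.
  by apply: supp_inW (cF l) => l' [-> /cP h]; split=> //; exact: h.
by move=> h; split; apply: supp_inW h => l [].
Qed.

(** All lists of entries of [l] are allowed, repetitions included, so [l] is its own acyclic
    carrier, with its first entry as apex. *)
Lemma carried_homotopic (F : {additive chain -> chain}) P k c :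
  (forall c, bd (F c) = F (bd c)) -> F << [::] >> = << [::] >> -> carried F ->
  subset_closed P -> of_size k c -> supp_in P c -> bd c = 0 ->
  exists b, [/\ of_size k.+1 b, supp_in P b & bd b = c - F c].
Proof.
move=> bdF F_nil cF cP kc Pc bc; exists (homotopy (head t0) F k c).
have : supp_in (fun l => size l = k.+1 /\ P l) (homotopy (head t0) F k c).
  apply: supp_in_ext (supp_inI kc Pc) => l [sl Pl].
  have -> : homotopy_list (head t0) F k l = homotopy (head t0) F k << l >>.
    by rewrite /homotopy ext1.
  pose Q l := [set y : T | y \in l].
  apply: supp_inW (_ : supp_in (fun l' => size l' = k.+1 /\
    {in l', forall y, Q l y}) _).
    by move=> l' [-> h]; split => //; apply: cP Pl _ => y /h.
  apply: homotopy_carried => //.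
  - move=> l1 x l2 y; rewrite /Q /= !mem_cat inE => /orP[->//|->].
    by rewrite !orbT.
  - by move=> [|x l'] //= _; rewrite /Q /= mem_head.
move=> h; split; [by apply: supp_inW h => l []|by apply: supp_inW h => l []|].
by rewrite bd_homotopy // bc raddf0 subr0.
Qed.

Lemma carried_comp (F G : {additive chain -> chain}) :
  carried F -> carried G -> carried (F \o G).
Proof.
move=> cF cG l.
have cP : subset_closed (fun l' => {subset l' <= l}).
  by move=> l1 l2 h1 h2 x /h2 /h1.
have sG : of_size (size l) (G << l >>) by apply: supp_inW (cG l) => l' [].
have lG : supp_in (fun l' => {subset l' <= l}) (G << l >>).
  by apply: supp_inW (cG l) => l' [].
by have [h1 h2] := carried_supp cF cP sG lG; exact: supp_inI.
Qed.

End Carried.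

(* Every cycle is homologous to one in which the vertex [u] occurs only in
   front and at most once; [away u] collects the part without [u] and
   [strip u] the link part. *)
Section Vertex.
Variables (T : choiceType) (t0 : T) (u : T).
Notation chain := {freeg (seq T) / int}.
Implicit Types (l : seq T) (c : chain) (P : seq T -> Prop).

Definition away_list l : chain := if u \in l then 0 else << l >>.

(** The sign is that of moving [u] to the front. Only the first [u] is removed, and a list with a
    second one gives 0. *)
Fixpoint strip_list l : chain :=
  if l is x :: l' then
    if x == u then away_list l' else - cone x (strip_list l')
  else 0.

Definition away : chain -> chain := ext away_list.
HB.instance Definition _ := GRing.Additive.on away.
Definition strip : chain -> chain := ext strip_list.
HB.instance Definition _ := GRing.Additive.on strip.

Lemma away_cone_id c : away (cone u c) = 0.
Proof.
move: c; apply: (@eq_additive _ _ (away \o cone u) \0) => l /=.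
by rewrite cone1 /away ext1 /away_list mem_head.
Qed.

Lemma away_cone x c : x != u -> away (cone x c) = cone x (away c).
Proof.
move=> xu; move: c.
apply: (@eq_additive _ _ (away \o cone x) (cone x \o away)) => l /=.
rewrite cone1 /away !ext1 /away_list inE eq_sym (negbTE xu) /=.
by case: ifP; rewrite ?raddf0 ?cone1.
Qed.

Lemma strip_cone_id c : strip (cone u c) = away c.
Proof.
move: c; apply: (@eq_additive _ _ (strip \o cone u) away) => l /=.
by rewrite cone1 /strip ext1 /= eqxx /away ext1.
Qed.

Lemma strip_cone x c : x != u -> strip (cone x c) = - cone x (strip c).
Proof.
move=> xu; move: c.
apply: (@eq_additive _ _ (strip \o cone x) (\- (cone x \o strip))) => l /=.
by rewrite cone1 /strip !ext1 /= (negbTE xu).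
Qed.

(** A face misses [u] in two ways: the list has no [u], or the face drops its only [u]. With two
    occurrences both sides vanish. *)
Lemma away_bd c : away (bd c) = bd (away c) + strip c.
Proof.
move: c.
apply: (@eq_additive _ _ (away \o bd) ((bd \o away) \+ strip)) => l /=.
elim: l => [|x l IH].
  by rewrite bd_nil raddf0 /away /strip !ext1 /= bd_nil addr0.
rewrite bd_cons raddfB /= -cone1; have [->|xu] := eqVneq x u.
  by rewrite !away_cone_id strip_cone_id subr0 raddf0 add0r.
rewrite !away_cone // strip_cone // bd_cone IH raddfD /=.
by rewrite opprD addrA.
Qed.

Lemma strip_bd c : strip (bd c) = - bd (strip c).
Proof.
move: c; apply: (@eq_additive _ _ (strip \o bd) (\- (bd \o strip))) => l /=.
elim: l => [|x l IH].
  by rewrite bd_nil raddf0 /strip ext1 /= raddf0 oppr0.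
rewrite bd_cons raddfB /= -cone1; have [->|xu] := eqVneq x u.
  by rewrite !strip_cone_id away_bd opprD addrCA subrr addr0.
rewrite !strip_cone // IH opprK [cone x _]raddfN /=.
by rewrite [bd (- _)]raddfN /= opprK bd_cone.
Qed.

Definition split c := away c + cone u (strip c).

Lemma split_is_zmod_morphism : zmod_morphism split.
Proof. by move=> c c'; rewrite /split !raddfB /= addrACA opprD. Qed.

HB.instance Definition _ :=
  GRing.isZmodMorphism.Build chain chain split split_is_zmod_morphism.

Lemma bd_split c : bd (split c) = split (bd c).
Proof.
rewrite /split raddfD /= bd_cone away_bd strip_bd raddfN /= addrA.
by [].
Qed.

Lemma split_nil : split << [::] >> = << [::] >>.
Proof. by rewrite /split /away /strip !ext1 /= raddf0 addr0. Qed.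

Lemma supp_away_list l :
  supp_in (fun l' => l' = l /\ u \notin l) (away_list l).
Proof.
rewrite /away_list; case: ifP => [_|/negbT ul]; first exact: supp_in0.
exact: supp_inU.
Qed.

Lemma supp_strip_list l :
  supp_in (fun l' => [/\ u \notin l', size l = (size l').+1
                       & {subset u :: l' <= l}]) (strip_list l).
Proof.
elim: l => [|x l IH] /=; first exact: supp_in0.
case: eqP => [->|/eqP xu].
  by apply: supp_inW (@supp_away_list l) => _ [-> ul]; split.
apply: supp_inN; apply: supp_in_ext IH => l' [ul' sl sub].
apply: supp_inU; split => /=; rewrite ?sl //.
  by rewrite inE eq_sym negb_or xu.
move=> y; rewrite !inE => /or3P[/eqP->|->//|yl'].
  by rewrite (sub u) ?mem_head ?orbT.
by rewrite (sub y) ?orbT // inE yl' orbT.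
Qed.

Lemma carried_split : carried split.
Proof.
move=> l; rewrite /split /away /strip !ext1; apply: supp_inD.
  by apply: supp_inW (@supp_away_list l) => _ [-> _]; split.
apply: supp_in_ext (@supp_strip_list l) => l' [_ -> sub].
exact: supp_inU.
Qed.

Lemma supp_away P c : supp_in P c ->
  supp_in (fun l => P l /\ u \notin l) (away c).
Proof.
apply: supp_in_ext => l Pl.
by apply: supp_inW (@supp_away_list l) => _ [->].
Qed.

Lemma supp_strip P k c : subset_closed P -> of_size k.+1 c -> supp_in P c ->
  of_size k (strip c) /\ supp_in (fun l => u \notin l /\ P (u :: l)) (strip c).
Proof.
move=> cP kc Pc.
have : supp_in (fun l => size l = k /\ (u \notin l /\ P (u :: l))) (strip c).
  apply: supp_in_ext (supp_inI kc Pc) => l [sl Pl].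
  apply: supp_inW (@supp_strip_list l) => l' [ul' + sub].
  by rewrite sl => -[]; split => //; split => //; exact: cP Pl _.
by move=> h; split; apply: supp_inW h => l [].
Qed.

Lemma strip_cycle c : bd c = 0 -> bd (strip c) = 0.
Proof. by move=> bc; apply/oppr_inj; rewrite -strip_bd bc raddf0 oppr0. Qed.

(** The boundary of [cone u y] is [y - cone u (strip u c)], so it exchanges the part of the cycle
    through [u] for the filling [y] of the base of that part. *)
Lemma push_off P k c y : subset_closed P ->
  of_size k.+1 c -> supp_in P c -> bd c = 0 ->
  of_size k.+1 y -> supp_in (fun l => u \notin l /\ P (u :: l)) y ->
  bd y = strip c ->
  exists c' b, [/\ of_size k.+1 c', supp_in (fun l => P l /\ u \notin l) c',
                  of_size k.+2 b, supp_in P b & c = c' + bd b].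
Proof.
move=> cP kc Pc bc ky Py ystrip.
have [b [kb Pb bb]] := carried_homotopic t0 bd_split split_nil carried_split cP
  kc Pc bc.
exists (away c + y), (b - cone u y); split.
- by apply: supp_inD => //; apply: supp_inW (supp_away kc) => l [].
- apply: supp_inD; first exact: supp_away.
  by apply: supp_inW Py => l [ul Pl]; split=> //; apply: cP Pl _ => z zl;
    rewrite inE zl orbT.
- by apply: supp_inB => //; exact: of_size_cone.
- apply: supp_inB => //; apply: supp_in_ext Py => l [_ Pl].
  exact: supp_inU.
have E (V : zmodType) (a s x z : V) : x = a + z + (x - (a + s) - (z - s)).
  by rewrite opprB opprD !addrA subrK -[_ - a - z]addrA -opprD addrAC subrr add0r.
by rewrite raddfB /= bb bd_cone ystrip -E.
Qed.

End Vertex.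

(** * Normal form along an enumeration of vertices *)

Section Normalize.
Variables (T : choiceType) (t0 : T).
Notation chain := {freeg (seq T) / int}.
Implicit Types (l us : seq T) (c : chain) (P : seq T -> Prop).

(** The vertices are moved to the front starting from the last one, so that the front ends up in the
    order of [us]. *)
Fixpoint normalize us c : chain :=
  if us is u :: us' then split u (normalize us' c) else c.

Lemma normalize_is_zmod_morphism us : zmod_morphism (normalize us).
Proof. by elim: us => [//|u us IH] c c' /=; rewrite IH raddfB. Qed.

HB.instance Definition _ us :=
  GRing.isZmodMorphism.Build chain chain (normalize us)
    (normalize_is_zmod_morphism us).

Lemma bd_normalize us c : bd (normalize us c) = normalize us (bd c).
Proof. by elim: us => [//|u us IH] /=; rewrite bd_split IH. Qed.

Lemma normalize_nil us : normalize us << [::] >> = << [::] >>.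
Proof. by elim: us => [//|u us /= ->]; rewrite split_nil. Qed.

Lemma carried_normalize us : carried (normalize us).
Proof.
elim: us => [l|u us IH]; first by apply: supp_inU; split.
exact: (carried_comp (@carried_split T u) IH).
Qed.

Lemma supp_strip_list_cat u s t : u \notin s ->
  supp_in (fun l => exists t', [/\ l = s ++ t', u \notin t' & {subset t' <= t}])
    (strip_list u (s ++ t)).
Proof.
elim: s => [|x s IH] /=.
  move=> _; apply: supp_inW (@supp_strip_list _ u t) => l [ul _ sub].
  by exists l; split => // y yl; rewrite sub // inE yl orbT.
rewrite inE negb_or eq_sym => /andP[/negbTE-> /IH{}IH].
apply: supp_inN; apply: supp_in_ext IH => _ [t' [-> ut' sub]].
by apply: supp_inU; exists t'; split.
Qed.

(** If [us] contains all vertices, then [t] is empty and only sorted lists without repetition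
    survive. *)
Lemma supp_normalize us c : uniq us ->
  supp_in (fun l => exists s t, [/\ l = s ++ t, subseq s us
                                 & {in t, forall x, x \notin us}])
    (normalize us c).
Proof.
elim: us => [_|u us IH] /=; first by move=> l _; exists [::], l.
move=> /andP[uus /IH{}IH].
have -> : split u (normalize us c) = ext (fun l => split u << l >>)
  (normalize us c).
  move: (normalize us c).
  by apply: (@eq_additive _ _ (split u) (ext (fun l => split u << l >>))) => l
    /=; rewrite ext1.
apply: supp_in_ext IH => _ [s [t [-> ss tus]]].
have us' : u \notin s by apply: contraNN uus; exact: mem_subseq.
have sub (t' : seq T) : u \notin t' -> {subset t' <= t} ->
  {in t', forall x, x \notin u :: us}.
  move=> ut' tt' x xt'; rewrite inE negb_or (tus _ (tt' _ xt')) andbT.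
  by apply: contraNN ut' => /eqP <-.
rewrite /split /away /strip !ext1; apply: supp_inD.
  apply: supp_inW (@supp_away_list _ u (s ++ t)) => _ [->].
  rewrite mem_cat negb_or => /andP[_ ut]; exists s, t; split => //.
    exact: (subseq_trans ss (subseq_cons us u)).
  exact: sub.
apply: supp_in_ext (supp_strip_list_cat us') => _ [t' [-> ut' tt']].
apply: supp_inU; exists (u :: s), t'; split; first by [].
  by rewrite /= eqxx.
exact: sub.
Qed.

Lemma coeff_cone_notin (u : T) c (s : seq T) : u \notin s -> coeff s (cone u c) = 0.
Proof.
move=> us; apply: coeff_outdom; apply/negP => /=.
suff H : supp_in (fun l => u \in l) (cone u c) by move=> /H; rewrite (negbTE us).
apply: (@supp_in_ext _ _ (fun=> True)) => // l _.
by apply: supp_inU; rewrite mem_head.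
Qed.

(* A cycle whose normal form only involves simplices through the first vertex
   [u] is a cone with apex [u], hence its normal form vanishes. *)
Lemma normalize_bounds P k u us c : uniq (u :: us) -> subset_closed P ->
  of_size k c -> supp_in P c -> supp_in (fun l => {subset l <= u :: us}) c ->
  bd c = 0 ->
  (forall s, subseq s us -> size s = k -> coeff s (normalize (u :: us) c) = 0) ->
  exists b, [/\ of_size k.+1 b, supp_in P b & bd b = c].
Proof.
move=> uniq_us cP kc Pc us_c bc coeff0.
suff N0 : normalize (u :: us) c = 0.
  have [b [kb Pb eb]] := carried_homotopic t0 (bd_normalize (u :: us))
    (normalize_nil _) (@carried_normalize _) cP kc Pc bc.
  by exists b; split; rewrite // eb [X in _ - X]N0 subr0.
set c1 := normalize us c.
have cQ : subset_closed (fun l => {subset l <= u :: us}).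
  by move=> l l' h1 h2 x /h2 /h1.
have [kc1 us_c1] := carried_supp (@carried_normalize us) cQ kc us_c.
have /andP[uus uniq_us'] : (u \notin us) && uniq us by [].
have A0 : away u c1 = 0.
  apply/eqP; rewrite -dom_eq0; case E : (dom _) => [//|s d].
  have sd : s \in dom (away u c1) by rewrite E mem_head.
  have [[[ks us_s] [s' [t [st ss tus]]]] us'] := supp_away (supp_inI
    (supp_inI kc1 us_c1) (@supp_normalize us c uniq_us')) sd.
  (* All entries lie in [u :: us] and [t] avoids [us], so [t] could only repeat [u], which [away]
     has removed. *)
  have t_nil : t = [::].
    case: t st tus => [//|y t] st tus; exfalso.
    have ys : y \in s by rewrite st mem_cat mem_head orbT.
    move: (us_s _ ys) (tus y (mem_head _ _)); rewrite inE => /predU1P[yu|->//] _.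
    by move: us'; rewrite -yu ys.
  (* The other summand of the normal form lives on lists that contain [u], so the coefficient at [s]
     is that of [away u c1]. *)
  have := coeff0 s; rewrite /= -/c1 /split coeffD coeff_cone_notin // addr0.
  move=> s0; move: sd; rewrite mem_dom s0 ?eqxx //.
  by rewrite st t_nil cats0.
have bc1 : bd c1 = 0 by rewrite bd_normalize bc raddf0.
(* The normal form is now [cone u S] with [S := strip u c1]. Being a cycle it forces [S] to be a
   cone with apex [u], while [S] is supported on lists without [u]; hence [S = 0]. *)
have S0 : strip u c1 = cone u (bd (strip u c1)).
  have : bd (split u c1) = 0 by rewrite bd_split bc1 raddf0.
  by rewrite /split A0 add0r bd_cone => /eqP; rewrite subr_eq0 => /eqP.
have : away u (strip u c1) = strip u c1.
  have h : supp_in (fun l => u \notin l) (strip u c1).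
    apply: (@supp_in_ext _ _ (fun=> True)) => // l _.
    by apply: supp_inW (@supp_strip_list _ u l) => l' [].
  move: (strip u c1) h.
  apply: (@eq_additive_in _ _ _ (away u) idfun) => l ul /=.
  by rewrite /away ext1 /away_list (negbTE ul).
rewrite /= -/c1 /split A0 S0 away_cone_id => <-.
by rewrite raddf0 addr0.
Qed.

End Normalize.

(** * Chains under maps of vertices, and the prism operator *)

Section MapChains.
Variables (T T' : choiceType) (f : T -> T').

Definition map_chain : {freeg (seq T) / int} -> {freeg (seq T') / int} :=
  ext (fun l => << map f l >>).
HB.instance Definition _ := GRing.Additive.on map_chain.

Lemma map_chain1 l : map_chain << l >> = << map f l >>.
Proof. exact: ext1. Qed.

Lemma map_chain_cone x c : map_chain (cone x c) = cone (f x) (map_chain c).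
Proof.
move: c; apply: (@eq_additive _ _ (map_chain \o cone x)
  (cone (f x) \o map_chain)) => l /=.
by rewrite cone1 !map_chain1 cone1.
Qed.

Lemma map_chain_bd c : map_chain (bd c) = bd (map_chain c).
Proof.
move: c; apply: (@eq_additive _ _ (map_chain \o bd) (bd \o map_chain)) => l /=.
rewrite map_chain1; elim: l => [|x l IH]; first by rewrite /= !bd_nil raddf0.
by rewrite /= !bd_cons raddfB /= map_chain1 map_chain_cone IH.
Qed.

Lemma of_size_map_chain k c : of_size k c -> of_size k (map_chain c).
Proof. by apply: supp_in_ext => l <-; apply: supp_inU; rewrite size_map. Qed.

End MapChains.

Section Prism.
Variables (T T' : choiceType) (i0 i1 : T -> T').
Notation chain := {freeg (seq T) / int}.

Fixpoint prism_list (l : seq T) : {freeg (seq T') / int} :=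
  if l is x :: l' then
    << i0 x :: i1 x :: map i1 l' >> - cone (i0 x) (prism_list l')
  else 0.

Definition prism := ext prism_list.
HB.instance Definition _ := GRing.Additive.on prism.

Lemma prism_cone x c : prism (cone x c) =
  cone (i0 x) (cone (i1 x) (map_chain i1 c)) - cone (i0 x) (prism c).
Proof.
move: c; apply: (@eq_additive _ _ (prism \o cone x)
  ((cone (i0 x) \o (cone (i1 x) \o map_chain i1)) \- (cone (i0 x) \o prism))) =>
    l /=.
by rewrite cone1 /prism !ext1 /= map_chain1 !cone1.
Qed.

Lemma bd_prism c : bd (prism c) = map_chain i1 c - map_chain i0 c - prism (bd c).
Proof.
move: c; apply: (@eq_additive _ _ (bd \o prism)
  ((map_chain i1 \- map_chain i0) \- (prism \o bd))) => l /=.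
elim: l => [|x l IH].
  by rewrite bd_nil !map_chain1 subrr raddf0 subr0 /prism ext1 raddf0.
rewrite bd_cons raddfB /= -cone1 !prism_cone !map_chain_cone [bd (_ - _)]raddfB /=.
rewrite !bd_cone IH map_chain_bd.
rewrite !raddfB /=; chain_ring.
Qed.

End Prism.

(** * Barycentric subdivision *)

Section Subdivision.
Variables (R : realType).
Implicit Types V W : lmodType R.

Definition convex_closed V (C : set V) := forall k (w : 'I_k -> R) (p : 'I_k -> V),
  (forall i, 0 <= w i) -> \sum_i w i = 1 -> (forall i, C (p i)) ->
  C (\sum_i w i *: p i).

(** The intersection of all convex sets containing [l]: a bound on the hull is proved by exhibiting
    a convex set, without handling weights. *)
Definition hull V (l : seq V) : set V :=
  [set y | forall C, convex_closed C -> {in l, forall x, C x} -> C y].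

Lemma convex_hull V (l : seq V) : convex_closed (hull l).
Proof. by move=> k w p w0 w1 hp C cC Cl; apply: (cC) => // i; exact: (hp i). Qed.

Lemma mem_hull V (l : seq V) x : x \in l -> hull l x.
Proof. by move=> xl C _; exact. Qed.

Lemma sub_hull V (l l' : seq V) : {in l, forall x, hull l' x} ->
  hull l `<=` hull l'.
Proof. by move=> ll' y; apply; [exact: convex_hull|exact: ll']. Qed.

Lemma hull_mono V (l1 : seq V) x l2 : hull (l1 ++ l2) `<=` hull (l1 ++ x :: l2).
Proof.
apply: sub_hull => y; rewrite mem_cat => yl; apply: mem_hull.
by rewrite mem_cat inE; case/orP: yl => ->; rewrite ?orbT.
Qed.

Definition barycenter V (l : seq V) : V := (size l)%:R^-1 *: \sum_(x <- l) x.

Lemma barycenter_in V (C : set V) l : convex_closed C -> (0 < size l)%N ->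
  {in l, forall x, C x} -> C (barycenter l).
Proof.
move=> cC l0 Cl; rewrite /barycenter (big_nth 0) big_mkord scaler_sumr.
apply: cC => [i||i].
- by rewrite invr_ge0 ler0n.
- rewrite sumr_const card_ord -[LHS]mulr_natl mulfV // pnatr_eq0.
  by rewrite -lt0n.
- by apply: Cl; exact: mem_nth.
Qed.

Lemma hull_barycenter V (l : seq V) : (0 < size l)%N -> hull l (barycenter l).
Proof.
by move=> l0; apply: barycenter_in => //; [exact: convex_hull|exact: mem_hull].
Qed.

Lemma barycenter_map V W (f : {linear V -> W}) l :
  barycenter (map f l) = f (barycenter l).
Proof. by rewrite /barycenter size_map big_map linearZ /= [f _]linear_sum. Qed.

Fixpoint subdiv_list V k (l : seq V) : {freeg (seq V) / int} :=
  if k is k'.+1 then cone (barycenter l) (ext (subdiv_list k') (bd << l >>))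
  else << l >>.

Definition subdiv V : {freeg (seq V) / int} -> {freeg (seq V) / int} :=
  ext (fun l => subdiv_list (size l) l).
HB.instance Definition _ V := GRing.Additive.on (@subdiv V).

Lemma subdivE V (l : seq V) : (0 < size l)%N ->
  subdiv << l >> = cone (barycenter l) (subdiv (bd << l >>)).
Proof.
rewrite {1}/subdiv ext1; case sl : (size l) => [//|k] _ /=; congr cone.
have : of_size k (bd << l >>) by apply: of_size_bd; apply: supp_inU.
move: (bd _); apply: eq_additive_in => l' sl'.
by rewrite /= /subdiv !ext1 sl'.
Qed.

Lemma subdiv_nil V : subdiv << [::] : seq V >> = << [::] >>.
Proof. by rewrite /subdiv ext1. Qed.

Lemma subdiv_hull V (l : seq V) :
  supp_in (fun l' => size l' = size l /\ {in l', forall y, hull l y})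
    (subdiv << l >>).
Proof.
elim: {l}(size l) {-2}l (erefl (size l)) => [|k IH] l sl.
  by rewrite (size0nil sl) subdiv_nil; apply: supp_inU; split.
rewrite subdivE ?sl //.
apply: (@supp_in_ext _ _ (fun l' => size l' = k /\ {in l', forall y, hull l y})).
  move=> l' [sl' hl']; apply: supp_inU; split; first by rewrite /= sl'.
  move=> y; rewrite inE => /predU1P[->|/hl' //]; apply: hull_barycenter.
  by rewrite sl.
rewrite bd1; apply: supp_in_ext (@supp_in_list_boundary _ l).
move=> _ [l1 [x [l2 [El ->]]]].
have sl12 : size (l1 ++ l2) = k.
  by move: sl; rewrite El !size_cat /= addnS => -[].
have := IH _ sl12; rewrite /subdiv ext1 sl12; apply: supp_inW => l' [-> h].
by split => // y /h; rewrite El; exact: hull_mono.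
Qed.

Lemma bd_subdiv V (c : {freeg (seq V) / int}) : bd (subdiv c) = subdiv (bd c).
Proof.
move: c; apply: (@eq_additive _ _ (bd \o @subdiv V) (@subdiv V \o bd)) => l /=.
elim: {l}(size l) {-2}l (erefl (size l)) => [|k IH] l sl.
  by rewrite (size0nil sl) subdiv_nil bd_nil raddf0.
rewrite subdivE ?sl // bd_cone.
suff -> : bd (subdiv (bd << l >>)) = 0 by rewrite raddf0 subr0.
have -> : bd (subdiv (bd << l >>)) = subdiv (bd (bd << l >>)).
  have : of_size k (bd << l >>) by apply: of_size_bd; apply: supp_inU.
  move: (bd << l >>).
  by apply: (@eq_additive_in _ _ _ (bd \o @subdiv V) (@subdiv V \o bd)).
by rewrite bd_bd raddf0.
Qed.

(** Barycenters commute with linear maps. Subdivision can therefore be computed once, on the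
    standard simplex, and transported to every singular simplex. *)
Lemma subdiv_map V W (f : {linear V -> W}) c :
  subdiv (map_chain f c) = map_chain f (subdiv c).
Proof.
move: c; apply: (@eq_additive _ _ (@subdiv W \o map_chain f)
  (map_chain f \o @subdiv V)) => l /=.
elim: {l}(size l) {-2}l (erefl (size l)) => [|k IH] l sl.
  by rewrite (size0nil sl) map_chain1 !subdiv_nil map_chain1.
rewrite map_chain1 !subdivE ?size_map ?sl // -map_chain1 -map_chain_bd.
rewrite map_chain_cone barycenter_map; congr cone.
have : of_size k (bd << l >>) by apply: of_size_bd; apply: supp_inU.
move: (bd << l >>).
by apply: (@eq_additive_in _ _ _ (@subdiv W \o map_chain f)
  (map_chain f \o @subdiv V)).
Qed.

Fixpoint subdivn V j (c : {freeg (seq V) / int}) : {freeg (seq V) / int} :=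
  if j is j'.+1 then subdiv (subdivn j' c) else c.

Lemma subdivn_is_zmod_morphism V j : zmod_morphism (@subdivn V j).
Proof. by elim: j => [//|j IH] c c' /=; rewrite IH raddfB. Qed.

HB.instance Definition _ V j := GRing.isZmodMorphism.Build
  {freeg (seq V) / int} {freeg (seq V) / int} (@subdivn V j)
  (subdivn_is_zmod_morphism j).

Lemma subdivn_nil V j : subdivn j << [::] : seq V >> = << [::] >>.
Proof. by elim: j => [//|j /= ->]; exact: subdiv_nil. Qed.

Lemma bd_subdivn V j (c : {freeg (seq V) / int}) :
  bd (subdivn j c) = subdivn j (bd c).
Proof. by elim: j => [//|j IH] /=; rewrite bd_subdiv IH. Qed.

Lemma subdivn_map V W (f : {linear V -> W}) j c :
  subdivn j (map_chain f c) = map_chain f (subdivn j c).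
Proof. by elim: j => [//|j IH] /=; rewrite IH subdiv_map. Qed.

Lemma subdivn_hull V j (l : seq V) :
  supp_in (fun l' => size l' = size l /\ {in l', forall y, hull l y})
    (subdivn j << l >>).
Proof.
elim: j => [|j IH] /=; first by apply: supp_inU; split => //; exact: mem_hull.
have -> : subdiv (subdivn j << l >>) =
    ext (fun l => subdiv << l >>) (subdivn j << l >>).
  move: (subdivn _ _); apply: (@eq_additive _ _ (@subdiv V)
    (ext (fun l => subdiv << l >>))) => l' /=; by rewrite ext1.
apply: supp_in_ext IH => l' [sl' hl'].
apply: supp_inW (@subdiv_hull _ l') => l'' [-> hl'']; split => // y /hl''.
exact: sub_hull.
Qed.

(** With barycenters as apexes the homotopy is natural for linear maps, as the subdivision is. *)
Definition subdivn_homotopy V j k :=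
  @homotopy V (@barycenter V) (@subdivn V j) k.
HB.instance Definition _ V j k := GRing.Additive.on (@subdivn_homotopy V j k).

Lemma bd_subdivn_homotopy V j k (c : {freeg (seq V) / int}) : of_size k c ->
  bd (subdivn_homotopy j k c) =
  c - subdivn j c - subdivn_homotopy j k.-1 (bd c).
Proof.
by move=> kc; apply: bd_homotopy => //; [exact: bd_subdivn|exact: subdivn_nil].
Qed.

Lemma subdivn_homotopy_hull V j k (l : seq V) : size l = k ->
  supp_in (fun l' => size l' = k.+1 /\ {in l', forall y, hull l y})
    (subdivn_homotopy j k << l >>).
Proof.
move=> sl; apply: (@homotopy_carried _ _ _ (@hull V)) => //.
- by move=> l1 x l2; exact: hull_mono.
- by move=> l'; exact: hull_barycenter.
- by move=> l' y; exact: mem_hull.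
- by move=> l'; exact: subdivn_hull.
Qed.

Lemma subdivn_homotopy_map V W (f : {linear V -> W}) j k c : of_size k c ->
  subdivn_homotopy j k (map_chain f c) = map_chain f (subdivn_homotopy j k c).
Proof.
elim: k c => [|k IH] c.
  move: c; apply: (@eq_additive_in _ _ _ (@subdivn_homotopy W j 0 \o map_chain f)
    (map_chain f \o @subdivn_homotopy V j 0)) => l _ /=.
  by rewrite map_chain1 /subdivn_homotopy /homotopy !ext1 raddf0.
move: c; apply: (@eq_additive_in _ _ _ (@subdivn_homotopy W j k.+1 \o map_chain f)
    (map_chain f \o @subdivn_homotopy V j k.+1)) => l sl /=.
rewrite map_chain1 /subdivn_homotopy !homotopyS barycenter_map map_chain_cone.
congr cone; rewrite !raddfB /= map_chain1 -subdivn_map map_chain1.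
congr (_ - _); rewrite -map_chain1 -map_chain_bd; apply: IH.
by apply: of_size_bd; apply: supp_inU.
Qed.

End Subdivision.

(** * Shrinking of simplices under subdivision *)

Section Mesh.
Variables (R : realType) (a : nat).
Implicit Types (l : seq 'rV[R]_a) (d : R).

Definition coord_close d (x y : 'rV[R]_a) := forall i, `|x ord0 i - y ord0 i| <= d.
Definition mesh_le d l := {in l &, forall x y, coord_close d x y}.

Lemma convex_coord_close d x : convex_closed (coord_close d x).
Proof.
move=> k w p w0 w1 h i; rewrite summxE -[x _ _]mul1r -w1 mulr_suml -sumrB.
apply: le_trans (ler_norm_sum _ _ _) _.
rewrite -[leRHS]mul1r -w1 mulr_suml; apply: ler_sum => j _.
by rewrite mxE -mulrBr normrM ger0_norm // ler_wpM2l //; exact: h.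
Qed.

(** Among the [s] differences averaged here, the one at [y = x] is zero. This gives the contraction
    factor [(s - 1) / s]. *)
Lemma coord_close_barycenter d l x : mesh_le d l -> 0 <= d -> x \in l ->
  coord_close (d * (size l).-1%:R / (size l)%:R) x (barycenter l).
Proof.
move=> ml d0 xl i; have sl : (0 < size l)%N by case: l xl {ml}.
have s0 : (size l)%:R != 0 :> R by rewrite pnatr_eq0 -lt0n.
have -> : x ord0 i - barycenter l ord0 i =
    (size l)%:R^-1 * \sum_(y <- l) (x ord0 i - y ord0 i).
  rewrite sumrB /barycenter mxE summxE mulrBr big_const_seq count_predT.
  by rewrite iter_addr_0 -[x _ _ *+ _]mulr_natl mulKf.
rewrite normrM ger0_norm ?invr_ge0 ?ler0n // mulrC ler_pM2r ?invr_gt0 ?ltr0n //.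
apply: le_trans (ler_norm_sum _ _ _) _.
rewrite (perm_big _ (perm_to_rem xl)) big_cons /= subrr normr0 add0r.
rewrite -(size_rem xl); set r := rem x l.
have -> : d * (size r)%:R = \sum_(y <- r) d.
  by rewrite big_const_seq count_predT iter_addr_0 mulr_natr.
by rewrite big_seq [leRHS]big_seq; apply: ler_sum => y /mem_rem yl; exact: ml.
Qed.

Definition shrink k : R := k.-1%:R / k%:R.

Lemma shrink_ge0 k : 0 <= shrink k.
Proof. by rewrite divr_ge0. Qed.

Lemma shrink_lt1 k : shrink k < 1.
Proof.
case: k => [|k]; first by rewrite /shrink mul0r.
by rewrite ltr_pdivrMr ?ltr0n // mul1r ltr_nat.
Qed.

Lemma shrink_le k k' : (k <= k')%N -> shrink k <= shrink k'.
Proof.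
case: k k' => [k' _|k [//|k'] kk'].
  by rewrite {1}/shrink mul0r shrink_ge0.
rewrite ler_pdivrMr ?ltr0n // mulrAC ler_pdivlMr ?ltr0n // -!natrM ler_nat /=.
by nia.
Qed.

(** [k] only bounds the size because the induction passes to faces, whose own factor is smaller as
    [shrink] is monotone. *)
Lemma subdiv_mesh k d l : (size l <= k)%N -> 0 <= d -> mesh_le d l ->
  supp_in (mesh_le (d * shrink k)) (subdiv << l >>).
Proof.
move=> slk d0.
elim: {l}(size l) {-2}l (erefl (size l)) slk => [|s IH] l sl slk ml.
  by rewrite (size0nil sl) subdiv_nil; apply: supp_inU.
rewrite subdivE ?sl //.
apply: (@supp_in_ext _ _ (fun l' => mesh_le (d * shrink k) l' /\
    {in l', forall y, hull l y})) => [l' [ml' hl']|].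
  have bl' y : hull l y -> coord_close (d * shrink k) (barycenter l) y.
    move=> hy i; rewrite distrC; apply: (hy (fun y => coord_close _ y _)).
      move=> k' w p w0 w1 hp j; rewrite distrC.
      by apply: convex_coord_close => // m n; rewrite distrC; exact: hp.
    move=> x xl j; apply: le_trans (coord_close_barycenter ml d0 xl j) _.
    rewrite -mulrA ler_wpM2l //; exact: shrink_le.
  apply: supp_inU => x y; rewrite !inE => /predU1P[->|xl'] /predU1P[->|yl'].
  - by move=> i; rewrite subrr normr0 mulr_ge0 // shrink_ge0.
  - by apply: bl'; exact: hl'.
  - by move=> i; rewrite distrC; apply: bl'; exact: hl'.
  - by apply: ml'.
rewrite bd1.
have -> : subdiv (list_boundary l) = ext (fun l => subdiv << l >>)
  (list_boundary l).
  move: (list_boundary l); apply: (@eq_additive _ _ (@subdiv R _)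
    (ext (fun l => subdiv << l >>))) => l' /=; by rewrite ext1.
apply: supp_in_ext (@supp_in_list_boundary _ l).
move=> _ [l1 [x [l2 [El ->]]]].
have sl12 : size (l1 ++ l2) = s.
  by move: sl; rewrite El !size_cat /= addnS => -[].
have sub y : y \in l1 ++ l2 -> y \in l.
  by rewrite El !mem_cat inE => /orP[->//|->]; rewrite !orbT.
apply: supp_inI.
  apply: IH => //; first by rewrite sl12 ltnW // -sl.
  by move=> y z /sub yl /sub zl; exact: ml.
apply: supp_inW (@subdiv_hull _ _ (l1 ++ l2)) => l' [_ hl'] y /hl'.
by rewrite El; exact: hull_mono.
Qed.

Lemma subdivn_mesh j k d l : size l = k -> 0 <= d -> mesh_le d l ->
  supp_in (mesh_le (d * shrink k ^+ j)) (subdivn j << l >>).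
Proof.
move=> sl d0 ml; elim: j => [|j IH] /=.
  by rewrite expr0 mulr1; exact: supp_inU.
have -> : subdiv (subdivn j << l >>) =
    ext (fun l => subdiv << l >>) (subdivn j << l >>).
  move: (subdivn _ _); apply: (@eq_additive _ _ (@subdiv R _)
    (ext (fun l => subdiv << l >>))) => l' /=; by rewrite ext1.
apply: supp_in_ext (supp_inI IH (@subdivn_hull _ _ j l)) => l' [ml' [sl' _]].
rewrite exprSr mulrA; apply: subdiv_mesh => //; first by rewrite sl' sl.
by rewrite mulr_ge0 // exprn_ge0 // shrink_ge0.
Qed.

End Mesh.

(** * Singular chains *)

Section ContinuousOn.
Variables (S T : topologicalType).

Definition cont_on (A : set S) (f : S -> T) :=
  forall x, A x -> f @ within A (nbhs x) --> f x.

End ContinuousOn.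

Lemma cont_on_continuous (S T : topologicalType) (A : set S) (f : S -> T) :
  continuous f -> cont_on A f.
Proof. by move=> cf x _; apply: cvg_within_filter; exact: cf. Qed.

Lemma cont_on_comp (S T U : topologicalType) (A : set S) (B : set T)
    (f : S -> T) (g : T -> U) :
  cont_on A f -> cont_on B g -> (forall x, A x -> B (f x)) ->
  cont_on A (g \o f).
Proof.
move=> cf cg AB x Ax N /= /(cg _ (AB _ Ax)) /= gN.
have := cf _ Ax _ gN; rewrite /= /nbhs /= /within /=.
by apply: filterS => y h Ay; apply: h => //; exact: AB.
Qed.

Lemma cont_on_eq (S T : topologicalType) (A : set S) (f g : S -> T) :
  (forall x, A x -> f x = g x) -> cont_on A f -> cont_on A g.
Proof.
move=> fg cf x Ax N; rewrite -fg // => /(cf _ Ax); rewrite /= /nbhs /= /within /=.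
by apply: filterS => y h Ay; rewrite -fg //; exact: h.
Qed.

Section Simplices.
Variable R : realType.

(** Indexed by the number of vertices, so that [k = 0] is the degree of the empty list. *)
Definition dsimp k : set 'rV[R]_k :=
  [set x | (forall j, 0 <= x ord0 j) /\ \sum_j x ord0 j = 1].

Lemma convex_dsimp k : convex_closed (@dsimp k).
Proof.
move=> n w p w0 w1 hp; split => [j|].
  by rewrite summxE sumr_ge0 // => i _; rewrite mxE mulr_ge0 //; case: (hp i).
under eq_bigr do rewrite summxE; rewrite exchange_big /= -[RHS]w1.
apply: eq_bigr => i _; under eq_bigr do rewrite mxE.
by rewrite -mulr_sumr (proj2 (hp i)) mulr1.
Qed.

(** The affine simplex spanned by [l], extended to a linear map on all of R^k that sends the unit
    vectors to the entries of [l]. *)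
Definition comb k (V : lmodType R) (l : seq V) (t : 'rV[R]_k) : V :=
  \sum_(i < k) t ord0 i *: l`_i.

Lemma comb_is_linear k V l : linear (@comb k V l).
Proof.
move=> c x y; rewrite /comb scaler_sumr -big_split /=; apply: eq_bigr => i _.
by rewrite !mxE scalerDl scalerA.
Qed.

HB.instance Definition _ k (V : lmodType R) l := GRing.isLinear.Build R 'rV[R]_k V _
  (@comb k V l) (comb_is_linear l).

Lemma linear_comb k (V W : lmodType R) (f : {linear V -> W}) l (t : 'rV[R]_k) :
  f (comb l t) = comb (map f l) t.
Proof.
rewrite /comb linear_sum; apply: eq_bigr => i _; rewrite linearZ /=.
have [il|il] := ltnP i (size l); first by rewrite (nth_map 0).
by rewrite !nth_default ?size_map // linear0.
Qed.

Lemma comb_in k (V : lmodType R) (C : set V) l t : convex_closed C ->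
  size l = k -> {in l, forall x, C x} -> dsimp t -> C (@comb k V l t).
Proof.
move=> cC sl Cl [t0 t1]; apply: cC => // i.
by apply: Cl; rewrite mem_nth ?sl.
Qed.

Definition units k : seq 'rV[R]_k := [seq delta_mx ord0 i | i <- enum 'I_k].

Lemma size_units k : size (units k) = k.
Proof. by rewrite size_map size_enum_ord. Qed.

Lemma nth_units k (i : 'I_k) : (units k)`_i = delta_mx ord0 i.
Proof. by rewrite (nth_map i) ?size_enum_ord // nth_ord_enum. Qed.

Lemma comb_delta k (V : lmodType R) (l : seq V) (i : 'I_k) :
  comb l (delta_mx ord0 i) = l`_i.
Proof.
rewrite /comb (bigD1 i) //= mxE !eqxx scale1r big1 ?addr0 // => j ji.
by rewrite mxE (negbTE ji) andbF scale0r.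
Qed.

Lemma map_comb_units k (V : lmodType R) (l : seq V) : size l = k ->
  map (@comb k V l) (units k) = l.
Proof.
move=> sl; apply: (@eq_from_nth _ 0); first by rewrite size_map size_units.
rewrite size_map size_units => i ik.
by rewrite (nth_map 0) ?size_units // (nth_units (Ordinal ik)) comb_delta.
Qed.

Lemma comb_units k (t : 'rV[R]_k) : comb (units k) t = t.
Proof.
by rewrite {2}(row_sum_delta t); apply: eq_bigr => i _; rewrite nth_units.
Qed.

Lemma dsimp_units k : {in units k, forall x, dsimp x}.
Proof.
move=> _ /mapP[i _ ->]; split => [j|]; first by rewrite mxE ler0n.
rewrite (bigD1 i) //= mxE !eqxx big1 ?addr0 // => j ji.
by rewrite mxE (negbTE ji) andbF.
Qed.

Lemma comb_units_in k (V : lmodType R) (f : 'rV[R]_k -> V) x : x \in units k ->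
  comb (map f (units k)) x = f x.
Proof.
case/mapP => i _ ->; rewrite comb_delta (nth_map 0) ?size_units //.
by rewrite nth_units.
Qed.

Lemma continuous_comb k (V : normedModType R) (l : seq V) :
  continuous (@comb k V l).
Proof.
move=> t; rewrite /comb /continuous_at.
apply: (@cvg_big V _ +%R 0 xpredT add_continuous _ (nbhs t) (index_enum _)
  (fun i (t : 'rV[R]_k) => t ord0 i *: l`_i)) => i _.
by apply: cvgZr_tmp; exact: coord_continuous.
Qed.

End Simplices.
Arguments dsimp : clear implicits.
Arguments units : clear implicits.
Arguments comb {R} k {V}.

Lemma additive_extE (K K' : choiceType)
    (F : {additive {freeg K / int} -> {freeg K' / int}}) c :
  F c = ext (fun x => F << x >>) c.
Proof.
move: c; apply: (@eq_additive _ _ F (ext (fun x => F << x >>))) => x /=.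
by rewrite ext1.
Qed.

(** * Singular chains in R^m and natural operations on them *)

Section SingularChains.
Variables (R : realType) (m : nat).
Notation W := 'rV[R]_m.

(* A singular [k.-1]-simplex is a function on all of R^k, extended by 0 off
   the standard simplex so that equality of functions is equality of
   simplices; for k = 0 the standard simplex is empty. *)
Definition sing k := {freeg ('rV[R]_k -> W) / int}.

Definition restr k (s : 'rV[R]_k -> W) : 'rV[R]_k -> W :=
  fun t => if t \in dsimp R k then s t else 0.

Lemma restrT k (s : 'rV[R]_k -> W) t : dsimp R k t -> restr s t = s t.
Proof. by rewrite /restr => /mem_set ->. Qed.

Lemma eq_restr k (s s' : 'rV[R]_k -> W) :
  (forall t, dsimp R k t -> s t = s' t) -> restr s = restr s'.
Proof.
move=> ss'; apply/funext => t; rewrite /restr; case: ifP => // /set_mem.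
exact: ss'.
Qed.

(** Lists are realized as affine simplices of [V] and composed with [G], which turns computations
    with lists into computations with singular chains. *)
Definition push k (V : lmodType R) (G : V -> W) : {freeg (seq V) / int} -> sing k :=
  ext (fun l => << restr (G \o comb k l) >>).
HB.instance Definition _ k V G := GRing.Additive.on (@push k V G).

Lemma push1 k (V : lmodType R) (G : V -> W) l :
  push k G << l >> = << restr (G \o comb k l) >>.
Proof. exact: ext1. Qed.

Definition in_list k (V : lmodType R) (C : set V) (l : seq V) :=
  size l = k /\ {in l, forall x, C x}.

Lemma eq_push k (V : lmodType R) (C : set V) (G G' : V -> W) c :
  convex_closed C -> (forall x, C x -> G x = G' x) ->
  supp_in (in_list k C) c -> push k G c = push k G' c.
Proof.
move=> cC GG'; move: c.
apply: (@eq_additive_in _ _ _ (push k G) (push k G')) => l [sl Cl] /=.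
rewrite !push1; congr (<< _ >>); apply: eq_restr => t tS /=.
by apply: GG'; exact: comb_in.
Qed.

Lemma push_push k k' (V : lmodType R) (G : V -> W) (l : seq V) c :
  supp_in (in_list k' (dsimp R k)) c ->
  push k' (restr (G \o comb k l)) c = push k' G (map_chain (comb k l) c).
Proof.
move: c; apply: (@eq_additive_in _ _ _ (push k' (restr (G \o comb k l)))
  (push k' G \o map_chain (comb k l))) => l' [sl Cl] /=.
rewrite map_chain1 !push1; congr (<< _ >>); apply: eq_restr => t tS /=.
rewrite restrT /= ?linear_comb //.
exact: comb_in (@convex_dsimp R k) sl Cl tS.
Qed.

(** A natural operation is determined by its value [th] on the identity of the standard simplex;
    boundary, subdivision and the subdivision homotopy are all of this form. *)
Definition act k k' (th : {freeg (seq 'rV[R]_k) / int}) : sing k -> sing k' :=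
  ext (fun s => push k' s th).
HB.instance Definition _ k k' th := GRing.Additive.on (@act k k' th).

Lemma act1 k k' (th : {freeg (seq 'rV[R]_k) / int}) s :
  act k' th << s >> = push k' s th.
Proof. exact: ext1. Qed.

Lemma act_is_additive k k' c : zmod_morphism (fun th => @act k k' th c).
Proof.
move=> th th'; move: c; apply: (@eq_additive _ _ (act k' (th - th'))
  (act k' th \- act k' th')) => s /=.
by rewrite !act1 raddfB.
Qed.

Lemma act_push k k' (V : lmodType R) (G : V -> W) th c :
  supp_in (in_list k' (dsimp R k)) th ->
  act k' th (push k G c) =
  push k' G (ext (fun l => map_chain (comb k l) th) c).
Proof.
move=> thS; move: c; apply: (@eq_additive _ _ (act k' th \o push k G)
  (push k' G \o ext (fun l => map_chain (comb k l) th))) => l /=.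
by rewrite push1 act1 ext1 push_push.
Qed.

Definition sbd k : sing k.+1 -> sing k := act k (bd << units R k.+1 >>).
HB.instance Definition _ k := GRing.Additive.on (@sbd k).

Lemma supp_units k : supp_in (in_list k (dsimp R k)) << units R k >>.
Proof. by apply: supp_inU; split; [exact: size_units|exact: dsimp_units]. Qed.

Lemma supp_in_list_bd k (V : lmodType R) (C : set V) c :
  supp_in (in_list k.+1 C) c -> supp_in (in_list k C) (bd c).
Proof.
apply: supp_in_ext => l [sl Cl]; apply: supp_inW (@supp_in_list_boundary _ l).
move=> _ [l1 [x [l2 [El ->]]]]; split.
  by move: sl; rewrite El !size_cat /= addnS => -[].
by move=> y yl; apply: Cl; move: yl; rewrite El !mem_cat inE => /orP[->|->];
  rewrite ?orbT.
Qed.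

Lemma sbd_push k (V : lmodType R) (G : V -> W) c : of_size k.+1 c ->
  sbd (push k.+1 G c) = push k G (bd c).
Proof.
move=> kc; rewrite /sbd act_push; last exact/supp_in_list_bd/supp_units.
congr push; move: c kc; apply: (eq_additive_in (f := ext _) (g := bd)) => l sl /=.
by rewrite ext1 map_chain_bd map_chain1 map_comb_units.
Qed.

Lemma sbd1 k s : sbd << s >> = push k s (bd << units R k.+1 >>).
Proof. exact: act1. Qed.

Lemma sbd_sbd k (c : sing k.+2) : sbd (sbd c) = 0.
Proof.
move: c; apply: (@eq_additive _ _ (@sbd k \o @sbd k.+1) \0) => s /=.
rewrite sbd1 sbd_push ?bd_bd ?raddf0 //.
by apply: of_size_bd; apply: supp_inU; exact: size_units.
Qed.

Definition cycle k : sing k -> Prop :=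
  if k is k'.+1 then fun c => sbd c = 0 else fun=> True.

Definition sing_in k (U : set W) (s : 'rV[R]_k -> W) :=
  [/\ cont_on (dsimp R k) s, forall t, dsimp R k t -> U (s t)
    & forall t, ~ dsimp R k t -> s t = 0].

Lemma sing_in_restr k U (s : 'rV[R]_k -> W) :
  cont_on (dsimp R k) s -> (forall t, dsimp R k t -> U (s t)) ->
  sing_in U (restr s).
Proof.
move=> cs Us; split.
- by apply: cont_on_eq cs => t tS; rewrite restrT.
- by move=> t tS; rewrite restrT //; exact: Us.
- by move=> t tS; rewrite /restr; case: ifP => // /set_mem.
Qed.

Lemma restr_id k U (s : 'rV[R]_k -> W) : sing_in U s -> restr s = s.
Proof.
case=> _ _ s0; apply/funext => t; rewrite /restr; case: ifPn => //.
by move/negP => tS; rewrite s0 // => /mem_set.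
Qed.

Lemma sing_inW k (U U' : set W) (s : 'rV[R]_k -> W) :
  U `<=` U' -> sing_in U s -> sing_in U' s.
Proof. by move=> UU' [cs Us s0]; split => // t /Us /UU'. Qed.

Lemma push_sing_in k (V : normedModType R) (C : set V) (G : V -> W) U c :
  convex_closed C -> cont_on C G -> (forall x, C x -> U (G x)) ->
  supp_in (in_list k C) c -> supp_in (sing_in U) (push k G c).
Proof.
move=> cC cG UG; apply: supp_in_ext => l [sl Cl]; apply: supp_inU.
have hC t : dsimp R k t -> C (comb k l t) by exact: comb_in.
apply: sing_in_restr => [|t /hC /UG //]; apply: cont_on_comp cG hC.
exact/cont_on_continuous/continuous_comb.
Qed.

Lemma act_sing_in k k' (th : {freeg (seq 'rV[R]_k) / int}) U c :
  supp_in (in_list k' (dsimp R k)) th ->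
  supp_in (sing_in U) c -> supp_in (sing_in U) (act k' th c).
Proof.
move=> thS; apply: supp_in_ext => s [cs Us _].
by apply: push_sing_in thS => //; exact: convex_dsimp.
Qed.

Lemma sbd_sing_in k U (c : sing k.+1) :
  supp_in (sing_in U) c -> supp_in (sing_in U) (sbd c).
Proof. by apply: act_sing_in; exact/supp_in_list_bd/supp_units. Qed.

Lemma act_units k U (c : sing k) : supp_in (sing_in U) c ->
  act k << units R k >> c = c.
Proof.
move: c; apply: (@eq_additive_in _ _ _ (act k << units R k >>) idfun) => s sU /=.
rewrite act1 push1 -[in RHS](restr_id sU); congr (<< _ >>);
  apply: eq_restr => t _ /=.
by rewrite comb_units.
Qed.

(** [th] is the model of an operation [TH] on lists; by naturality, operating on each face of a
    simplex amounts to applying [TH] to the boundary of the model. *)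
Lemma act_sbd k k' (th : {freeg (seq 'rV[R]_k) / int})
    (TH : {additive {freeg (seq 'rV[R]_k.+1) / int} ->
      {freeg (seq 'rV[R]_k.+1) / int}}) c :
  supp_in (in_list k' (dsimp R k)) th ->
  (forall l : seq 'rV[R]_k.+1, size l = k ->
    map_chain (comb k l) th = TH << l >>) ->
  act k' th (sbd c) = act k' (TH (bd << units R k.+1 >>)) c.
Proof.
move=> thS thTH; move: c; apply: (@eq_additive _ _ (act k' th \o @sbd k)
  (act k' (TH (bd << units R k.+1 >>)))) => s /=.
rewrite sbd1 act_push // act1; congr push.
have : of_size k (bd << units R k.+1 >>).
  by apply: of_size_bd; apply: supp_inU; exact: size_units.
move: (bd _); apply: (eq_additive_in (f := ext _) (g := TH)) => l sl /=.
by rewrite ext1 thTH.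
Qed.

Section SubdivideSingular.
Variable j : nat.

Definition ssub k : sing k -> sing k := act k (subdivn j << units R k >>).
HB.instance Definition _ k := GRing.Additive.on (@ssub k).
Definition shom k : sing k -> sing k.+1 :=
  act k.+1 (subdivn_homotopy j k << units R k >>).
HB.instance Definition _ k := GRing.Additive.on (@shom k).

Lemma in_list_hull k n (V : lmodType R) (C : set V) l (c : {freeg (seq V) / int}) :
  convex_closed C -> in_list n C l ->
  supp_in (fun l' => size l' = k /\ {in l', forall y, hull l y}) c ->
  supp_in (in_list k C) c.
Proof.
move=> cC [_ Cl]; apply: supp_inW => l' [sl' hl']; split => // y /hl'.
exact.
Qed.

Lemma supp_ssub k : supp_in (in_list k (dsimp R k)) (subdivn j << units R k >>).
Proof.
apply: (@in_list_hull _ k _ _ (units R k)); first exact: convex_dsimp.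
  by split; [exact: size_units|exact: dsimp_units].
by have := @subdivn_hull R _ j (units R k); rewrite size_units.
Qed.

Lemma supp_shom k :
  supp_in (in_list k.+1 (dsimp R k)) (subdivn_homotopy j k << units R k >>).
Proof.
apply: (@in_list_hull _ k _ _ (units R k)); first exact: convex_dsimp.
  by split; [exact: size_units|exact: dsimp_units].
by apply: subdivn_homotopy_hull; exact: size_units.
Qed.

Lemma sbd_ssub k (c : sing k.+1) : sbd (ssub c) = ssub (sbd c).
Proof.
rewrite /ssub (act_sbd _ (TH := @subdivn R _ j)); last first.
- by move=> l sl; rewrite -subdivn_map map_chain1 map_comb_units.
- exact: supp_ssub.
move: c; apply: (@eq_additive _ _ (@sbd k \o act k.+1
  (subdivn j << units R k.+1 >>))
  (act k (subdivn j (bd << units R k.+1 >>)))) => s /=.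
rewrite !act1 -bd_subdivn; apply: sbd_push.
by apply: supp_inW (@supp_ssub k.+1) => l [].
Qed.

Lemma ssub_sing_in k U c :
  supp_in (@sing_in k U) c -> supp_in (sing_in U) (ssub c).
Proof. by apply: act_sing_in; exact: supp_ssub. Qed.

Lemma ssub_homologous k U (c : sing k) : supp_in (sing_in U) c -> cycle c ->
  supp_in (sing_in U) (shom c) /\ sbd (shom c) = c - ssub c.
Proof.
move=> cU cc; split; first by apply: act_sing_in cU; exact: supp_shom.
have -> : sbd (shom c) = act k (bd (subdivn_homotopy j k << units R k >>)) c.
  move: c {cU cc}; apply: (@eq_additive _ _ (@sbd k \o @shom k)
    (act k (bd (subdivn_homotopy j k << units R k >>)))) => s /=.
  rewrite /shom !act1; apply: sbd_push.
  by apply: supp_inW (@supp_shom k) => l [].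
rewrite bd_subdivn_homotopy; last by apply: supp_inU; exact: size_units.
(* The last term is the homotopy applied to [sbd c], which is 0 for a cycle; for [k = 0] the model
   simplex has no faces. *)
rewrite !act_is_additive (act_units cU) [X in _ - X](_ : _ = 0) ?subr0 //.
case: k c cc cU => [|k] c /= cc cU.
  rewrite (_ : bd << units R 0 >> = 0).
    by rewrite raddf0 -[0](subrr (0 : {freeg (seq 'rV[R]_0)/int}))
      act_is_additive subrr.
  by rewrite (size0nil (size_units R 0)) bd_nil.
rewrite -(@act_sbd _ _ (subdivn_homotopy j k << units R k >>)).
- by rewrite cc raddf0.
- exact: supp_shom.
move=> l sl; rewrite -subdivn_homotopy_map ?map_chain1 ?map_comb_units //.
by apply: supp_inU; exact: size_units.
Qed.

End SubdivideSingular.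

Definition vert k : sing k -> {freeg (seq W) / int} :=
  ext (fun s : 'rV[R]_k -> W => << map s (units R k) >>).
HB.instance Definition _ k := GRing.Additive.on (@vert k).

Lemma vert_push k (V : lmodType R) (G : V -> W) c : of_size k c ->
  vert (push k G c) = map_chain G c.
Proof.
move: c; apply: (eq_additive_in (f := @vert k \o push k G) (g := map_chain G))
  => l sl /=.
rewrite push1 /vert ext1 map_chain1; congr (<< _ >>).
rewrite -[in RHS](map_comb_units sl) -[RHS]map_comp; apply/eq_in_map => x xu /=.
by rewrite restrT //; exact: dsimp_units xu.
Qed.

Lemma bd_vert k (c : sing k.+1) : bd (vert c) = vert (sbd c).
Proof.
move: c; apply: (@eq_additive _ _ (bd \o @vert k.+1) (@vert k \o @sbd k)) => s /=.
rewrite sbd1 vert_push; last by apply: of_size_bd; apply: supp_inU;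
  exact: size_units.
by rewrite map_chain_bd map_chain1 /vert ext1.
Qed.

Lemma of_size_vert k (c : sing k) : of_size k (vert c).
Proof.
apply: (@supp_in_ext _ _ (fun=> True)) => // s _.
by apply: supp_inU; rewrite size_map size_units.
Qed.

Lemma vert_cycle k (c : sing k) : cycle c -> bd (vert c) = 0.
Proof.
case: k c => [|k] c /= cc; last by rewrite bd_vert cc raddf0.
by have [a ->] := of_size0 (@of_size_vert 0 c);
  rewrite freegU_scale scale_mulz raddfMz /= bd_nil mul0rz.
Qed.

End SingularChains.

(** * Pushforward of singular chains *)

Section Forward.
Variables (R : realType) (m m' : nat) (f : 'rV[R]_m -> 'rV[R]_m').

Definition fwd k : sing R m k -> sing R m' k :=
  ext (fun s : 'rV[R]_k -> 'rV[R]_m => << restr (f \o s) >>).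
HB.instance Definition _ k := GRing.Additive.on (@fwd k).

Lemma fwd1 k s : @fwd k << s >> = << restr (f \o s) >>.
Proof. exact: ext1. Qed.

Lemma fwd_push k (V : lmodType R) (G : V -> 'rV[R]_m) c :
  fwd (push k G c) = push k (f \o G) c.
Proof.
move: c; apply: (@eq_additive _ _ (@fwd k \o push k G) (push k (f \o G))) => l /=.
rewrite !push1 fwd1; congr (<< _ >>); apply: eq_restr => t tS /=.
by rewrite restrT.
Qed.

Lemma sbd_fwd k (c : sing R m k.+1) : sbd (fwd c) = fwd (sbd c).
Proof.
move: c; apply: (@eq_additive _ _ (@sbd R m' k \o @fwd k.+1)
  (@fwd k \o @sbd R m k)) => s /=.
rewrite fwd1 !sbd1 fwd_push; apply: eq_push; first exact: convex_dsimp.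
  by move=> t tS; rewrite restrT.
exact/supp_in_list_bd/supp_units.
Qed.

Lemma fwd_cycle k (c : sing R m k) : cycle c -> cycle (fwd c).
Proof. by case: k c => [//|k] c /= cc; rewrite sbd_fwd cc raddf0. Qed.

Lemma fwd_sing_in k (U : set 'rV[R]_m) (U' : set 'rV[R]_m') (c : sing R m k) :
  cont_on U f -> (forall x, U x -> U' (f x)) ->
  supp_in (sing_in U) c -> supp_in (sing_in U') (fwd c).
Proof.
move=> cf UU'; apply: supp_in_ext => s [cs Us _]; apply: supp_inU.
apply: sing_in_restr => [|t /Us /UU' //]; exact: cont_on_comp cf Us.
Qed.

End Forward.

Section PrismLists.
Variables (T T' : choiceType) (i0 i1 : T -> T').

Lemma supp_prism_list l :
  supp_in (fun l' => size l' = (size l).+1 /\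
     {in l', forall y, exists2 x, x \in l & y = i0 x \/ y = i1 x})
    (prism_list i0 i1 l).
Proof.
elim: l => [|x l IH] /=; first exact: supp_in0.
apply: supp_inB.
  apply: supp_inU; split; first by rewrite /= size_map.
  move=> y; rewrite !inE => /or3P[/eqP->|/eqP->|/mapP[z zl ->]].
  - by exists x; [rewrite mem_head|left].
  - by exists x; [rewrite mem_head|right].
  - by exists z; [rewrite inE zl orbT|right].
apply: supp_in_ext IH => l' [sl' h]; apply: supp_inU; split;
  first by rewrite /= sl'.
move=> y; rewrite inE => /predU1P[->|/h[z zl yz]].
  by exists x; [rewrite mem_head|left].
by exists z => //; rewrite inE zl orbT.
Qed.

End PrismLists.

Lemma prism_map (T1 T2 T1' T2' : choiceType) (i0 i1 : T1 -> T1') (j0 j1 : T2 -> T2')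
    (f : T1 -> T2) (g : T1' -> T2') c :
  (forall x, g (i0 x) = j0 (f x)) -> (forall x, g (i1 x) = j1 (f x)) ->
  prism j0 j1 (map_chain f c) = map_chain g (prism i0 i1 c).
Proof.
move=> g0 g1; move: c; apply: (@eq_additive _ _ (prism j0 j1 \o map_chain f)
  (map_chain g \o prism i0 i1)) => l /=.
rewrite map_chain1; elim: l => [|x l IH].
  by rewrite /prism !ext1 raddf0.
rewrite /= -cone1 -[in RHS]cone1 !prism_cone raddfB /= !map_chain_cone IH g0 g1.
by rewrite !map_chain1 -!map_comp; congr (cone _ (cone _ << _ >>) - _);
  apply: eq_map => y /=; rewrite g1.
Qed.

(** * Homotopies given simplex by simplex *)

Section Prism.
Variables (R : realType) (m : nat).
Notation W := 'rV[R]_m.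

Local Notation P2 k := ('rV[R]_k * R^o)%type.
Definition bottom k (x : 'rV[R]_k) : P2 k := (x, 0).
Definition lid k (x : 'rV[R]_k) : P2 k := (x, 1).
Definition cylinder k : set (P2 k) := [set p | dsimp R k p.1 /\ 0 <= p.2 <= 1].

Lemma sum_pair k n (w : 'I_n -> R) (p : 'I_n -> P2 k) :
  \sum_i w i *: p i = (\sum_i w i *: (p i).1, \sum_i w i * (p i).2) :> P2 k.
Proof.
by elim/big_rec3: _ => [//|i x y z _ ->].
Qed.

Lemma comb_level k (a : R^o) (t : 'rV[R]_k) : dsimp R k t ->
  comb k [seq (x, a) : P2 k | x <- units R k] t = (t, a).
Proof.
move=> [_ t1]; rewrite /comb sum_pair; congr pair.
  rewrite -[RHS]comb_units; apply: eq_bigr => i _.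
  by rewrite (nth_map 0) ?size_units.
rewrite -[RHS]mul1r -[in RHS]t1 mulr_suml; apply: eq_bigr => i _.
by rewrite (nth_map 0) ?size_units.
Qed.

Lemma convex_cylinder k : convex_closed (@cylinder k).
Proof.
move=> n w p w0 w1 hp; rewrite sum_pair; split => /=.
  by apply: convex_dsimp => // i; case: (hp i).
have p01 i : 0 <= (p i).2 <= 1 by case: (hp i).
apply/andP; split.
  by apply: sumr_ge0 => i _; apply: mulr_ge0 => //; case/andP: (p01 i).
rewrite -w1; apply: ler_sum => i _; rewrite ler_piMr //.
by case/andP: (p01 i).
Qed.

Variables (U : set W) (v : W -> W) (good : forall k, ('rV[R]_k -> W) -> Prop).
Variable h : forall k, ('rV[R]_k -> W) -> 'rV[R]_k * R^o -> W.
Arguments h {k}.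
Hypothesis cont_h : forall k s, good s -> cont_on (@cylinder k) (h s).
Hypothesis h_in : forall k s p, good s -> @cylinder k p -> U (h s p).
Hypothesis h0 : forall k (s : 'rV[R]_k -> W) x, good s -> dsimp R k x ->
  h s (x, 0) = s x.
Hypothesis h1 : forall k (s : 'rV[R]_k -> W) x, good s -> dsimp R k x ->
  h s (x, 1) = comb k (map v (map s (units R k))) x.
Hypothesis h_face : forall k (s : 'rV[R]_k.+1 -> W) l x t, good s -> size l = k ->
  {subset l <= units R k.+1} -> dsimp R k x -> 0 <= t <= 1 ->
  h (restr (s \o comb k l)) (x, t) = h s (comb k l x, t).

Definition side k (l : seq 'rV[R]_k.+1) (p : P2 k) : P2 k.+1 := (comb k l p.1, p.2).

Lemma side_linear k l : linear (@side k l).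
Proof. by move=> a p q; rewrite /side linearP. Qed.

HB.instance Definition _ k l := GRing.isLinear.Build R (P2 k) (P2 k.+1) _
  (@side k l) (@side_linear k l).

Definition prism_units k := prism (@bottom k) (@lid k) << units R k >>.

Lemma supp_prism_units k : supp_in (in_list k.+1 (@cylinder k)) (prism_units k).
Proof.
rewrite /prism_units /prism ext1.
apply: supp_inW (@supp_prism_list _ _ (@bottom k) (@lid k) (units R k)) => l
  [sl hl].
split; first by rewrite sl size_units.
move=> y /hl[x /dsimp_units xS] [->|->]; split => //=; by rewrite ?lexx ler01.
Qed.

Definition homotop k : sing R m k -> sing R m k.+1 :=
  ext (fun s : 'rV[R]_k -> W => push k.+1 (h s) (prism_units k)).

HB.instance Definition _ k := GRing.Additive.on (@homotop k).

Lemma homotop_push k (s : 'rV[R]_k.+1 -> W) : good s ->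
  homotop (push k s (bd << units R k.+1 >>)) =
  push k.+1 (h s) (prism (@bottom k.+1) (@lid k.+1) (bd << units R k.+1 >>)).
Proof.
move=> gs.
have : supp_in (fun l => size l = k /\ {subset l <= units R k.+1})
  (bd << units R k.+1 >>).
  rewrite bd1; apply: supp_inW (@supp_in_list_boundary _ (units R k.+1)).
  move=> _ [l1 [x [l2 [El ->]]]]; split.
    by have := size_units R k.+1; rewrite El !size_cat /= addnS => -[].
  move=> y yl; rewrite El; move: yl; rewrite !mem_cat inE => /orP[->//|->].
  by rewrite !orbT.
move: (bd _); apply: (@eq_additive_in _ _ _ (@homotop k \o push k s)
  (push k.+1 (h s) \o prism (@bottom k.+1) (@lid k.+1))) => l [sl ul] /=.
rewrite push1 /homotop ext1 -{2}(map_comb_units sl) -map_chain1.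
rewrite (@prism_map _ _ _ _ (@bottom k) (@lid k) _ _ (comb k l) (@side k l)) //.
move: (@supp_prism_units k); rewrite /prism_units; move: (prism _ _ _).
apply: (@eq_additive_in _ _ _ (push k.+1 (h (restr (s \o comb k l))))
  (push k.+1 (h s) \o map_chain (@side k l))) => l' [sl' cl'] /=.
rewrite map_chain1 !push1; congr (<< _ >>); apply: eq_restr => t tS /=.
rewrite -(@linear_comb R k.+1 (P2 k) (P2 k.+1) (@side k l)).
have [] : cylinder (comb k.+1 l' t) by exact: comb_in (@convex_cylinder k) sl'
  cl' tS.
by rewrite /side; case: (comb k.+1 l' t) => x u /= xS u01; exact: h_face.
Qed.

(** Each simplex has its own homotopy [h s], and [h_face] makes these agree on faces, so the side
    walls of the prisms cancel over a cycle. It is applied to the straight homotopy towards vertices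
    and to a contraction, where [v] is constant. *)
Lemma prism_homologous k (U0 : set W) (c : sing R m k) :
  supp_in (@good k) c -> supp_in (sing_in U0) c -> cycle c ->
  exists b : sing R m k.+1, supp_in (sing_in U) b /\
    sbd b = push k idfun (map_chain v (vert c)) - c.
Proof.
move=> gc c0 cc; exists (homotop c); split.
  apply: supp_in_ext gc => s gs.
  apply: push_sing_in (@convex_cylinder k) (cont_h gs) _ (@supp_prism_units k).
  by move=> p; exact: h_in.
have E : sbd (homotop c) =
    ext (fun s : 'rV[R]_k -> W => push k (h s) (bd (prism_units k))) c.
  move: c {gc c0 cc}; apply: (@eq_additive _ _ (@sbd R m k \o @homotop k)
    (ext (fun s : 'rV[R]_k -> W => push k (h s) (bd (prism_units k))))) => s /=.
  rewrite /homotop !ext1; apply: sbd_push.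
  by apply: supp_inW (@supp_prism_units k) => l [].
suff Z : ext (fun s : 'rV[R]_k -> W =>
    push k (h s) (prism (@bottom k) (@lid k) (bd << units R k >>))) c = 0.
  rewrite {}E -[RHS]subr0 -{}Z; move: (supp_inI gc c0) => {gc c0 cc}; move: c.
  apply: (@eq_additive_in _ _ _ (ext _)
    (((push k idfun \o (map_chain v \o @vert R m k)) \- idfun) \- ext _)) => s
      [gs s0] /=.
  rewrite !ext1 /prism_units bd_prism !raddfB /= !map_chain1 !push1.
  rewrite /vert ext1 map_chain1 push1; congr (<< _ >> - << _ >> - _).
    apply: eq_restr => t tS /=; rewrite -h1 //; congr h.
    exact: comb_level.
  rewrite -[RHS](restr_id s0); apply: eq_restr => t tS /=.
  by rewrite comb_level ?h0.
case: k c gc c0 cc {E} => [|k] c gc c0 cc.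
  have -> : bd << units R 0 >> = 0 by rewrite (size0nil (size_units R 0)) bd_nil.
  move: c {gc c0 cc}; apply: (@eq_additive _ _ (ext _) \0) => s /=.
  by rewrite ext1 !raddf0.
transitivity (homotop (sbd c)); last by rewrite cc raddf0.
move: c gc {c0 cc}; apply: (@eq_additive_in _ _ _ (ext _)
  (@homotop k \o @sbd R m k)) => s gs /=.
by rewrite ext1 sbd1 homotop_push.
Qed.

End Prism.

(** * Lebesgue numbers and fine subdivisions *)

Section Compactness.
Variable R : realType.

Lemma continuous_coord k (j : 'I_k) : continuous (fun x : 'rV[R]_k => x ord0 j).
Proof. exact: coord_continuous. Qed.

Lemma continuous_sum_coord k (P : pred 'I_k) :
  continuous (fun x : 'rV[R]_k => \sum_(j | P j) x ord0 j).
Proof.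
move=> t; apply: (@cvg_big R^o _ +%R 0 P add_continuous _ (nbhs t) (index_enum _)
  (fun j (t : 'rV[R]_k) => t ord0 j)) => j _.
exact: coord_continuous.
Qed.

Lemma dsimp_le1 k (x : 'rV[R]_k) j : dsimp R k x -> x ord0 j <= 1.
Proof.
by move=> [x0 <-]; rewrite (bigD1 j) //= lerDl sumr_ge0.
Qed.

Lemma closed_dsimp k : closed (dsimp R k).
Proof.
have -> : dsimp R k = (\bigcap_(j in [set: 'I_k]) [set x | 0 <= x ord0 j]) `&`
    [set x | \sum_j x ord0 j = 1].
  apply/seteqP; split => x /= [x0 x1]; split => // j; last exact: (x0 j).
  by move=> _; exact: x0.
apply: closedI.
  apply: closed_bigI => j _.
  apply: (@preimage_closed _ _ (fun x : 'rV[R]_k => x ord0 j) [set y | 0 <= y]).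
    by move=> x _; exact: continuous_coord.
  exact: closed_ge.
apply: (@preimage_closed _ _ (fun x : 'rV[R]_k => \sum_j x ord0 j) [set y | y = 1]).
  by move=> x _; exact: continuous_sum_coord.
exact: closed_eq.
Qed.

Lemma compact_dsimp k : compact (dsimp R k).
Proof.
have cbox : compact [set x : 'rV[R]_k | forall i, `[0, 1]%classic (x ord0 i)].
  by apply: (@rV_compact R k (fun=> `[0, 1]%classic)) => _; exact: segment_compact.
apply: subclosed_compact (@closed_dsimp k) cbox _ => x xS i /=.
by rewrite in_itv /= (proj1 xS) dsimp_le1.
Qed.

Lemma ball_coord k (x y : 'rV[R]_k) e : 0 < e ->
  (forall i, `|x ord0 i - y ord0 i| < e) -> ball x e y.
Proof. by move=> e0 h; split => // i j; rewrite (ord1 i); exact: h. Qed.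

(** The hereditary predicate [good] plays the role of lying in one member of an open cover;
    compactness of the simplex is used as a near-covering property, which gives a uniform [d]. *)
Lemma lebesgue_number k (T : topologicalType) (U : set T) (s : 'rV[R]_k -> T)
    (good : set T -> Prop) :
  cont_on (dsimp R k) s -> (forall t, dsimp R k t -> U (s t)) ->
  good set0 -> (forall A B, B `<=` A -> good A -> good B) ->
  (forall w, U w -> exists2 N, nbhs w N & good (N `&` U)) ->
  exists2 d, 0 < d & forall A, A `<=` dsimp R k ->
    (forall x y, A x -> A y -> coord_close d x y) -> good (s @` A).
Proof.
move=> cs Us good0 goodW goodU.
have /compact_near_coveringP/near_covering_withinP cov := @compact_dsimp k.
pose P (d : R) (x : 'rV[R]_k) := forall A, A `<=` dsimp R k -> A x ->
  (forall x y, A x -> A y -> coord_close d x y) -> good (s @` A).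
have [e /= e0 eP] : \forall d \near (0 : R)^'+, dsimp R k `<=` P d.
  apply: (cov R (0 : R)^'+ P) => x xS.
  have [N Nx gN] := goodU _ (Us _ xS).
  have : nbhs x (fun y => dsimp R k y -> N (s y)) by exact: (cs _ xS _ Nx).
  move=> /nbhs_ballP[r /= r0 rN].
  exists (ball x (r / 2), [set d | d < r / 2]) => /=.
    split; first by apply: nbhsx_ballx; rewrite divr_gt0.
    by apply: nbhs_right_lt; rewrite divr_gt0.
  move=> [x' d] /= [xx' dr] x'S A AS Ax' mA.
  apply: goodW gN => _ [y Ay <-]; split; last exact/Us/AS.
  apply: rN; last exact: AS.
  apply: (ball_split xx').
  apply: ball_coord => [|i]; first by rewrite divr_gt0.
  by apply: le_lt_trans dr; exact: mA.
have [d d0 dP] : exists2 d : R, 0 < d & dsimp R k `<=` P d.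
  exists (e / 2); first by rewrite divr_gt0.
  apply: eP; last by rewrite divr_gt0.
  by rewrite /= sub0r normrN gtr0_norm ?divr_gt0 // ltr_pdivrMr // mulr2n mulrDr
    mulr1 ltrDl.
exists d => // A AS mA; have [[x Ax]|/forallNP A0] := pselect (exists x, A x).
  exact: (dP x (AS _ Ax) A).
rewrite (_ : s @` A = set0) //; apply/seteqP; split => // y [x Ax _].
by case: (A0 x).
Qed.

Lemma hull_close k d (l : seq 'rV[R]_k) x y : mesh_le d l ->
  hull l x -> hull l y -> coord_close d x y.
Proof.
move=> ml hx hy; apply: (hy (coord_close d x) (@convex_coord_close _ _ d x)) =>
  z zl i.
rewrite distrC; move: i; apply: (hx (coord_close d z)
  (@convex_coord_close _ _ d z)) => w wl.
by move=> i; apply: ml.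
Qed.

Lemma units_close k : mesh_le 1 (units R k).
Proof.
move=> x y /dsimp_units xS /dsimp_units yS i.
by rewrite ler_distl; have := dsimp_le1 i xS; have := dsimp_le1 i yS;
  have := proj1 xS i; have := proj1 yS i; lra.
Qed.

Lemma shrink_small k (d : R) : 0 < d ->
  exists j0, forall j, (j0 <= j)%N -> shrink R k ^+ j <= d.
Proof.
move=> d0; have /cvgr0_norm_lt/(_ _ d0) : GRing.exp (shrink R k) @ \oo --> (0 : R).
  by apply: cvg_expr; rewrite ger0_norm ?shrink_ge0 ?shrink_lt1.
case=> j0 _ h; exists j0 => j /h /=.
by rewrite ger0_norm ?exprn_ge0 ?shrink_ge0 // => /ltW.
Qed.

(** A chain has finitely many simplices, so their thresholds have a maximum. [good] will be a bound
    on the diameter, or avoiding one of two closed sets. *)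
Lemma small_subdivision m k (U : set 'rV[R]_m) (good : set 'rV[R]_m -> Prop)
    (c : sing R m k) :
  good set0 -> (forall A B, B `<=` A -> good A -> good B) ->
  (forall w, U w -> exists2 N, nbhs w N & good (N `&` U)) ->
  supp_in (sing_in U) c ->
  exists j0, forall j, (j0 <= j)%N ->
    supp_in (fun s : 'rV[R]_k -> 'rV[R]_m => good (s @` dsimp R k)) (ssub j c).
Proof.
move=> good0 goodW goodU; move: c; apply: supp_in_ind.
  by exists 0 => j _; rewrite raddf0; exact: supp_in0.
move=> a s c [cs Us _] [j1 IH].
have [d d0 small] := lebesgue_number cs Us good0 goodW goodU.
have [j2 j2P] := shrink_small k d0.
exists (maxn j1 j2) => j; rewrite geq_max => /andP[/IH{}IH /j2P jd].
rewrite raddfD /=; apply: supp_inD => //.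
rewrite freegU_scale scale_mulz raddfMz -scale_mulz; apply: supp_inZ.
rewrite /= /ssub act1.
have := supp_inI (@supp_ssub R j k)
  (@subdivn_mesh R k j _ _ _ (size_units R k) ler01 (@units_close k)).
apply: supp_in_ext => l [[sl Sl] ml]; apply: supp_inU.
apply: (goodW (s @` (comb k l @` dsimp R k))).
  by move=> _ [t tS <-]; exists (comb k l t); rewrite ?restrT //; exists t.
apply: small => [_ [t tS <-]|_ _ [t tS <-] [t' t'S <-] i].
  exact: comb_in (@convex_dsimp R k) sl Sl tS.
have hl u : dsimp R k u -> hull l (comb k l u).
  by apply: comb_in => //; [exact: convex_hull|exact: mem_hull].
apply: le_trans (hull_close ml (hl _ tS) (hl _ t'S) i) _.
by rewrite mul1r.
Qed.

End Compactness.

(** * Comparison of singular and simplicial chains *)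

Section Comparison.
Variables (R : realType) (m : nat) (v0 : 'I_m) (L : {set {set 'I_m}}).
Hypothesis cxL : simplicial_complex L.
Notation W := 'rV[R]_m.
Notation vchain := {freeg (seq 'I_m) / int}.

Definition in_cx (l : seq 'I_m) : Prop := [set x in l]%SET \in L.

Lemma in_cx_closed : subset_closed in_cx.
Proof.
move=> l l' lL ll'; apply: (proj2 cxL) lL _; apply/fintype.subsetP => x.
by rewrite !inE; exact: ll'.
Qed.

Definition spt (x : W) : {set 'I_m} := [set i | x ord0 i != 0]%SET.

Lemma realizationE x : realization L x <-> dsimp R m x /\ spt x \in L.
Proof. by split => [[]|[[]]]. Qed.

Definition pt (i : 'I_m) : W := delta_mx ord0 i.

Definition vtx (x : W) : 'I_m := [arg max_(i > v0) x ord0 i]%O.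

(** The largest barycentric coordinate is at least [1 / m], so it stays positive within half that
    distance. *)
Definition smallness : R := (2 * m%:R)^-1.

Lemma vtx_gt x : dsimp R m x -> smallness < x ord0 (vtx x).
Proof.
move=> [x0 x1]; have m0 : 0 < m%:R :> R by rewrite ltr0n
  (leq_ltn_trans _ (ltn_ord v0)).
suff : m%:R^-1 <= x ord0 (vtx x).
  apply: lt_le_trans; rewrite ltf_pV2 ?posrE ?mulr_gt0 //.
  by rewrite ltr_pMl // ltr1n.
rewrite -[_^-1]mulr1 -[X in _ * X]x1 ler_pdivrMl //.
apply: (@le_trans _ _ (\sum_(j < m) x ord0 (vtx x))).
  apply: ler_sum => j _; rewrite /vtx; case: arg_maxP => // i _; exact.
by rewrite sumr_const card_ord mulr_natl.
Qed.

Lemma vtx_near x y : dsimp R m x -> coord_close smallness x y -> 0 < y ord0 (vtx x).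
Proof.
move=> xS xy; have := vtx_gt xS; have := xy (vtx x).
by rewrite ler_distl; lra.
Qed.

Lemma pt_in_dsimp i : dsimp R m (pt i).
Proof.
have := dsimp_units (k := m) (R := R); apply.
by apply/mapP; exists i; rewrite ?mem_enum.
Qed.

Lemma hull_pt l x : hull (map pt l) x ->
  dsimp R m x /\ {subset spt x <= l}.
Proof.
move=> hx; apply: (hx [set x | dsimp R m x /\ {subset spt x <= l}]).
  move=> n w p w0 w1 hp; split.
    by apply: convex_dsimp => // i; case: (hp i).
  move=> i; rewrite inE summxE; apply: contraR => il; apply/eqP.
  apply: big1 => j _; rewrite mxE; have [->|pji] := eqVneq (p j ord0 i) 0.
    by rewrite mulr0.
  by case: (hp j) => _ /(_ i); rewrite inE pji (negbTE il) => /(_ isT).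
move=> _ /mapP[i il ->]; split; first exact: pt_in_dsimp.
move=> j; rewrite inE mxE eqxx /=.
by case: (j =P i) => [->//|_]; rewrite eqxx.
Qed.

Lemma hull_pt_realization l : in_cx l -> (hull (map pt l) `<=` realization L).
Proof.
move=> lL x /hull_pt[xS sx]; apply/realizationE; split => //.
apply: (proj2 cxL) lL _; apply/fintype.subsetP => i /sx.
by rewrite inE.
Qed.

Definition affine_sing k : vchain -> sing R m k := push k idfun \o map_chain pt.
HB.instance Definition _ k := GRing.Additive.on (@affine_sing k).

Lemma sbd_affine k c : of_size k.+1 c ->
  sbd (affine_sing k.+1 c) = affine_sing k (bd c).
Proof.
by move=> kc; rewrite /affine_sing /= sbd_push ?map_chain_bd //;
  exact: of_size_map_chain.
Qed.

Lemma affine_sing_in k c : of_size k c -> supp_in in_cx c ->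
  supp_in (sing_in (realization L)) (affine_sing k c).
Proof.
move=> kc Lc; rewrite additive_extE;
  apply: supp_in_ext (supp_inI kc Lc) => l [sl lL].
rewrite /= /affine_sing /= map_chain1.
apply: (@push_sing_in _ _ _ _ _ _ _ _ (@convex_hull _ _ (map pt l))).
- exact: cont_on_continuous (fun=> cvg_id).
- exact: hull_pt_realization.
- by apply: supp_inU; split; [rewrite size_map|exact: mem_hull].
Qed.

Lemma ssub_push k j (V : lmodType R) (G : V -> W) c : of_size k c ->
  ssub j (push k G c) = push k G (subdivn j c).
Proof.
move=> kc; rewrite /ssub act_push; last exact: supp_ssub.
congr push; move: c kc; apply: (eq_additive_in (f := ext _)
  (g := @subdivn R V j)) => l sl /=.
by rewrite ext1 -subdivn_map map_chain1 map_comb_units.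
Qed.

Definition tight (A : set W) := forall x y, A x -> A y -> coord_close smallness x y.

Lemma tight_local w : realization L w ->
  exists2 N, nbhs w N & tight (N `&` realization L).
Proof.
have m0 : 0 < smallness.
  by rewrite invr_gt0 mulr_gt0 // ltr0n (leq_ltn_trans _ (ltn_ord v0)).
move=> _; exists (ball w (smallness / 2)).
  by apply: nbhsx_ballx; rewrite divr_gt0.
move=> x y [[_ wx] _] [[_ wy] _] i.
have := wx ord0 i; have := wy ord0 i; rewrite /ball /= !ltr_distl ler_distl.
by move=> /andP[? ?] /andP[? ?]; apply/andP; split; lra.
Qed.

Lemma tight_subdivision k (c : sing R m k) : supp_in (sing_in (realization L)) c ->
  exists j, supp_in (fun s => sing_in (realization L) s /\ tight
    (s @` dsimp R k)) (ssub j c).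
Proof.
move=> cL; have [||j h] := small_subdivision (good := tight) _ _ tight_local cL.
- by [].
- by move=> A B BA tA x y /BA xA /BA yA; exact: tA.
by exists j; apply: supp_inI; [exact: ssub_sing_in|exact: h].
Qed.

Lemma vtx_spt k (s : 'rV[R]_k -> W) x y : sing_in (realization L) s ->
  tight (s @` dsimp R k) -> dsimp R k x -> dsimp R k y ->
  0 < s y ord0 (vtx (s x)).
Proof.
move=> [_ sL _] ts xS yS; apply: vtx_near.
  by have /realizationE[] := sL _ xS.
by apply: ts; [exists x|exists y].
Qed.

(** By tightness all chosen vertices have positive coordinate at one common point, the image of the
    first corner; they lie in its support, which is a simplex of [L]. *)
Lemma vert_in_cx k (s : 'rV[R]_k -> W) : sing_in (realization L) s ->
  tight (s @` dsimp R k) -> in_cx (map vtx (map s (units R k))).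
Proof.
move=> sL ts; case: k s sL ts => [|k] s sL ts.
  rewrite (size0nil (size_units R 0)) /in_cx (_ : [set x in _]%SET = finset.set0).
    exact: (proj1 cxL).
  by apply/finset.setP => x; rewrite !inE.
have x0S : dsimp R k.+1 (delta_mx ord0 ord0).
  by apply: dsimp_units; apply/mapP; exists ord0; rewrite ?mem_enum.
have /realizationE[_] := let: And3 _ h _ := sL in h _ x0S.
move=> h; apply: (proj2 cxL) h _; apply/fintype.subsetP => i;
  rewrite !inE -map_comp.
move=> /mapP[x /dsimp_units xS ->]; rewrite gt_eqF //.
exact: vtx_spt.
Qed.

Lemma supp_vert k (c : sing R m k) :
  supp_in (fun s => sing_in (realization L) s /\ tight (s @` dsimp R k)) c ->
  of_size k (map_chain vtx (vert c)) /\ supp_in in_cx (map_chain vtx (vert c)).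
Proof.
move=> ct; split; first exact/of_size_map_chain/of_size_vert.
have -> : map_chain vtx (vert c) =
    ext (fun s : 'rV[R]_k -> W => << map vtx (map s (units R k)) >>) c.
  move: c {ct}; apply: (@eq_additive _ _ (map_chain vtx \o @vert R m k) (ext _))
    => s /=.
  by rewrite /vert !ext1 map_chain1.
apply: supp_in_ext ct => s [sL ts]; apply: supp_inU; exact: vert_in_cx.
Qed.

Definition vertex_approx j : vchain -> vchain :=
  map_chain vtx \o (@subdivn R W j \o map_chain pt).
HB.instance Definition _ j := GRing.Additive.on (@vertex_approx j).

(** Subdivision stays in the simplex spanned by [l], where a maximal coordinate is positive and so
    belongs to [l]. *)
Lemma carried_vertex_approx j : carried (vertex_approx j).
Proof.
move=> l; rewrite /vertex_approx /= map_chain1.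
apply: supp_in_ext (@subdivn_hull _ _ j (map pt l)) => l' [sl' hl'].
apply: supp_inU; split; first by rewrite size_map sl' size_map.
move=> _ /mapP[x /hl' /hull_pt[xS sx] ->]; apply: sx; rewrite inE gt_eqF //.
by apply: vtx_near => // i; rewrite subrr normr0 invr_ge0 mulr_ge0.
Qed.

(** The vertices of a fine subdivision of [b] form a simplicial chain. Its boundary is a vertex
    approximation of [c], homologous to [c] because that approximation is carried. *)
Lemma simplicial_bounds k (c : vchain) (b : sing R m k.+1) :
  of_size k c -> supp_in in_cx c -> bd c = 0 ->
  supp_in (sing_in (realization L)) b -> sbd b = affine_sing k c ->
  exists c', [/\ of_size k.+1 c', supp_in in_cx c' & bd c' = c].
Proof.
move=> kc Lc bc bL bb; have [j /supp_vert[]] := tight_subdivision bL.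
set c1 := map_chain _ _ => kc1 Lc1.
have bc1 : bd c1 = vertex_approx j c.
  rewrite -map_chain_bd bd_vert sbd_ssub bb /affine_sing /=.
  have kpc : of_size k (map_chain pt c) by exact: of_size_map_chain.
  rewrite ssub_push // vert_push.
    by rewrite /vertex_approx /=; congr map_chain;
      apply: (@eq_additive _ _ (map_chain idfun) idfun) => l /=;
        rewrite map_chain1 map_id.
  rewrite additive_extE; apply: supp_in_ext kpc => l sl.
  by apply: supp_inW (@subdivn_hull _ _ j l) => l' []; rewrite sl.
have [|||b2 [kb2 Lb2 bb2]] := carried_homotopic v0 (F := vertex_approx j) _ _ _
  in_cx_closed kc Lc bc.
- by move=> c2; rewrite /vertex_approx /= -map_chain_bd bd_subdivn -map_chain_bd.
- by rewrite /= /vertex_approx /= map_chain1 /= subdivn_nil map_chain1.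
- exact: carried_vertex_approx.
exists (b2 + c1); split; [exact: supp_inD|exact: supp_inD|].
by rewrite raddfD /= bb2 bc1 subrK.
Qed.

End Comparison.

(** * Singular cycles are homologous to simplicial ones *)

Section SimplicialApproximation.
Variables (R : realType) (m : nat) (v0 : 'I_m) (L : {set {set 'I_m}}).
Hypothesis cxL : simplicial_complex L.
Notation W := 'rV[R]_m.
Notation X := (@realization R m L).

Let v (x : W) : W := pt R (vtx v0 x).

Let straight k (s : 'rV[R]_k -> W) (p : 'rV[R]_k * R^o) : W :=
  (1 - p.2) *: s p.1 + p.2 *: comb k (map v (map s (units R k))) p.1.

Let good k (s : 'rV[R]_k -> W) := sing_in X s /\ tight (s @` dsimp R k).

Let straight_continuous k (s : 'rV[R]_k -> W) : good s ->
  cont_on (@cylinder R k) (straight s).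
Proof.
move=> [[cs _ _] _] p pC; rewrite /straight.
have c1 : (fun q : 'rV[R]_k * R^o => s q.1) @ within (@cylinder R k) (nbhs p)
  --> s p.1.
  apply: (@cont_on_comp _ _ _ (@cylinder R k) (dsimp R k) fst s) => //.
    by apply: cont_on_continuous => q; exact: cvg_fst.
  by move=> q [].
have c2 : (fun q : 'rV[R]_k * R^o => q.2) @ within (@cylinder R k) (nbhs p) -->
  (p.2 : R^o).
  by apply: cvg_within_filter; exact: cvg_snd.
apply: cvgD; apply: cvgZ => //.
  by apply: cvgB => //; exact: cvg_cst.
apply: cvg_within_filter; apply: cvg_comp; last exact: continuous_comb.
exact: cvg_fst.
Qed.

(** By tightness every vertex used for the end point has positive coordinate at [s p.1], so the
    segment stays in the closed simplex carrying that point. *)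
Let straight_in k (s : 'rV[R]_k -> W) p : good s -> @cylinder R k p ->
  X (straight s p).
Proof.
move=> [sL ts] [pS p01]; have [_ sX _] := sL.
have /realizationE[spS spL] := sX _ pS.
set y := comb k (map v (map s (units R k))) p.1.
have yS : dsimp R m y.
  apply: comb_in pS; [exact: convex_dsimp|by rewrite 2!size_map size_units|].
  by move=> _ /mapP[z _ ->]; exact: pt_in_dsimp.
apply/realizationE; split.
  have := @convex_dsimp R m 2 (fun i => if val i == 0%N then 1 - p.2 else p.2)
    (fun i => if val i == 0%N then s p.1 else y).
  rewrite /= !big_ord_recl !big_ord0 /= !addr0; apply.
  - by move=> i; case: ifP; case/andP: p01; lra.
  - by rewrite subrK.
  - by move=> i; case: ifP.
apply: (proj2 cxL) spL _; apply/fintype.subsetP => i; rewrite !inE.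
apply: contraNN => /eqP spi; rewrite !mxE spi mulr0 add0r.
rewrite (_ : y ord0 i = 0) ?mulr0 // /y /comb summxE big1 // => j _.
have sz : (j < size (map s (units R k)))%N by rewrite size_map size_units.
rewrite mxE (nth_map 0 _ _ sz) (nth_map 0) ?size_units // nth_units /v /pt mxE
  eqxx /=.
case: eqP => [ij|_]; last by rewrite mulr0.
have jS : dsimp R k (delta_mx ord0 j).
  by apply: dsimp_units; apply/mapP; exists j; rewrite ?mem_enum.
have := vtx_spt v0 sL ts jS pS.
by rewrite -ij spi ltxx.
Qed.

Let straight_face k (s : 'rV[R]_k.+1 -> W) l x t : size l = k ->
  {subset l <= units R k.+1} -> dsimp R k x ->
  straight (restr (s \o comb k l)) (x, t) = straight s (comb k l x, t).
Proof.
move=> sl ul xS; rewrite /straight /= restrT //; congr (_ + _ *: _).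
rewrite linear_comb; congr comb; rewrite -[in RHS](map_comb_units sl).
rewrite -[LHS]map_comp -[RHS]map_comp.
apply/eq_in_map => e eu /=; rewrite restrT /=; last exact: (dsimp_units eu).
have el : comb k l e \in units R k.+1.
  by apply: ul; rewrite -[X in _ \in X](map_comb_units sl); exact: map_f.
by rewrite -[map v _]map_comp (comb_units_in (v \o s) el).
Qed.

Lemma simplicial_approx k (c : sing R m k) :
  supp_in (sing_in X) c -> cycle c ->
  exists z b, [/\ of_size k z, supp_in (in_cx L) z, bd z = 0,
    supp_in (sing_in X) b & c = affine_sing R k z + sbd b].
Proof.
move=> cX cc; have [j gc] := tight_subdivision v0 cX.
have [hX hb] := ssub_homologous j cX cc.
have cc' : cycle (ssub j c).
  by case: k c cX cc gc hX hb => [//|k] c cX /= cc *; rewrite sbd_ssub cc raddf0.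
have [|||b [bX bb]] := @prism_homologous R m X v good straight
  straight_continuous straight_in _ _ _ k X _ gc (ssub_sing_in cX) cc'.
- by move=> n s x _ _; rewrite /straight /= subr0 scale1r scale0r addr0.
- by move=> n s x _ _; rewrite /straight /= subrr scale1r scale0r add0r.
- by move=> n s l x t _ sl ul xS _; exact: straight_face.
have [kz Lz] := supp_vert v0 cxL gc.
exists (map_chain (vtx v0) (vert (ssub j c))), (shom j c - b); split=> //.
- by rewrite -map_chain_bd vert_cycle // raddf0.
- exact: supp_inB.
rewrite raddfB /= hb bb /affine_sing /=.
rewrite (_ : map_chain v _ = map_chain (@pt R m)
  (map_chain (vtx v0) (vert (ssub j c)))).
  by chain_ring.
move: (vert _); apply: (@eq_additive _ _ (map_chain v)
  (map_chain (@pt R m) \o map_chain (vtx v0))) => l /=.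
by rewrite !map_chain1 -map_comp.
Qed.

End SimplicialApproximation.

(** * Vanishing of reduced homology for a contractible set *)

Section Contractible.
Variables (R : realType) (m : nat) (U : set 'rV[R]_m) (y1 : 'rV[R]_m).
Variable H : 'rV[R]_m * R^o -> 'rV[R]_m.
Let UI := [set p : 'rV[R]_m * R^o | U p.1 /\ 0 <= p.2 <= 1].
Hypothesis H_cont : cont_on UI H.
Hypothesis H_in : forall p, UI p -> U (H p).
Hypothesis H0 : forall y, U y -> H (y, 0) = y.
Hypothesis H1 : forall y, U y -> H (y, 1) = y1.
Hypothesis Uy1 : U y1.

Lemma contractible_bounds k (c : sing R m k) :
  supp_in (sing_in U) c -> cycle c ->
  exists b : sing R m k.+1, supp_in (sing_in U) b /\ sbd b = c.
Proof.
move=> cU cc.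
pose h n (s : 'rV[R]_n -> 'rV[R]_m) (p : 'rV[R]_n * R^o) := H (s p.1, p.2).
have hUI n (s : 'rV[R]_n -> 'rV[R]_m) : sing_in U s ->
    forall p, @cylinder R n p -> UI (s p.1, p.2).
  by move=> [_ Us _] p [pS p01]; split => //; exact: Us.
have [|||||b [bU bb]] := @prism_homologous R m U (fun=> y1)
  (fun n => @sing_in R m n U) h _ _ _ _ _ k U c cU cU cc.
- move=> n s sU; apply: cont_on_comp H_cont (hUI _ _ sU) => p pC.
  apply: (cvg_pair (G := nbhs (s p.1)) (H := nbhs p.2)
    (f := fun q : 'rV[R]_n * R^o => s q.1) (g := fun q : 'rV[R]_n * R^o => q.2)).
    apply: (@cont_on_comp _ _ _ (@cylinder R n) (dsimp R n) fst s) => //.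
    - by apply: cont_on_continuous => q; exact: cvg_fst.
    - by case: sU.
    - by move=> q [].
  by apply: cvg_within_filter; exact: cvg_snd.
- by move=> n s p sU pC; apply: H_in; exact: hUI.
- by move=> n s x [_ Us _] xS; apply: H0; exact: Us.
- move=> n s x [_ Us _] xS; rewrite /h /= H1; last exact: Us.
  rewrite /comb -[LHS]scale1r -(proj2 xS) scaler_suml; apply: eq_bigr => i _.
  have sz : (i < size (map s (units R n)))%N by rewrite size_map size_units.
  by rewrite (nth_map 0 _ _ sz).
- by move=> n s l x t [_ Us _] sl ul xS _; rewrite /h /= restrT.
(* The contraction turns [c] into a cycle on lists of copies of [y1], which is bounded by its cone
   with apex [y1]. *)
set d := map_chain _ _ in bb.
have kd : of_size k d by exact/of_size_map_chain/of_size_vert.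
have bd0 : bd d = 0 by rewrite -map_chain_bd vert_cycle // raddf0.
have supp_d : supp_in (fun l : seq 'rV[R]_m => {in l, forall x, [set y1] x}) d.
  apply: (@supp_in_ext _ _ (fun=> True)) => // l _; apply: supp_inU.
  by move=> _ /mapP[x _ ->].
exists (push k.+1 idfun (cone y1 d) - b); split.
  apply: supp_inB => //.
  apply: (@push_sing_in _ _ _ _ [set y1]).
  - move=> n w p w0 w1 hp /=; rewrite -[RHS]scale1r -w1 scaler_suml.
    by apply: eq_bigr => i _; rewrite hp.
  - exact: cont_on_continuous (fun=> cvg_id).
  - by move=> x ->.
  apply: supp_in_ext (supp_inI kd supp_d) => l [sl hl]; apply: supp_inU.
  split; first by rewrite /= sl.
  by move=> x; rewrite inE => /predU1P[->//|/hl].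
rewrite raddfB /= bb sbd_push ?bd_cone ?bd0 ?raddf0 ?subr0;
  last exact: of_size_cone.
by rewrite addr0 subKr.
Qed.

End Contractible.

(** * Complements of convex sets *)

Section Acyclic.
Variables (R : realType) (m : nat).
Notation W := 'rV[R]_m.

Definition bounds_in k (U : set W) (z : sing R m k) :=
  exists b : sing R m k.+1, supp_in (sing_in U) b /\ sbd b = z.

(** Reduced acyclicity: at [k = 0] the generator is the empty simplex, and its bounding says that
    [U] is nonempty. *)
Definition acyclic (U : set W) :=
  forall k (z : sing R m k), supp_in (sing_in U) z -> cycle z -> bounds_in U z.

Lemma bounds_inW k (U U' : set W) (z : sing R m k) :
  U `<=` U' -> bounds_in U z -> bounds_in U' z.
Proof.
move=> UU' [b [bU bz]]; exists b; split => //.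
by apply: supp_inW bU => s; exact: sing_inW.
Qed.

Lemma supp_sing_inW k (U U' : set W) (z : sing R m k) :
  U `<=` U' -> supp_in (sing_in U) z -> supp_in (sing_in U') z.
Proof. by move=> UU'; apply: supp_inW => s; exact: sing_inW. Qed.

(** The difference of the two fillings is a cycle off the intersection of [C1] and [C2], hence
    bounds some [c] there. Cutting a fine subdivision of [c] into a part off [C1] and a part off
    [C2] corrects the fillings until they coincide. *)
Lemma mayer_vietoris (X C1 C2 : set W) k (z : sing R m k) :
  closed C1 -> closed C2 -> acyclic (X `\` (C1 `&` C2)) ->
  supp_in (sing_in (X `\` (C1 `|` C2))) z -> cycle z ->
  bounds_in (X `\` C1) z -> bounds_in (X `\` C2) z ->
  bounds_in (X `\` (C1 `|` C2)) z.
Proof.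
move=> cl1 cl2 acX zX cz [a [aX az]] [b [bX bz]].
have [|//=|c [cX cab]] := acX _ (a - b).
- apply: supp_inB; [apply: supp_sing_inW aX|apply: supp_sing_inW bX];
    by move=> x [Xx nC]; split => // -[].
- by rewrite raddfB /= az bz subrr.
pose good (A : set W) := A `<=` ~` C1 \/ A `<=` ~` C2.
have [|||j] := small_subdivision (good := good) _ _ _ cX.
- by left.
- by move=> A B BA [A1|A2]; [left|right]; exact: (subset_trans BA).
- move=> w [Xw] nC; have [C1w|nC1w] := pselect (C1 w).
    exists (~` C2); last by right => x [].
    by apply: open_nbhs_nbhs; split; [exact: closed_openC|move=> C2w; apply: nC].
  exists (~` C1); last by left => x [].
  by apply: open_nbhs_nbhs; split; first exact: closed_openC.
move=> /(_ j (leqnn j)) gc.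
have [c1 [c2 [Ec c1P c2P]]] := supp_in_split
  (fun s : 'rV[R]_k.+2 -> W => s @` dsimp R k.+2 `<=` ~` C1) (ssub j c).
have c1X : supp_in (sing_in (X `\` C1)) c1.
  apply: supp_inW c1P => s [sc s1].
  have [cs sX s0] := (@ssub_sing_in _ _ j _ _ _ cX) _ sc; split => // t tS.
  by split; [case: (sX _ tS)|apply: s1; exists t].
have c2X : supp_in (sing_in (X `\` C2)) c2.
  apply: supp_inW c2P => s [sc s1].
  have [cs sX s0] := (@ssub_sing_in _ _ j _ _ _ cX) _ sc; split => // t tS.
  by split; [case: (sX _ tS)|case: (gc _ sc) => // s2; apply: s2; exists t].
(* This expression avoids [C1], the one in [Ee] avoids [C2]. As [e] fills the subdivision of [z],
   [shom j z] is added at the end to fill [z] itself. *)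
pose e := ssub j a - sbd c1.
have Ee : e = ssub j b + sbd c2.
  have := sbd_ssub j c; rewrite cab Ec raddfD raddfB /= => H.
  rewrite /e; apply/eqP; rewrite subr_eq -addrA (addrC (sbd c2)) H.
  by rewrite addrC subrK.
exists (e + shom j z); split.
  apply: supp_inD; last by have [] := ssub_homologous j zX cz.
  have e1 : supp_in (sing_in (X `\` C1)) e.
    by apply: supp_inB; [exact: ssub_sing_in|exact: sbd_sing_in].
  have e2 : supp_in (sing_in (X `\` C2)) e.
    by rewrite Ee; apply: supp_inD; [exact: ssub_sing_in|exact: sbd_sing_in].
  apply: supp_inW (supp_inI e1 e2) => s [[cs s1 s0] [_ s2 _]]; split => // t tS.
  by have [Xt n1] := s1 _ tS; have [_ n2] := s2 _ tS; split => // -[].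
rewrite raddfD /= (proj2 (ssub_homologous j zX cz)) /e raddfB /= sbd_sbd subr0.
by rewrite sbd_ssub az addrC subrK.
Qed.

Lemma sing_in_avoid k (U C : set W) (f : W -> R) (s : 'rV[R]_k -> W) :
  sing_in U s -> continuous f -> closed C ->
  (forall x, U x -> C x -> 0 < f x) ->
  exists2 e, 0 < e & forall t, dsimp R k t -> C (s t) -> e < f (s t).
Proof.
move=> [cs sU _] cf clC f0.
have /compact_near_coveringP/near_covering_withinP cov := @compact_dsimp R k.
have [e /= e0 eP] : \forall e \near (0 : R)^'+,
    dsimp R k `<=` (fun t => C (s t) -> e < f (s t)).
  apply: (cov R (0 : R)^'+ (fun e t => C (s t) -> e < f (s t))) => x xS.
  have [Cx|nCx] := pselect (C (s x)); last first.
    have Nx : nbhs (s x) (~` C).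
      by apply: open_nbhs_nbhs; split; first exact: closed_openC.
    have N : nbhs x (fun y => dsimp R k y -> (~` C) (s y)) by exact: (cs _ xS _ Nx).
    exists ([set y | dsimp R k y -> (~` C) (s y)], setT).
      by split => //; exact: filterT.
    by move=> [y e] [/= h _] yS Cy; case: (h yS).
  have fx := f0 _ (sU _ xS) Cx.
  have Nx : nbhs (s x) [set y | f (s x) / 2 < f y].
    apply: (cf (s x) [set r | f (s x) / 2 < r]); apply: open_nbhs_nbhs.
    by split; [exact: open_gt|rewrite /=; lra].
  have N : nbhs x (fun y => dsimp R k y -> f (s x) / 2 < f (s y))
    by exact: (cs _ xS _ Nx).
  exists ([set y | dsimp R k y -> f (s x) / 2 < f (s y)],
    [set d | d < f (s x) / 2]).
    by split => //=; apply: nbhs_right_lt; rewrite divr_gt0.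
  by move=> [y d] [/= h dr] yS _; apply: lt_trans dr (h yS).
exists (e / 2); first by rewrite divr_gt0.
apply: eP; last by rewrite divr_gt0.
by rewrite /= sub0r normrN gtr0_norm ?divr_gt0 // ltr_pdivrMr // mulr2n mulrDr
  mulr1 ltrDl.
Qed.

(** Thickens a slice to a slab: the finitely many simplices of [c] have compact images, on whose
    part in [C] the function [f] is bounded away from 0. *)
Lemma supp_avoid k (U C : set W) (f : W -> R) (c : sing R m k) :
  supp_in (sing_in U) c -> continuous f -> closed C ->
  (forall x, U x -> C x -> 0 < f x) ->
  exists2 e, 0 < e & supp_in (sing_in (U `\` (C `&` [set x | f x <= e]))) c.
Proof.
move=> cU cf clC f0; rewrite -[c]freeg_sumE.
have : {in dom c, forall s, sing_in U s} by [].
elim: (dom c) => [|s d IH] sU.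
  by exists 1 => //; rewrite big_nil; exact: supp_in0.
have [|e1 e10 IH1] := IH; first by move=> s' s'd; apply: sU; rewrite inE s'd orbT.
have sUs := sU s (mem_head _ _).
have [e2 e20 h] := sing_in_avoid sUs cf clC f0.
exists (Num.min e1 e2); first by rewrite lt_min e10.
rewrite big_cons; apply: supp_inD.
  apply: supp_inU; have [cs Us s0] := sUs; split => // t tS; split; first exact: Us.
  move=> [Ct /= ft]; have := h _ tS Ct.
  by rewrite ltNge (le_trans ft) // ge_min lexx orbT.
apply: supp_sing_inW IH1 => x [Ux nC]; split => // -[Cx /= fx]; apply: nC.
by split => //=; rewrite (le_trans fx) // ge_min lexx.
Qed.

(* Sweeping [C] by the slices [x i <= t]: a cycle bounding off the part below
   [t] and off a thin slab around the slice [x i = t] bounds off a larger part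
   below, by Mayer-Vietoris, because the complement of a slice is acyclic. *)
Lemma acyclic_sweep (X C : set W) (i : 'I_m) :
  C !=set0 -> compact C -> convex_closed C ->
  (forall t, (C `&` [set x | x ord0 i = t]) !=set0 ->
    acyclic (X `\` (C `&` [set x | x ord0 i = t]))) ->
  acyclic (X `\` C).
Proof.
move=> C0 cC vC slice k z zX cz.
have clC : closed C by apply: compact_closed => //; exact: norm_hausdorff.
have ci : continuous (fun x : W => x ord0 i) by exact: coord_continuous.
have cwi : {within C, continuous (fun x : W => x ord0 i)}
  by exact: continuous_subspaceT.
have [xa /set_mem Cxa amin] := compact_EVT_min C0 cC cwi.
have [xb /set_mem Cxb bmax] := compact_EVT_max C0 cC cwi.
set a := xa ord0 i in amin; set b := xb ord0 i in bmax.
have ab : a <= b by apply: amin; exact: mem_set.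
have slice0 t : a <= t <= b -> (C `&` [set x | x ord0 i = t]) !=set0.
  move=> /andP[at_ tb]; have [E|ab'] := eqVneq a b.
    by exists xa; split => //=; rewrite -/a; apply/eqP; rewrite eq_le at_ E tb.
  have ba0 : 0 < b - a by rewrite subr_gt0 lt_neqAle ab'.
  pose u := (t - a) / (b - a).
  have u0 : 0 <= u by rewrite divr_ge0 // ?subr_ge0 // ltW.
  have u1 : u <= 1 by rewrite ler_pdivrMr // mul1r lerD2r.
  exists ((1 - u) *: xa + u *: xb); split.
    have := vC 2 (fun j => if val j == 0%N then 1 - u else u)
      (fun j => if val j == 0%N then xa else xb).
    rewrite /= !big_ord_recl !big_ord0 /= !addr0; apply.
    - by move=> j; case: ifP => _ //; rewrite subr_ge0.
    - by rewrite subrK.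
    - by move=> j; case: ifP.
  rewrite /= !mxE -/a -/b (_ : _ + _ = a + u * (b - a)); last by ring.
  by rewrite /u divfK ?gt_eqF // addrC subrK.
pose below t := C `&` [set x | x ord0 i <= t].
have clbelow t : closed (below t).
  apply: closedI => //.
  apply: (@preimage_closed _ _ (fun x : W => x ord0 i) [set y | y <= t]).
    by move=> x _; exact: ci.
  exact: closed_le.
have zXW E : E `<=` C -> supp_in (sing_in (X `\` E)) z.
  by move=> EC; apply: supp_sing_inW zX => x [Xx nC]; split => // /EC.
have bslice t : a <= t <= b -> bounds_in (X `\` (C `&` [set x | x ord0 i = t])) z.
  by move=> /slice0/slice; apply => //; apply: zXW => x [].
have slab t : a <= t <= b -> exists2 e, 0 < e &
    bounds_in (X `\` (C `&` [set x | `|x ord0 i - t| <= e])) z.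
  move=> /bslice[c [cX cz']].
  have [|||e e0 ce] := @supp_avoid _ _ C (fun x => `|x ord0 i - t|) _ cX.
  - move=> x; apply: (@continuous_comp _ R^o _ (fun x : W => x ord0 i - t)
      (fun r : R^o => `|r|)); last exact: norm_continuous.
    by apply: (@cvgB R R^o W (nbhs x) _ (fun x : W => x ord0 i) (fun=> t));
      [exact: ci|exact: cvg_cst].
  - exact: clC.
  - move=> x [_ nC] Cx; rewrite normr_gt0 subr_eq0; apply/eqP => xt.
    by apply: nC.
  exists e => //; exists c; split => //.
  by apply: supp_sing_inW ce => x [[Xx _] nC].
pose S := [set t | a <= t <= b /\ bounds_in (X `\` below t) z].
(* At the minimum [a] of the coordinate, the part below is the slice itself. *)
have Sa : S a.
  split; first by rewrite lexx.
  apply: bounds_inW (bslice a _) => [x [Xx nC]|]; last by rewrite lexx.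
  split => // -[Cx /= xa']; apply: nC; split => //=; apply/eqP.
  by rewrite eq_le xa' amin //; exact: mem_set.
have supS : has_sup S by split; [exists a|exists b => t [/andP[]]].
have aT : a <= sup S <= b.
  apply/andP; split; first exact: (ub_le_sup (proj2 supS) Sa).
  by apply: ge_sup => [|t [/andP[]]]; first by exists a.
have [e e0 bslab] := slab _ aT.
have [t [/andP[at_ tb] bt] tT] := sup_adherent e0 supS.
have tsup : t <= sup S by apply: ub_le_sup; [case: supS|split; rewrite ?at_].
(* [t] lies within [e] below the supremum, so the part between [t] and [sup S + e] fits in the slab,
   and it meets the part below [t] exactly in the slice at [t]. *)
have bTe : bounds_in (X `\` below (sup S + e)) z.
  pose upper := C `&` [set x | t <= x ord0 i <= sup S + e].
  have clupper : closed upper.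
    have -> : upper = C `&` ((fun x : W => x ord0 i) @^-1` [set y | t <= y] `&`
        (fun x : W => x ord0 i) @^-1` [set y | y <= sup S + e]).
      by apply/seteqP; split => x [Cx /=];
        [move=> /andP[]|move=> [tx xT]; split; rewrite //= tx].
    apply: closedI => //; apply: closedI.
      by apply: preimage_closed; [move=> x _; exact: ci|exact: closed_ge].
    by apply: preimage_closed; [move=> x _; exact: ci|exact: closed_le].
  have EI : below t `&` upper = C `&` [set x | x ord0 i = t].
    apply/seteqP; split => x /=.
      by move=> [[Cx xt] [_ /andP[tx _]]]; split=> //; apply/eqP; rewrite eq_le xt.
    move=> [Cx xt]; split; split; rewrite //= xt lexx //=.
    by rewrite (le_trans tsup) // lerDl ltW.
  have EU : below t `|` upper = below (sup S + e).
    apply/seteqP; split => x /=.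
      move=> [[Cx /= xt]|[Cx /andP[_ xT]]]; split => //=.
      by rewrite (le_trans xt) // (le_trans tsup) // lerDl ltW.
    move=> [Cx /= xT]; have [xt|tx] := leP (x ord0 i) t; first by left.
    by right; split => //=; rewrite xT ltW.
  rewrite -EU; apply: mayer_vietoris => //.
  - by rewrite EI; apply: slice; apply: slice0; rewrite at_.
  - by apply: zXW => x [[]|[]].
  - apply: bounds_inW bslab => x [Xx nC]; split => // -[Cx /= /andP[tx xT]].
    by apply: nC; split => //=; rewrite ler_distl; apply/andP; split; lra.
have [bT|Tb] := leP b (sup S + e).
  apply: bounds_inW bTe => x [Xx nC]; split => // Cx; apply: nC; split => //=.
  by apply: le_trans bT; apply: bmax; exact: mem_set.
have : S (sup S + e).
  by split => //; case/andP: aT => aT _; rewrite (ltW Tb) andbT; lra.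
move=> /(ub_le_sup (proj2 supS)); lra.
Qed.

(** Induction on the list [l] of coordinates that may vary on [C]: slicing fixes one of them, and
    when none is left [C] is a point. *)
Lemma acyclic_complement (X C : set W) :
  (forall x, X x -> acyclic (X `\` [set x])) ->
  C `<=` X -> C !=set0 -> compact C -> convex_closed C -> acyclic (X `\` C).
Proof.
move=> acX.
suff H : forall (l : seq 'I_m) (C : set W),
  (forall x y, C x -> C y -> forall i, i \notin l -> x ord0 i = y ord0 i) ->
    C `<=` X -> C !=set0 -> compact C -> convex_closed C -> acyclic (X `\` C).
  move=> CX C0 cC vC; apply: (H (enum 'I_m) C _ CX C0 cC vC) => x y _ _ i.
  by rewrite mem_enum.
elim => [|i l IH] {}C Cl CX C0 cC vC.
  have [x Cx] := C0; rewrite (_ : C = [set x]); first exact/acX/CX.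
  apply/seteqP; split => [y Cy|y ->//]; apply/rowP => i.
  exact: Cl.
apply: (acyclic_sweep (i := i)) => // t t0; apply: IH => //.
- move=> x y [Cx /= xt] [Cy /= yt] j jl; have [->|ji] := eqVneq j i.
    by rewrite xt yt.
  by apply: Cl => //; rewrite inE negb_or ji.
- by move=> x [/CX].
- apply: compact_closedI => //.
  apply: (@preimage_closed _ _ (fun x : W => x ord0 i) [set y | y = t]).
    by move=> x _; exact: coord_continuous.
  exact: closed_eq.
move=> n w p w0 w1 hp; split; first by apply: vC => // j; case: (hp j).
rewrite /= summxE -[RHS]mul1r -w1 mulr_suml; apply: eq_bigr => j _.
by rewrite mxE; case: (hp j) => _ /= ->.
Qed.

End Acyclic.

(** * A sphere without a point is contractible *)

Section PuncturedSphere.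
Variables (R : realType) (d : nat).
Notation N := d.+2.
Notation W := 'rV[R]_N.
Notation Y := (@realization R N (boundary_complex d)).

Lemma sphereE y : Y y <-> dsimp R N y /\ exists i, y ord0 i = 0.
Proof.
rewrite realizationE inE; split => -[yS].
  move=> /eqP nT; split => //; apply: contrapT => /forallNP yn0.
  by apply: nT; apply/finset.setP => i; rewrite !inE; apply/eqP; exact: yn0.
move=> [i yi]; split => //; apply/eqP => /finset.setP/(_ i).
by rewrite !inE yi eqxx.
Qed.

(* The gauge of the simplex with respect to its barycenter: the boundary of
   the simplex is the unit sphere of [gauge (y - center)]. *)
Definition gauge (v : W) : R := \big[Num.max/0]_i (- (N%:R * v ord0 i)).

Definition center : W := const_mx N%:R^-1.

Lemma N_neq0 : N%:R != 0 :> R.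
Proof. by rewrite pnatr_eq0. Qed.

Lemma gauge_ge (v : W) i : - (N%:R * v ord0 i) <= gauge v.
Proof. exact: le_bigmax. Qed.

Lemma gauge_ge0 (v : W) : 0 <= gauge v.
Proof. by rewrite /gauge; elim/big_rec: _ => // i x _ x0;
  rewrite le_max x0 orbT. Qed.

Lemma gauge_le (v : W) r : 0 <= r -> (forall i, - (N%:R * v ord0 i) <= r) ->
  gauge v <= r.
Proof. by move=> r0 h; apply: bigmax_le. Qed.

Lemma gauge_attained (v : W) : 0 < gauge v -> exists i,
  gauge v = - (N%:R * v ord0 i).
Proof.
rewrite /gauge; elim/big_rec: _ => [|i x _ IH]; first by rewrite ltxx.
by have [_|_ _] := leP (- (N%:R * v ord0 i)) x; [exact: IH|exists i].
Qed.

Lemma gaugeZ c (v : W) : 0 <= c -> gauge (c *: v) = c * gauge v.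
Proof.
move=> c0; rewrite /gauge (big_morph ( *%R c) (id1 := 0) (op1 := Num.max)).
- by apply: eq_bigr => i _; rewrite mxE; ring.
- by move=> x y; rewrite maxr_pMr.
- by rewrite mulr0.
Qed.

Lemma sum_center : \sum_i center ord0 i = 1.
Proof.
by under eq_bigr do rewrite mxE; rewrite sumr_const card_ord -[LHS]mulr_natl
  mulfV // N_neq0.
Qed.

Lemma gauge_sphere y : Y y -> gauge (y - center) = 1.
Proof.
move=> /sphereE[[y0 y1] [i yi]]; apply/eqP; rewrite eq_le; apply/andP; split.
  apply: gauge_le => // j; rewrite !mxE mulrBr mulfV ?N_neq0 // opprB.
  by rewrite gerBl mulr_ge0.
apply: le_trans (gauge_ge _ i); rewrite !mxE yi add0r mulrN mulfV ?N_neq0 //.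
by rewrite opprK.
Qed.

Lemma gauge_gt0 (v : W) : \sum_i v ord0 i = 0 -> v != 0 -> 0 < gauge v.
Proof.
move=> v0; rewrite lt_neqAle gauge_ge0 andbT; apply: contraNneq => g0.
have vge i : 0 <= v ord0 i.
  by have := gauge_ge v i; rewrite -g0 oppr_le0 pmulr_rge0 // ltr0n.
apply/eqP/rowP => i; rewrite mxE.
by move/eqP: v0; rewrite psumr_eq0 // => /allP/(_ i);
  rewrite mem_index_enum => /(_ isT)/eqP.
Qed.

Lemma continuous_maxr : continuous (fun x : R^o * R^o => Num.max x.1 x.2).
Proof.
rewrite (_ : (fun _ => _) = fun x : R^o * R^o => 2^-1 * (x.1 + x.2 + `|x.1 - x.2|)).
  move=> x; apply: (@cvgMl_tmp R _ (nbhs x)).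
  apply: (@cvgD _ R^o); first by apply: (@cvgD _ R^o);
    [exact: cvg_fst|exact: cvg_snd].
  apply: (@cvg_norm _ R^o); by apply: (@cvgB _ R^o);
    [exact: cvg_fst|exact: cvg_snd].
by apply/funext => x; rewrite maxr_absE mulrC.
Qed.

Lemma continuous_gauge : continuous gauge.
Proof.
move=> t; apply: (@cvg_big R _ Num.max 0 xpredT _ _ (nbhs t) (index_enum _)
  (fun i (t : W) => - (N%:R * t ord0 i))).
  exact: continuous_maxr.
move=> i _; apply: (@cvgN _ R^o); apply: (@cvgMl_tmp R _ (nbhs t) _
  (fun t : W => t ord0 i)).
exact: coord_continuous.
Qed.

Definition radial (v : W) : W := center + (gauge v)^-1 *: v.

Lemma radial_sphere y : Y y -> radial (y - center) = y.
Proof. by move=> /gauge_sphere g; rewrite /radial g invr1 scale1r addrC subrK. Qed.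

Lemma radial_in (v : W) : \sum_i v ord0 i = 0 -> v != 0 -> Y (radial v).
Proof.
move=> v0 vn0; have g0 := gauge_gt0 v0 vn0.
have N0 : 0 < N%:R :> R by rewrite ltr0n.
have gn0 : gauge v != 0 by rewrite gt_eqF.
have rE i : radial v ord0 i = (gauge v + N%:R * v ord0 i) / (N%:R * gauge v).
  have E (n g x : R) : n != 0 -> g != 0 -> n^-1 + g^-1 * x = (g + n * x) / (n * g).
    by move=> nn0 gg0; field; rewrite nn0 gg0.
  by rewrite !mxE E // N_neq0.
apply/sphereE; split.
  split => [i|].
    rewrite rE divr_ge0 // ?mulr_ge0 ?(ltW g0) ?(ltW N0) //.
    by have := gauge_ge v i; lra.
  under eq_bigr do rewrite mxE.
  rewrite big_split /= sum_center; under eq_bigr do rewrite mxE.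
  by rewrite -mulr_sumr v0 mulr0 addr0.
by have [i gi] := gauge_attained g0; exists i; rewrite rE gi addNr mul0r.
Qed.

Variable p : W.
Hypothesis Yp : Y p.

(** The straight path, seen from the barycenter, from a point of the sphere to the direction
    opposite to [p]; [pushed] projects it back to the sphere. *)
Let ray (q : W * R^o) : W := (1 - q.2) *: (q.1 - center) - q.2 *: (p - center).
Let pushed (q : W * R^o) : W := radial (ray q).
Let UI := [set q : W * R^o | (Y `\` [set p]) q.1 /\ 0 <= q.2 <= 1].

Let sum_sphere y : Y y -> \sum_i (y - center) ord0 i = 0.
Proof.
move=> /sphereE[[_ y1] _]; under eq_bigr do rewrite mxE [X in _ + X]mxE.
by rewrite sumrB y1 sum_center subrr.
Qed.

Let sum_ray q : UI q -> \sum_i ray q ord0 i = 0.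
Proof.
move=> [[Yq _] _]; rewrite /ray.
under eq_bigr do rewrite mxE [X in _ + X]mxE [X in X - _]mxE [X in _ - X]mxE.
by rewrite sumrB -!mulr_sumr !sum_sphere // !mulr0 subrr.
Qed.

(** Both points have gauge 1, so comparing gauges gives [1 - t = c + t]. For [t < 1] this makes
    [q.1] equal to [p], and [t = 1] contradicts [0 <= c]: the path never points towards [p]. *)
Let ray_dir q c : UI q -> 0 <= c -> ray q = c *: (p - center) -> c = 0 /\ q.2 = 1.
Proof.
move=> [[Yq qp] /andP[t0 t1]] c0 E; have {}E : (1 - q.2) *: (q.1 - center) =
  (c + q.2) *: (p - center).
  by rewrite [RHS]scalerDl -E /ray subrK.
have tn : 0 <= 1 - q.2 by rewrite subr_ge0.
have cq : 0 <= c + q.2 by rewrite addr_ge0.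
have := congr1 gauge E; rewrite !gaugeZ // !gauge_sphere // !mulr1 => cE.
have [q1|q1] := eqVneq (1 - q.2) 0; first by move: q1 cE; split; lra.
exfalso; apply: qp; move: E; rewrite -cE => /(scalerI q1)/addIr.
by [].
Qed.

Let ray_neq0 q : UI q -> ray q != 0.
Proof.
move=> qU; apply/eqP => q0; have [] := ray_dir qU (lexx 0).
  by rewrite q0 scale0r.
move=> _ q1; move: q0; rewrite /ray q1 subrr scale0r sub0r scale1r => /eqP.
rewrite oppr_eq0 => /eqP pc; have := gauge_sphere Yp.
rewrite pc => /eqP; rewrite -(scale0r 0) gaugeZ // mul0r eq_sym oner_eq0.
by [].
Qed.

Let pushed_in q : UI q -> (Y `\` [set p]) (pushed q).
Proof.
move=> qU; have r0 := sum_ray qU; have rn0 := ray_neq0 qU.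
have g0 := gauge_gt0 r0 rn0; split; first exact: radial_in.
move=> /= E; have : ray q = gauge (ray q) *: (p - center).
  by rewrite -E /pushed /radial addrC addKr scalerA mulfV ?gt_eqF // scale1r.
by move=> /(ray_dir qU (ltW g0))[gE _]; rewrite gE ltxx in g0.
Qed.

Let pushed_continuous : cont_on UI pushed.
Proof.
move=> q qU; apply: cvg_within_filter.
have rc : {for q, continuous ray}.
  apply: cvgB; apply: cvgZ.
  - by apply: cvgB; [exact: cvg_cst|exact: cvg_snd].
  - by apply: cvgB; [exact: cvg_fst|exact: cvg_cst].
  - exact: cvg_snd.
  - exact: cvg_cst.
apply: cvgD; first exact: cvg_cst.
apply: cvgZ => //; apply: (@cvgV R _ (nbhs q)).
  by rewrite gt_eqF // gauge_gt0 // ?sum_ray // ray_neq0.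
by apply: (@continuous_comp _ _ _ ray gauge q rc); exact: continuous_gauge.
Qed.

Variables (m : nat) (X : set 'rV[R]_m) (f : 'rV[R]_m -> W) (g : W -> 'rV[R]_m).
Hypothesis f_cont : cont_on X f.
Hypothesis g_cont : cont_on Y g.
Hypothesis fXY : forall x, X x -> Y (f x).
Hypothesis gYX : forall y, Y y -> X (g y).
Hypothesis fK : forall x, X x -> g (f x) = x.
Hypothesis gK : forall y, Y y -> f (g y) = y.

Lemma acyclic_punctured_at : acyclic (X `\` [set g p]).
Proof.
have ray_end y : ray (y, 1) = - (p - center).
  by rewrite /ray /= subrr scale0r sub0r scale1r.
have U_in q : (X `\` [set g p]) q.1 /\ 0 <= q.2 <= 1 -> UI (f q.1, q.2).
  move=> [[Xq qp] q01]; split => //; split => /=; first exact: fXY.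
  by move=> fp; apply: qp; rewrite /= -fp fK.
have H_in q : (X `\` [set g p]) q.1 /\ 0 <= q.2 <= 1 ->
    (X `\` [set g p]) (g (pushed (f q.1, q.2))).
  move=> /U_in/pushed_in[Yq qp]; split; first exact: gYX.
  by move=> /(congr1 f); rewrite !gK.
(* Some point other than [p] is needed to see, by following it to time 1, that the contraction ends
   in the punctured space; the point opposite to [p] serves. *)
have [y Yy] : exists y, (Y `\` [set p]) y.
  exists (radial (- (p - center))); have pn0 : p - center != 0.
    apply/eqP => p0; have := gauge_sphere Yp; rewrite p0 => /eqP.
    by rewrite -(scale0r 0) gaugeZ // mul0r eq_sym oner_eq0.
  have s0 : \sum_i (- (p - center)) ord0 i = 0.
    by under eq_bigr do rewrite mxE; rewrite sumrN sum_sphere // oppr0.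
  split; first by apply: radial_in => //; rewrite oppr_eq0.
  move=> /= E; have := gauge_gt0 s0; rewrite oppr_eq0 => /(_ pn0) g0.
  have dirE w : radial w = p -> 0 < gauge w -> w = gauge w *: (p - center).
    move=> <- gw; rewrite /radial [center + _]addrC addrK scalerA mulfV ?gt_eqF //.
    by rewrite scale1r.
  have := dirE _ E g0; move: g0; move: (gauge _) => gw g0 /eqP.
  rewrite -subr_eq0 -scaleN1r -scalerBl scaler_eq0 (negbTE pn0) orbF.
  by rewrite subr_eq0 => /eqP; lra.
move=> k z zU cz.
apply: (@contractible_bounds R m _ (g (radial (- (p - center))))
  (fun q => g (pushed (f q.1, q.2))) _ _ _ _ _ k z zU cz).
- apply: (@cont_on_comp _ _ _ _ Y (fun q : 'rV[R]_m * R^o => pushed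
  (f q.1, q.2)) g) => //.
    apply: (@cont_on_comp _ _ _ _ UI (fun q : 'rV[R]_m * R^o => (f q.1, q.2))
      pushed) => //.
    move=> q qU; apply: (cvg_pair (G := nbhs (f q.1)) (H := nbhs q.2)
      (f := fun q : 'rV[R]_m * R^o => f q.1) (g := fun q : 'rV[R]_m * R^o => q.2)).
      apply: (@cont_on_comp _ _ _ _ X (fun q : 'rV[R]_m * R^o => q.1) f _ _ _ q
        qU) => //.
        by apply: cont_on_continuous => ?; exact: cvg_fst.
      by move=> ? [[]].
    by apply: cvg_within_filter; exact: cvg_snd.
  by move=> q /U_in/pushed_in[].
- exact: H_in.
- move=> x [Xx _]; rewrite /pushed /ray /= subr0 scale0r subr0 scale1r.
  by rewrite radial_sphere ?fK //; exact: fXY.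
- by move=> x _; rewrite /pushed ray_end.
have := H_in (g y, 1); rewrite /pushed ray_end; apply; split => /=;
  last by rewrite ler01 lexx.
by case: Yy => Yy yp; split; [exact: gYX|move=> /(congr1 f); rewrite !gK].
Qed.

End PuncturedSphere.

Lemma acyclic_punctured_sphere (R : realType) (d m : nat) (X : set 'rV[R]_m) f g :
  cont_on X f -> cont_on (@realization R d.+2 (boundary_complex d)) g ->
  (forall x, X x -> realization (boundary_complex d) (f x)) ->
  (forall y, realization (boundary_complex d) y -> X (g y)) ->
  (forall x, X x -> g (f x) = x) ->
  (forall y, realization (boundary_complex d) y -> f (g y) = y) ->
  forall x, X x -> acyclic (X `\` [set x]).
Proof.
move=> cf cg fXY gYX fK gK x Xx; rewrite -(fK x Xx).
by apply: (@acyclic_punctured_at R d (f x) (fXY _ Xx) m X f g).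
Qed.

(** * Continuity of piecewise linear maps *)

Section PLContinuous.
Variable R : realType.

Lemma continuous_mulmx a b (A : 'M[R]_(a, b)) :
  continuous (fun x : 'rV[R]_a => x *m A).
Proof.
rewrite (_ : (fun x => _) = comb a [seq row i A | i <- enum 'I_a]).
  exact: continuous_comb.
apply/funext => x; rewrite /comb mulmx_sum_row; apply: eq_bigr => i _.
by rewrite (nth_map i) ?size_enum_ord // nth_ord_enum.
Qed.

Lemma closed_polytope a (C : set 'rV[R]_a) : polytope C -> closed C.
Proof.
move=> [k [p ->]].
have <- : comb k [seq p i | i <- enum 'I_k] @` dsimp R k =
    [set x | exists w : 'I_k -> R,
          [/\ forall i, 0 <= w i, \sum_i w i = 1 & x = \sum_i w i *: p i]].
  have E t : comb k [seq p i | i <- enum 'I_k] t = \sum_i t ord0 i *: p i.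
    apply: eq_bigr => i _.
    by rewrite (nth_map i) ?size_enum_ord // nth_ord_enum.
  apply/seteqP; split => [_ [t [t0 t1] <-]|x [w [w0 w1 ->]]].
    by exists (fun i => t ord0 i); split => //; rewrite E.
  exists (\row_i w i); last by rewrite E; apply: eq_bigr => i _; rewrite mxE.
  by split => [j|]; [rewrite mxE|under eq_bigr do rewrite mxE].
apply: compact_closed; first exact: norm_hausdorff.
apply: continuous_compact; last exact: compact_dsimp.
by apply: continuous_subspaceT; exact: continuous_comb.
Qed.

(** Of the finitely many polytopes covering a neighbourhood of [x], those missing [x] are closed and
    stay away from it; on each of the others [f] agrees with a continuous affine map. *)
Lemma pl_on_cont a b (X : set 'rV[R]_a) (f : 'rV[R]_a -> 'rV[R]_b) :
  pl_on X f -> cont_on X f.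
Proof.
move=> plf x Xx; have [k [C [hC cover]]] := plf x Xx => N Nfx.
have near_i i : \forall y \near x, C i y -> N (f y).
  have [pC CX [A [v fA]]] := hC i.
  have [Cx|nCx] := pselect (C i x); last first.
    have : nbhs x (~` C i).
      apply: open_nbhs_nbhs; split => //; apply: closed_openC.
      exact: closed_polytope.
    by apply: filterS => y nCy /nCy.
  have cA : {for x, continuous (fun y : 'rV[R]_a => y *m A + v)}.
    apply: (@cvgD _ _ _ (nbhs x) _ (fun y => y *m A) (fun=> v)).
      exact: (@continuous_mulmx _ _ A x).
    exact: cvg_cst.
  have : nbhs x [set y | N (y *m A + v)].
    by apply: cA; rewrite -fA.
  by apply: filterS => y Ny Cy; rewrite fA.
have near_all : \forall y \near x, forall i, C i y -> N (f y).
  apply: (@filter_forall _ 'I_k (fun i y => C i y -> N (f y)) (nbhs x)).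
  exact: near_i.
have near_cover : nbhs x (fun y => X y -> exists i, C i y) by exact: cover.
have : nbhs x (fun y => X y -> N (f y)).
  apply: filterS2 near_cover near_all => y h1 h2 Xy.
  by have [i] := h1 Xy; exact: h2.
exact.
Qed.

End PLContinuous.

(** * Combinatorial spheres *)

Section Faces.
Variables (R : realType) (m : nat) (L : {set {set 'I_m}}).
Hypothesis cxL : simplicial_complex L.
Notation W := 'rV[R]_m.
Notation X := (@realization R m L).
Notation vchain := {freeg (seq 'I_m) / int}.

Definition face_space (rho : {set 'I_m}) : set W :=
  [set x | dsimp R m x /\ forall i, i \notin rho -> x ord0 i = 0].

Lemma spt_subset (x : W) (rho : {set 'I_m}) :
  (spt x \subset rho) <-> (forall i, i \notin rho -> x ord0 i = 0).
Proof.
split => [/fintype.subsetP h i ir|h].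
  by apply/eqP; apply: contraNT ir => xi; apply: h; rewrite inE.
by apply/fintype.subsetP => i; rewrite inE; apply: contraR => /h ->.
Qed.

Lemma face_space_sub rho : rho \in L -> face_space rho `<=` X.
Proof.
move=> rL x [xS /spt_subset xr]; apply/realizationE; split => //.
exact: (proj2 cxL) rL xr.
Qed.

Lemma convex_face_space rho : convex_closed (face_space rho).
Proof.
move=> k w p w0 w1 hp; split.
  by apply: convex_dsimp => // i; case: (hp i).
move=> i ir; rewrite summxE big1 // => j _; rewrite mxE.
by case: (hp j) => _ ->//; rewrite mulr0.
Qed.

Lemma compact_face_space rho : compact (face_space rho).
Proof.
have -> : face_space rho = dsimp R m `&`
    \bigcap_(i in [set i | i \notin rho]) [set x : W | x ord0 i = 0].
  by apply/seteqP; split => x /= [].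
apply: compact_closedI; first exact: compact_dsimp.
apply: closed_bigI => i _.
apply: (@preimage_closed _ _ (fun x : W => x ord0 i) [set y | y = 0]).
  by move=> x _; exact: coord_continuous.
exact: closed_eq.
Qed.

Lemma face_space_pt (rho : {set 'I_m}) i : i \in rho -> face_space rho (pt R i).
Proof.
move=> ir; split; first exact: pt_in_dsimp.
move=> j jr; rewrite mxE eqxx /=.
by case: (j =P i) jr => [->|//]; rewrite ir.
Qed.

Definition away_from (rho : {set 'I_m}) : {set {set 'I_m}} :=
  [set s in L | s \subset ~: rho]%SET.

Lemma away_from_complex rho : simplicial_complex (away_from rho).
Proof.
split; first by rewrite inE (proj1 cxL) finset.sub0set.
move=> s t; rewrite !inE => /andP[sL sr] ts.
by rewrite (proj2 cxL _ _ sL ts) (fintype.subset_trans ts).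
Qed.

Lemma in_cx_away_from rho l :
  in_cx (away_from rho) l <-> in_cx L l /\ {in l, forall x, x \notin rho}.
Proof.
rewrite /in_cx inE; split => [/andP[lL /fintype.subsetP lr]|[-> lr]].
  by split=> // x xl; have := lr x; rewrite !inE; exact.
by apply/fintype.subsetP => x; rewrite !inE; exact: lr.
Qed.

Lemma affine_sing_subspace (U : set W) k c : of_size k c ->
  supp_in (fun l => hull (map (@pt R m) l) `<=` U) c ->
  supp_in (sing_in U) (affine_sing R k c).
Proof.
move=> kc cU; rewrite additive_extE;
  apply: supp_in_ext (supp_inI kc cU) => l [sl lU].
rewrite /= /affine_sing /= map_chain1.
apply: (@push_sing_in _ _ _ _ _ _ _ _ (@convex_hull _ _ (map (@pt R m) l))) => //.
- exact: cont_on_continuous (fun=> cvg_id).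
- by apply: supp_inU; split; [rewrite size_map|exact: mem_hull].
Qed.

Lemma fwd_affine_id (U : set W) (r : W -> W) k c : of_size k c ->
  supp_in (fun l => hull (map (@pt R m) l) `<=` U) c ->
    (forall x, U x -> r x = x) ->
  fwd r (affine_sing R k c) = affine_sing R k c.
Proof.
move=> kc cU rid; move: c {kc cU} (supp_inI kc cU).
apply: (@eq_additive_in _ _ _ (@fwd R m m r k \o @affine_sing R m k)
  (@affine_sing R m k)) => l [sl lU] /=.
rewrite /affine_sing /= map_chain1 fwd_push !push1; congr (<< _ >>).
apply: eq_restr => t tS /=; apply/rid/lU.
by apply: (comb_in (@convex_hull _ _ _)) tS; [rewrite size_map|exact: mem_hull].
Qed.

Definition outer_mass (rho : {set 'I_m}) (x : W) : R :=
  \sum_(i | i \notin rho) x ord0 i.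

(** Dropping the coordinates in [rho] and rescaling retracts the complement of the closed simplex
    [rho] onto the subcomplex on the other vertices. *)
Definition retract (rho : {set 'I_m}) (x : W) : W :=
  \row_i ((outer_mass rho x)^-1 * (if i \in rho then 0 else x ord0 i)).

Lemma outer_mass_gt0 rho x : (X `\` face_space rho) x -> 0 < outer_mass rho x.
Proof.
move=> [/realizationE[xS _] nx]; rewrite lt_neqAle sumr_ge0 ?andbT; last first.
  by move=> i _; exact: (proj1 xS).
apply/eqP => /esym/eqP; rewrite psumr_eq0; last by move=> i _; exact: (proj1 xS).
move=> /allP h; apply: nx; split => // i ir.
by have /implyP/(_ ir)/eqP := h i (mem_index_enum i).
Qed.

Lemma retract_in rho x : (X `\` face_space rho) x ->
  realization (away_from rho) (retract rho x).
Proof.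
move=> xr; have m0 := outer_mass_gt0 xr.
have /realizationE[xS xL] := xr.1.
apply/realizationE; split.
  split => [j|].
    rewrite mxE mulr_ge0 ?invr_ge0 ?(ltW m0) //.
    by case: ifP => // _; exact: (proj1 xS).
  under eq_bigr do rewrite mxE.
  rewrite -mulr_sumr (_ : \sum_i _ = outer_mass rho x) ?mulVf ?gt_eqF //.
  by rewrite /outer_mass [RHS]big_mkcond; apply: eq_bigr => i _; case: ifP.
rewrite inE; apply/andP; split.
  apply: (proj2 cxL) xL _; apply/fintype.subsetP => i; rewrite !inE mxE.
  by apply: contraNneq => ->; rewrite if_same mulr0.
apply/fintype.subsetP => i; rewrite !inE mxE.
by apply: contraNN => ->; rewrite mulr0.
Qed.

Lemma retract_id rho x : realization (away_from rho) x -> retract rho x = x.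
Proof.
move=> /realizationE[xS]; rewrite inE => /andP[_ /fintype.subsetP xr].
have x0 i : i \in rho -> x ord0 i = 0.
  move=> ir; apply/eqP; apply: contraTT ir => xi.
  by have := xr i; rewrite !inE xi; exact.
have m1 : outer_mass rho x = 1.
  rewrite -(proj2 xS) /outer_mass [RHS](bigID (fun i => i \in rho)) /=.
  by rewrite [X in X + _]big1 ?add0r // => i /x0.
apply/rowP => i; rewrite mxE m1 invr1 mul1r.
by case: ifP => // /x0.
Qed.

Lemma retract_continuous rho : cont_on (X `\` face_space rho) (retract rho).
Proof.
move=> x xr; apply: cvg_within_filter.
rewrite (_ : retract rho = fun y : W => (outer_mass rho y)^-1 *:
    comb m [seq (if i \in rho then 0 else pt R i) | i <- enum 'I_m] y).
  apply: cvgZ; last exact: continuous_comb.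
  apply: (@cvgV R _ (nbhs x)); first by rewrite gt_eqF // outer_mass_gt0.
  exact: continuous_sum_coord.
apply/funext => y; apply/rowP => i; rewrite !mxE; congr (_ * _).
rewrite /comb summxE (bigD1 i) //= big1 ?addr0.
  rewrite mxE (nth_map i) ?size_enum_ord // nth_ord_enum.
  by case: ifP => _; rewrite !mxE ?eqxx ?mulr0 ?mulr1.
move=> j ji; rewrite mxE (nth_map i) ?size_enum_ord // nth_ord_enum.
by case: ifP => _; rewrite !mxE ?mulr0 // [i == j]eq_sym (negbTE ji) andbF mulr0.
Qed.

Hypothesis acX : forall x, X x -> acyclic (X `\` [set x]).

Lemma affine_cycle k (c : vchain) : of_size k c -> bd c = 0 ->
  cycle (affine_sing R k c).
Proof.
by case: k => [//|k] kc bc /=; rewrite sbd_affine // bc raddf0.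
Qed.

(** The closed simplex [rho] is convex and compact, so [c] bounds a singular chain off it. The
    retraction moves this chain into [away_from rho] and fixes [c], after which it is made
    simplicial. *)
Lemma face_off_bounds rho k (c : vchain) : rho \in L -> rho != finset.set0 ->
  of_size k c -> supp_in (in_cx (away_from rho)) c -> bd c = 0 ->
  exists c', [/\ of_size k.+1 c', supp_in (in_cx (away_from rho)) c' & bd c' = c].
Proof.
move=> rL /finset.set0Pn[v0 v0r] kc cr bc.
have acr : acyclic (X `\` face_space rho).
  apply: acyclic_complement acX (face_space_sub rL) _ (@compact_face_space rho)
    (@convex_face_space rho).
  by exists (pt R v0); exact: face_space_pt.
have cxr := away_from_complex rho.
have sub : realization (away_from rho) `<=` X `\` face_space rho.
  move=> x /realizationE[xS]; rewrite inE => /andP[xL /fintype.subsetP xr].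
  split; first exact/realizationE.
  move=> [_ x0]; have := proj2 xS; rewrite big1 => [/eqP|i _].
    by rewrite eq_sym oner_eq0.
  have [ir|/x0//] := boolP (i \in rho).
  apply/eqP; apply: contraTT ir => xi.
  by have := xr i; rewrite !inE xi; exact.
have [b [br bb]] := acr _ _ (supp_sing_inW sub (affine_sing_in cxr kc cr))
  (affine_cycle kc bc).
apply: (simplicial_bounds v0 cxr kc cr bc (b := fwd (retract rho) b)).
  by apply: fwd_sing_in br; [exact: retract_continuous|exact: retract_in].
rewrite sbd_fwd bb (fwd_affine_id (U := realization (away_from rho))) //.
  by apply: supp_inW cr => l; exact: hull_pt_realization.
exact: retract_id.
Qed.

(** The barycenter of [tau] has more than [k] nonzero coordinates, so simplices with [k] vertices
    miss it, and [c] bounds in the punctured space. *)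
Lemma skeleton_bounds tau k (c : vchain) : tau \in L -> (k < #|tau|)%N ->
  of_size k c -> supp_in (in_cx L) c -> bd c = 0 ->
  exists c', [/\ of_size k.+1 c', supp_in (in_cx L) c' & bd c' = c].
Proof.
move=> tL kt kc cL bc.
have t0 : (0 < #|tau|)%N by case: #|tau| kt.
have tn0 : #|tau|%:R != 0 :> R by rewrite pnatr_eq0 -lt0n.
have /card_gt0P[v0 _] := t0.
pose x : W := \row_i (if i \in tau then #|tau|%:R^-1 else 0).
have sx : spt x = tau.
  apply/finset.setP => i; rewrite inE mxE; case: ifP => _; last by rewrite eqxx.
  by rewrite invr_eq0.
have Xx : X x.
  apply/realizationE; rewrite sx; split => //; split => [i|].
    by rewrite mxE; case: ifP => // _; rewrite invr_ge0.
  under eq_bigr do rewrite mxE.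
  by rewrite -big_mkcond /= sumr_const -[LHS]mulr_natl mulfV.
have cx : supp_in (sing_in (X `\` [set x])) (affine_sing R k c).
  apply: affine_sing_subspace => //.
  apply: supp_inW (supp_inI kc cL) => l [sl lL] y hy.
  split; first exact: hull_pt_realization hy.
  move=> yx; have [_ yl] := hull_pt hy.
  have : (#|tau| <= size l)%N.
    rewrite -sx -yx; apply: leq_trans (card_size l).
    by apply: subset_leq_card; apply/fintype.subsetP => i; exact: yl.
  by rewrite sl leqNgt kt.
have [b [bX bb]] := acX Xx cx (affine_cycle kc bc).
apply: (simplicial_bounds v0 cxL kc cL bc (b := b)) => //.
by apply: supp_sing_inW bX => y [].
Qed.

End Faces.

Section SplitUniq.
Variables (T : choiceType) (u : T).

Lemma strip_list_uniq l : uniq l -> u \in l ->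
  exists a l', [/\ a != 0, perm_eq (u :: l') l & strip_list u l = << a *g l' >>].
Proof.
elim: l => [//|x l IH] /= /andP[xl ul]; rewrite inE eq_sym.
have [<-|ux] /= := eqVneq x u.
  by move=> _; exists 1, l; rewrite /away_list (negbTE xl); split.
move=> /(IH ul)[a [l' [a0 pl ->]]]; exists (- a), (x :: l'); split.
- by rewrite oppr_eq0.
- rewrite -(perm_cons x) in pl; apply: perm_trans pl.
  by apply/permP => p /=; rewrite addnCA.
- rewrite freegU_scale scale_mulz raddfMz /= cone1 -scale_mulz -freegU_scale.
  by rewrite freegUN.
Qed.

Lemma split_uniq l : uniq l -> u \in l ->
  exists a l', [/\ a != 0, perm_eq l' l & split u << l >> = << a *g l' >>].
Proof.
move=> ul uinl; have [a [l' [a0 pl El]]] := strip_list_uniq ul uinl.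
exists a, (u :: l'); split => //.
rewrite /split /away ext1 /away_list uinl add0r /strip ext1 El.
by rewrite freegU_scale scale_mulz raddfMz /= cone1 -scale_mulz -freegU_scale.
Qed.

End SplitUniq.

(** Shows that the normal form of a nondegenerate simplex is not 0. *)
Lemma normalize_uniq (T : choiceType) (us l : seq T) : uniq l -> {subset us <= l} ->
  exists a l', [/\ a != 0, perm_eq l' l & normalize us << l >> = << a *g l' >>].
Proof.
move=> ul; elim: us => [_|u us IH sub] /=.
  by exists 1, l.
have [|a [l' [a0 pl ->]]] := IH; first by move=> x xus; apply: sub;
  rewrite inE xus orbT.
have ul' : uniq l' by rewrite (perm_uniq pl).
have uinl' : u \in l' by rewrite (perm_mem pl) sub // mem_head.
have [a' [l'' [a'0 pl' E]]] := split_uniq ul' uinl'.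
exists (a * a'), l''; split; first by rewrite mulf_neq0.
  exact: perm_trans pl' pl.
by rewrite freegU_scale scale_mulz raddfMz /= E -scale_mulz [in LHS]freegU_scale
  scalerA -freegU_scale.
Qed.

Lemma fwd_fwd (R : realType) m1 m2 m3 (f : 'rV[R]_m1 -> 'rV[R]_m2)
    (g : 'rV[R]_m2 -> 'rV[R]_m3) k (c : sing R m1 k) :
  fwd g (fwd f c) = fwd (g \o f) c.
Proof.
move: c; apply: (@eq_additive _ _ (@fwd R m2 m3 g k \o @fwd R m1 m2 f k)
  (@fwd R m1 m3 (g \o f) k)) => s /=.
rewrite !fwd1; congr (<< _ >>); apply: eq_restr => t tS /=.
by rewrite restrT.
Qed.

(** * Punctures and the dimension of combinatorial spheres *)

Section CombinatorialSphere.
Variables (R : realType) (d m : nat) (L : {set {set 'I_m}}).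
Hypothesis sphL : combinatorial_sphere R d L.

Lemma sphere_acyclic_punctured x : realization L x ->
  acyclic (@realization R m L `\` [set x]).
Proof.
have [_ [f [g [[plf fXY] [plg gYX] fK gK]]]] := sphL.
apply: acyclic_punctured_sphere fXY gYX fK gK x; exact: pl_on_cont.
Qed.

Lemma boundary_complexP N : simplicial_complex (boundary_complex N).
Proof.
split; first by rewrite inE; apply/eqP => /finset.setP/(_ ord0); rewrite !inE.
move=> s t; rewrite !inE => sT ts; apply: contraNneq sT => tT.
by rewrite finset.eqEsubset finset.subsetT -tT.
Qed.

(* If all simplices of [L] had at most [d] vertices, the fundamental cycle of
   the boundary of the simplex, carried to [L] and approximated there by a
   simplicial cycle, would bound. *)
Lemma sphere_facet : exists2 tau, tau \in L & #|tau| = d.+1.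
Proof.
have [cxL [f [g [[plf fXY] [plg gYX] fK gK]]]] := sphL.
have [cf cg] := (pl_on_cont plf, pl_on_cont plg).
apply: contrapT => noface.
have small s : s \in L -> (#|s| <= d)%N.
  move=> sL; rewrite leqNgt; apply/negP => ds; apply: noface.
  have [t ts td] : exists2 t : {set 'I_m}, t \subset s & #|t| = d.+1.
    exists [set x in take d.+1 (enum s)]%SET.
      by apply/fintype.subsetP => x; rewrite inE => /mem_take; rewrite mem_enum.
    rewrite cardsE (card_uniqP _) ?take_uniq ?enum_uniq // size_take -cardE.
    by case: ifP; lia.
  by exists t => //; exact: (proj2 cxL) sL ts.
pose full := enum 'I_d.+2.
have cxB := boundary_complexP d.
pose c0 := bd << full >>.
have kfull : of_size d.+2 << full >> by apply: supp_inU; rewrite size_enum_ord.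
have kc0 : of_size d.+1 c0 by exact: of_size_bd.
have Bc0 : supp_in (in_cx (boundary_complex d)) c0.
  rewrite /c0 bd1; apply: supp_inW (@supp_in_list_boundary _ full).
  move=> _ [l1 [x [l2 [El ->]]]]; rewrite /in_cx inE;
    apply/eqP => /finset.setP/(_ x).
  rewrite !inE mem_cat.
  have : uniq full := enum_uniq _.
  by rewrite El cat_uniq /= negb_or =>
    /and3P[_ /andP[/negbTE-> _] /andP[/negbTE-> _]].
have bc0 : bd c0 = 0 by exact: bd_bd.
set Y := realization (boundary_complex d) in fXY gYX cf cg fK gK.
pose z1 := fwd g (affine_sing R d.+1 c0).
have z1X : supp_in (sing_in (realization L)) z1.
  by apply: fwd_sing_in cg gYX (affine_sing_in cxB kc0 Bc0).
have z1c : cycle z1 by apply: fwd_cycle; exact: affine_cycle.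
have [v0 _] : exists v0 : 'I_m, True.
  have Yp : Y (pt R ord0).
    apply/realizationE; split; first exact: pt_in_dsimp.
    rewrite inE; apply/eqP => /finset.setP/(_ ord_max).
    by rewrite !inE mxE eqxx /= eqxx.
  have /realizationE[[_ x1] _] := gYX _ Yp.
  have [v0 _|no] := pickP (fun _ : 'I_m => true); first by exists v0.
  by move: x1; rewrite big1 => [/eqP|i]; [rewrite eq_sym oner_eq0|have := no i].
have [z [b [kz Lz bz bX Ez1]]] := simplicial_approx v0 cxL z1X z1c.
(* The coefficients to be tested sit at lists of [d + 1] distinct vertices, which are not simplices
   of [L] by [small]; so [z] bounds inside [L]. *)
have [b' [kb' Lb' bb']] : exists b',
  [/\ of_size d.+2 b', supp_in (in_cx L) b' & bd b' = z].
  case Em : (enum 'I_m) => [|u us].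
    by have := mem_enum 'I_m v0; rewrite Em.
  apply: (@normalize_bounds _ v0 _ _ u us _ _ _ kz Lz _ bz).
  - by rewrite -Em enum_uniq.
  - by have := in_cx_closed cxL.
  - by move=> l _ x _; rewrite -Em mem_enum.
  move=> s ss sz; apply: coeff_outdom; apply/negP => sd.
  have [_ LN] := carried_supp (@carried_normalize _ (u :: us))
    (in_cx_closed cxL) kz Lz.
  have := small _ (LN _ sd); rewrite cardsE (card_uniqP _) ?sz ?ltnn //.
  apply: (subseq_uniq (subseq_trans ss (subseq_cons us u))).
  by rewrite -Em enum_uniq.
pose beta := affine_sing R d.+2 b' + b.
have betaX : supp_in (sing_in (realization L)) beta.
  by apply: supp_inD bX; exact: affine_sing_in.
have Ebeta : sbd beta = z1 by rewrite Ez1 raddfD /= sbd_affine // bb'.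
have fz1 : fwd f z1 = affine_sing R d.+1 c0.
  rewrite /z1 fwd_fwd; apply: (fwd_affine_id (U := Y)) => //.
  by apply: supp_inW Bc0 => l; exact: hull_pt_realization.
have Efb : sbd (fwd f beta) = affine_sing R d.+1 c0 by rewrite sbd_fwd Ebeta.
(* Carried back by [f], the filling shows that the fundamental cycle [c0] bounds inside the boundary
   of the simplex. *)
have [c' [kc' Bc' bc']] := simplicial_bounds ord0 cxB kc0 Bc0 bc0
  (fwd_sing_in cf fXY betaX) Efb.
have x_bd : bd (<< full >> - c') = 0 by rewrite raddfB /= bc' subrr.
have kx : of_size d.+2 (<< full >> - c') by exact: supp_inB.
(* This cycle bounds a chain of lists with [d + 3] entries among [d + 2] vertices, whose normal form
   is 0. Hence [full] and [c'] have the same normal form, although that of [c'] lives on proper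
   faces. *)
have N0 : normalize full (<< full >> - c') = 0.
  pose B := cone ord0 (<< full >> - c').
  have -> : << full >> - c' = bd B by rewrite bd_cone x_bd raddf0 subr0.
  rewrite -bd_normalize (_ : normalize full B = 0) ?raddf0 //.
  have cT : subset_closed (fun _ : seq 'I_d.+2 => True) by [].
  have kB : of_size d.+3 B by exact: of_size_cone.
  have [kN _] := carried_supp (@carried_normalize _ full) cT kB (fun _ _ => I).
  apply/eqP; rewrite -dom_eq0; case E : (dom _) => [//|s dm].
  have sd : s \in dom (normalize full B) by rewrite E mem_head.
  have [s1 [t [Es ss tus]]] := @supp_normalize _ full B (enum_uniq _) _ sd.
  have := kN _ sd; rewrite Es; case: t tus {Es} => [_|y t tus].
    rewrite cats0 => s1s; have := size_subseq ss.
    by rewrite s1s size_enum_ord ltnn.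
  by have := tus y (mem_head _ _); rewrite mem_enum.
have [a [l' [a0 pl E]]] := normalize_uniq (us := full) (enum_uniq _) (fun x h => h).
have [_ BN] := carried_supp (@carried_normalize _ full) (in_cx_closed cxB) kc' Bc'.
have : l' \in dom (normalize full c').
  move/eqP: N0; rewrite raddfB /= subr_eq0 => /eqP <-.
  by rewrite E mem_dom coeffU eqxx mulr1.
move=> /BN; rewrite /in_cx inE => /eqP; apply; apply/finset.setP => x.
by rewrite !inE (perm_mem pl) mem_enum.
Qed.

End CombinatorialSphere.

(** * Pushing cycles off a simplex *)

(** A rational relation exists for reasons of rank; multiplying by the product of the denominators
    makes it integral. *)
Lemma int_relation r c (M : 'M[int]_(r, c)) : (c < r)%N ->
  exists2 a : 'I_r -> int, (exists i, a i != 0) &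
    forall j, \sum_i a i * M i j = 0.
Proof.
move=> cr; pose Q := map_mx (intr : int -> rat) M.
have : kermx Q != 0.
  rewrite -mxrank_eq0 mxrank_ker subn_eq0 -ltnNge.
  exact: leq_ltn_trans (rank_leq_col Q) cr.
move=> /rowV0Pn[v /sub_kermxP vQ v0].
pose D := \prod_i denq (v ord0 i).
have D0 : D != 0 by apply/prodf_neq0 => i _; exact: denq_neq0.
pose a i := numq (v ord0 i) * \prod_(j | j != i) denq (v ord0 j).
have aE i : (a i)%:~R = D%:~R * v ord0 i.
  rewrite /a /D [in RHS](bigD1 i) //= !rmorphM /=
    -[X in _ = _ * X](divq_num_den (v ord0 i)).
  have : (denq (v ord0 i))%:~R != 0 :> rat by rewrite intr_eq0 denq_neq0.
  by move=> h; field.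
exists a => [|j].
  have [i vi] : exists i, v ord0 i != 0.
    by apply/rV0Pn.
  by exists i; rewrite -(intr_eq0 rat) aE mulf_neq0 // intr_eq0.
apply: (@intr_inj rat); rewrite rmorph_sum /=.
have := congr1 (fun w : 'rV_c => D%:~R * w ord0 j) vQ; rewrite !mxE mulr0 mulr_sumr.
by move=> h; rewrite -[RHS]h; apply: eq_bigr => i _;
  rewrite rmorphM /= aE mulrA mxE.
Qed.

(** * Bounding the rank by the number of vertices *)

Section Rank.
Variables (m : nat) (L : {set {set 'I_m}}).
Hypothesis cxL : simplicial_complex L.
Notation vchain := {freeg (seq 'I_m) / int}.

Lemma mem_vertices l x : in_cx L l -> x \in l -> x \in vertices L.
Proof.
move=> lL xl; rewrite inE; apply: (proj2 cxL) lL _.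
by rewrite finset.sub1set inE.
Qed.

(* The cycles on w vertices are determined up to boundaries by their normal
   forms, hence by the coefficients at the k-subsets avoiding one vertex. *)
Lemma cycles_relation k r (z : 'I_r -> vchain) :
  (0 < #|vertices L|)%N -> ('C(#|vertices L|.-1, k) < r)%N ->
  (forall i, [/\ of_size k (z i), supp_in (in_cx L) (z i) & bd (z i) = 0]) ->
  exists2 a : 'I_r -> int, (exists i, a i != 0) &
    exists b, [/\ of_size k.+1 b, supp_in (in_cx L) b & bd b = \sum_i a i *: z i].
Proof.
move=> w0 cr hz.
case Ew : (enum (vertices L)) => [|u us]; first by rewrite cardE Ew in w0.
have v0 := u.
have uniq_us : uniq (u :: us) by rewrite -Ew enum_uniq.
pose A := [set s : {set 'I_m} | s \subset [set x in us]%SET & #|s| == k]%SET.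
have cA : #|A| = 'C(#|vertices L|.-1, k).
  rewrite cards_draws cardsE (card_uniqP _) ?(andP uniq_us).2 //; last first.
    by case/andP: uniq_us.
  by rewrite cardE Ew.
(* A sorted list is recovered from its set of entries, so subsets can index the columns of [M]. *)
pose sub_list (s : {set 'I_m}) := [seq x <- us | x \in s].
pose M := \matrix_(i < r, j < #|A|) coeff (sub_list (enum_val j))
  (normalize (u :: us) (z i)).
have [|a a0 aM] := @int_relation _ _ M; first by rewrite cA.
exists a => //; apply: (@normalize_bounds _ v0 (in_cx L) k u us) => //.
- exact: in_cx_closed.
- by apply: supp_in_sum => i _; apply: supp_inZ; case: (hz i).
- by apply: supp_in_sum => i _; apply: supp_inZ; case: (hz i).
- apply: supp_in_sum => i _; apply: supp_inZ; case: (hz i) => _ Lz _.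
  by apply: supp_inW Lz => l lL x /(mem_vertices lL); rewrite -mem_enum Ew.
- rewrite raddf_sum big1 // => i _; case: (hz i) => _ _ bz.
  by rewrite scale_mulz raddfMz /= bz mul0rz.
move=> s ss sk.
have sA : [set x in s]%SET \in A.
  rewrite inE cardsE (card_uniqP _) ?sk ?eqxx ?andbT; last first.
    by apply: subseq_uniq ss _; case/andP: uniq_us.
  by apply/fintype.subsetP => x; rewrite !inE; exact: mem_subseq ss x.
have := aM (enum_rank_in sA [set x in s]%SET).
rewrite raddf_sum raddf_sum /= => aMs; rewrite -[RHS]aMs; apply: eq_bigr => i _.
have E : normalize (u :: us) (a i *: z i) = a i *: normalize (u :: us) (z i).
  by rewrite !scale_mulz raddfMz.
rewrite -/(normalize (u :: us) (a i *: z i)) E coeffZ mxE enum_rankK_in //.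
congr (_ * coeff _ _).
have uus : uniq us by case/andP: uniq_us.
have /(subseq_uniqP uus) Es := ss; rewrite /sub_list {1}Es.
by apply: eq_filter => x; rewrite inE.
Qed.

End Rank.

(** * Pushing cycles through vertex links *)

Section Manifold.
Variables (R : realType) (n m : nat) (K : {set {set 'I_m}}).
Hypothesis n_gt0 : (0 < n)%N.
Hypothesis cxK : simplicial_complex K.
Hypothesis linkK : forall v, v \in vertices K ->
  combinatorial_sphere R (2 * n).-1 (link K v).
Notation vchain := {freeg (seq 'I_m) / int}.

Lemma mem_link v s : (s \in link K v) = (v \notin s) && ((v |: s)%SET \in K).
Proof. by rewrite inE. Qed.

Lemma face_vertex s v : s \in K -> v \in s -> v \in vertices K.
Proof.
by move=> sK vs; rewrite inE; apply: (proj2 cxK) sK _; rewrite finset.sub1set.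
Qed.

Lemma link_facet v : v \in vertices K ->
  exists2 tau, tau \in link K v & #|tau| = (2 * n)%N.
Proof.
move=> /linkK/sphere_facet[tau tL tc]; exists tau => //; rewrite tc.
by rewrite prednK // muln_gt0.
Qed.

Lemma facet_through v : v \in vertices K ->
  exists sigma, [/\ sigma \in K, v \in sigma & #|sigma| = (2 * n).+1].
Proof.
move=> /link_facet[tau]; rewrite mem_link => /andP[vt tK] tc.
by exists (v |: tau)%SET; split => //; [exact: setU11|rewrite cardsU1 vt tc].
Qed.

Lemma in_cx_link v l : in_cx (link K v) l <-> v \notin l /\ in_cx K (v :: l).
Proof.
rewrite /in_cx mem_link inE (_ : (v |: [set x in l])%SET = [set x in v :: l]%SET).
  by split => [/andP[]|[-> ->]].
by apply/finset.setP => x; rewrite !inE.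
Qed.

(** If [vs] is nonempty, it spans a simplex of the link with acyclic complement. If it is empty, the
    complement is the whole sphere, which is not acyclic, and the cycle bounds because its simplices
    have only [n < 2n] vertices. *)
Lemma link_bounds v vs c : v \in vertices K -> v \notin vs ->
  in_cx K (v :: vs) -> of_size n c ->
  supp_in (fun l => in_cx (link K v) l /\ {in l, forall x, x \notin vs}) c ->
  bd c = 0 ->
  exists y, [/\ of_size n.+1 y,
    supp_in (fun l => in_cx (link K v) l /\ {in l, forall x, x \notin vs}) y &
      bd y = c].
Proof.
move=> vK vvs vsK kc Lc bc.
have sph := linkK vK; have cxL := proj1 sph.
have ac := sphere_acyclic_punctured sph.
case: vs vvs vsK Lc => [|w vs] vvs vsK Lc.
  have [tau tL tc] := link_facet vK.
  have [||y [ky Ly by_]] := @skeleton_bounds R m _ cxL ac tau n c tL _ kc _ bc.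
  - by rewrite tc; lia.
  - by apply: supp_inW Lc => l [].
  by exists y; split => //; apply: supp_inW Ly.
have rL : [set x in w :: vs]%SET \in link K v.
  by have /in_cx_link : v \notin (w :: vs) /\ in_cx K (v :: w :: vs) by [].
have [||y [ky Ly by_]] := @face_off_bounds R m _ cxL ac [set x in w :: vs]%SET n
  c rL _ kc _ bc.
- by apply/finset.set0Pn; exists w; rewrite !inE eqxx.
- apply: supp_inW Lc => l [lL lv]; apply/in_cx_away_from; split => // x xl.
  by rewrite inE; exact: lv.
exists y; split => //; apply: supp_inW Ly => l /in_cx_away_from[lL lv];
  split => // x xl.
by have := lv _ xl; rewrite inE.
Qed.

Lemma push_off_face vs z : uniq vs -> in_cx K vs ->
  of_size n.+1 z -> supp_in (in_cx K) z -> bd z = 0 ->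
  exists z' b, [/\ of_size n.+1 z',
    supp_in (fun l => in_cx K l /\ {in l, forall x, x \notin vs}) z',
    of_size n.+2 b, supp_in (in_cx K) b & z = z' + bd b].
Proof.
move=> + + kz Kz bz; elim: vs => [_ _|v vs IH /= /andP[vvs uvs] vsK].
  exists z, 0; split => //; [by apply: supp_inW
    Kz|exact: supp_in0|exact: supp_in0|].
  by rewrite raddf0 addr0.
have [|z1 [b1 [kz1 Kz1 kb1 Kb1 E1]]] := IH uvs.
  by apply: (in_cx_closed cxK) vsK _ => x xl; rewrite inE xl orbT.
have bz1 : bd z1 = 0 by move: bz; rewrite E1 raddfD /= bd_bd addr0.
pose P l := in_cx K l /\ {in l, forall x, x \notin vs}.
have cP : subset_closed P.
  move=> l l' [lK lvs] ll'; split; first exact: (in_cx_closed cxK) lK ll'.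
  by move=> x /ll'; exact: lvs.
have vK : v \in vertices K by apply: mem_vertices vsK _; rewrite ?mem_head.
have PL l : v \notin l /\ P (v :: l) <->
    in_cx (link K v) l /\ {in l, forall x, x \notin vs}.
  rewrite in_cx_link; split => [[vl [vlK vlvs]]|[[vl vlK] lvs]].
    by split => // x xl; apply: vlvs; rewrite inE xl orbT.
  by split => //; split => // x; rewrite inE => /predU1P[->|/lvs].
have [ks Ps] := supp_strip v cP kz1 Kz1.
have [|y [ky Py by_]] := link_bounds vK vvs vsK ks _ (strip_cycle v bz1).
  by apply: supp_inW Ps => l /PL.
have {}Py : supp_in (fun l : seq 'I_m => v \notin l /\ P (v :: l)) y.
  by apply: supp_inW Py => l /PL.
have [z2 [b2 [kz2 Pz2 kb2 Pb2 E2]]] := push_off v (u := v) cP kz1 Kz1 bz1 ky Py by_.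
exists z2, (b1 + b2); split => //.
- apply: supp_inW Pz2 => l [[lK lvs] vl]; split => // x xl.
  rewrite inE negb_or lvs // andbT; apply: contraNneq vl => <-.
  exact: xl.
- exact: supp_inD.
- by apply: supp_inD => //; apply: supp_inW Pb2 => l [].
by rewrite raddfD /= E1 E2 -!addrA (addrC (bd b2)).
Qed.

(** The empty list is a reduced cycle in the link of a vertex of [sigma]; filling it off the rest of
    [sigma] produces a vertex outside [sigma]. This keeps the subtraction in [N - (2n + 2)] from
    being truncated. *)
Lemma vertices_many sigma : sigma \in K -> #|sigma| = (2 * n).+1 ->
  (2 * n + 2 <= #|vertices K|)%N.
Proof.
move=> sK sc.
have [v vs] : exists v, v \in sigma by apply/card_gt0P; rewrite sc.
have vK := face_vertex sK vs.
have sph := linkK vK; have cxL := proj1 sph.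
have ac := sphere_acyclic_punctured sph.
have rL : (sigma :\ v)%SET \in link K v.
  by rewrite mem_link !inE eqxx /= finset.setD1K.
have r0 : (sigma :\ v)%SET != finset.set0.
  by rewrite -card_gt0; have := cardsD1 v sigma; rewrite vs sc; lia.
have [|||y [ky Ly by_]] := @face_off_bounds R m _ cxL ac _ 0 << [::] >> rL r0.
- exact: supp_inU.
- apply: supp_inU; apply/in_cx_away_from; split => //.
  rewrite /in_cx (_ : [set x in _]%SET = finset.set0); first exact: (proj1 cxL).
  by apply/finset.setP => x; rewrite !inE.
- exact: bd_nil.
have [l ld] : exists l, l \in dom y.
  case E : (dom y) => [|l d]; last by exists l; rewrite mem_head.
  have /eqP y0 : y == 0 by rewrite -dom_eq0 E.
  by move: by_; rewrite y0 raddf0 => /esym/eqP; rewrite freegU_eq0.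
have /in_cx_away_from[lL lv] := Ly _ ld.
move: (ky _ ld) lL lv; case: l {ld} => [//|x l] _ /in_cx_link[vl vlK] lv.
have xK : x \in vertices K by apply: mem_vertices vlK _ => //;
  rewrite !inE eqxx orbT.
have xs : x \notin sigma.
  have := lv x (mem_head _ _); rewrite !inE negb_and negbK => /orP[/eqP xv|//].
  by move: vl; rewrite inE xv eqxx.
have : (x |: sigma)%SET \subset vertices K.
  by rewrite finset.subUset finset.sub1set xK; apply/fintype.subsetP => w;
    exact: face_vertex.
by move=> /subset_leq_card; rewrite cardsU1 xs sc; apply: leq_trans; rewrite addn2.
Qed.

End Manifold.

(** * Transfer to the triangulated space *)

Lemma nth_del (T : Type) (x0 : T) (l : seq T) i j : (i < size l)%N ->
  nth x0 (take i l ++ drop i.+1 l) j = nth x0 l (bump i j).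
Proof.
move=> il; rewrite nth_cat size_take il /bump; case: ltnP => ij.
  by rewrite nth_take // leqNgt ij.
by rewrite nth_drop add1n addSn subnKC.
Qed.

(** Matches the recursive boundary with the alternating sum in the definition of singular
    homology. *)
Lemma bd_sum (T : choiceType) (l : seq T) :
  bd << l >> = \sum_(i < size l) (-1) ^+ i *: << take i l ++ drop i.+1 l >>.
Proof.
elim: l => [|x l IH]; first by rewrite bd_nil big_ord0.
rewrite bd_cons big_ord_recl /= expr0 scale1r drop0; congr (_ + _).
rewrite IH raddf_sum -sumrN; apply: eq_bigr => i _ /=.
rewrite exprS mulN1r scaleNr !scale_mulz raddfMz /= cone1.
by congr (- (_ *~ _)).
Qed.

Lemma cont_on_sigL (S T : topologicalType) (A : set S) (f : S -> T) :
  cont_on A f <-> continuous (f \o (set_val : A -> S)).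
Proof.
rewrite -(@subspace_sigL_continuousP S A T f) subspace_continuousP.
by [].
Qed.

Section Transfer.
Variables (R : realType) (m : nat) (M : topologicalType) (X : set 'rV[R]_m).
Variables (f : (X : set _) -> M) (g : M -> (X : set _)).
Hypothesis f_cont : continuous f.
Hypothesis g_cont : continuous g.
Hypothesis gK : cancel g f.

Lemma face_row_comb k (i : 'I_k.+2) (t : 'rV[R]_k.+1) :
  comb k.+1 (take i (units R k.+2) ++ drop i.+1 (units R k.+2)) t = face_row i t.
Proof.
apply/rowP => j; rewrite /comb summxE mxE.
under eq_bigr => a _.
  rewrite mxE nth_del ?size_units // (nth_units R (fintype.lift i a)) mxE eqxx /=.
  over.
case: unliftP => [a ->|->].
  rewrite (bigD1 a) //= eqxx mulr1 big1 ?addr0 // => b ba.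
  by rewrite (inj_eq lift_inj) eq_sym (negbTE ba) mulr0.
by rewrite big1 // => a _; rewrite (negbTE (neq_lift i a)) mulr0.
Qed.

Lemma sbd_faces k (s : 'rV[R]_k.+2 -> 'rV[R]_m) :
  sbd << s >> = \sum_(i < k.+2) (-1) ^+ i *: << restr (s \o face_row i) >>.
Proof.
rewrite sbd1 bd_sum size_units raddf_sum; apply: eq_bigr => i _ /=.
rewrite !scale_mulz raddfMz /= push1; congr (<< _ >> *~ _);
  apply: eq_restr => t _ /=.
by rewrite face_row_comb.
Qed.

Definition unbundle k (s : singular_simplex R M k) (t : 'rV[R]_k.+1) : 'rV[R]_m :=
  match pselect (t \in @std_simplex R k) with
  | left h => set_val (g (s (exist _ t h)))
  | right _ => 0
  end.

Lemma unbundleE k (s : singular_simplex R M k) u :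
  unbundle s (set_val u) = set_val (g (s u)).
Proof.
rewrite /unbundle; case: pselect => [h|[]]; last exact: (valP u).
  by congr (set_val (g (s _))); exact: val_inj.
Qed.

Lemma dsimp_set_val k (u : @std_simplex R k) : dsimp R k.+1 (set_val u).
Proof. exact: (set_valP u). Qed.

Lemma dsimpP k (t : 'rV[R]_k.+1) : dsimp R k.+1 t ->
  exists u : @std_simplex R k, set_val u = t.
Proof. by move=> tS; exists (exist _ t (mem_set (tS : @std_simplex R k t))). Qed.

Lemma unbundle_sing_in k (s : singular_simplex R M k) : sing_in X (unbundle s).
Proof.
split => [|t /dsimpP[u <-]|t tS].
- apply/cont_on_sigL; rewrite (_ : _ \o _ = set_val \o (g \o s)); last first.
    by apply/funext => u /=; exact: unbundleE.
  move=> u; apply: (@continuous_comp _ _ _ (g \o s) set_val).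
    by apply: continuous_comp; [exact: cts_fun|exact: g_cont].
  exact: initial_continuous.
- by rewrite unbundleE; exact: set_valP.
- by rewrite /unbundle; case: pselect => // h; case: tS; exact: (set_mem h).
Qed.

(** A singular [k]-simplex has [k + 1] vertices, hence the shift of degree. *)
Definition to_sing k : singular_chain R M k -> sing R m k.+1 :=
  ext (fun s => << unbundle s >>).
HB.instance Definition _ k := GRing.Additive.on (@to_sing k).

Lemma to_sing_in k c : supp_in (sing_in X) (@to_sing k c).
Proof.
apply: (@supp_in_ext _ _ (fun=> True)) => // s _.
by apply: supp_inU; exact: unbundle_sing_in.
Qed.

Lemma boundary_is_zmod_morphism k : zmod_morphism (@Defs.boundary R M k).
Proof. exact: lift_is_additive. Qed.

HB.instance Definition _ k := GRing.isZmodMorphism.Build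
  (singular_chain R M k.+1) (singular_chain R M k) (@Defs.boundary R M k)
  (@boundary_is_zmod_morphism k).

Lemma sbd_to_sing k c : sbd (@to_sing k.+1 c) = to_sing (Defs.boundary c).
Proof.
move: c; apply: (@eq_additive _ _ (@sbd R m k.+1 \o @to_sing k.+1)
  (@to_sing k \o @Defs.boundary R M k)) => s /=.
rewrite /to_sing ext1 sbd_faces /Defs.boundary liftU scale1r /simplex_boundary.
rewrite raddf_sum; apply: eq_bigr => i _ /=.
rewrite !scale_mulz raddfMz /= ext1; congr (<< _ >> *~ _).
rewrite -[RHS](restr_id (unbundle_sing_in _));
  apply: eq_restr => _ /dsimpP[u <-] /=.
rewrite unbundleE /=.
have -> : face_row i (set_val u) = set_val (face i u) by [].
by rewrite unbundleE.
Qed.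

Lemma sing_in_set_val k (s : 'rV[R]_k.+1 -> 'rV[R]_m) : sing_in X s ->
  forall u : @std_simplex R k, s (set_val u) \in X.
Proof. by move=> [_ sX _] u; apply/mem_set/sX; exact: dsimp_set_val. Qed.

Definition bundle_fun k (s : 'rV[R]_k.+1 -> 'rV[R]_m) (sX : sing_in X s)
    (u : @std_simplex R k) : M := f (exist _ (s (set_val u))
      (sing_in_set_val sX u)).

Lemma bundle_continuous k s (sX : sing_in X s) : continuous (@bundle_fun k s sX).
Proof.
pose e u : (X : Type) := exist _ (s (set_val u)) (sing_in_set_val sX u).
have ce : continuous e.
  apply: continuous_comp_initial; apply/(@cont_on_sigL _ _ (dsimp R k.+1) s).
  by have [] := sX.
by move=> u; apply: (@continuous_comp _ _ _ e f); [exact: ce|exact: f_cont].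
Qed.

HB.instance Definition _ k s (sX : sing_in X s) :=
  isContinuous.Build _ _ (@bundle_fun k s sX) (@bundle_continuous k s sX).

(** The default value 0 makes this total on functions; compatibility with boundaries is claimed only
    for chains in [X]. *)
Definition bundle k (s : 'rV[R]_k.+1 -> 'rV[R]_m) : singular_chain R M k :=
  match pselect (sing_in X s) with
  | left sX => << (bundle_fun sX : singular_simplex R M k) >>
  | right _ => 0
  end.

Lemma bundleE k (s : 'rV[R]_k.+1 -> 'rV[R]_m) (sX : sing_in X s) :
  bundle s = << (bundle_fun sX : singular_simplex R M k) >>.
Proof.
rewrite /bundle; case: pselect => // sX'; congr (<< _ >>).
by apply/continuousEP => u; congr f; exact: val_inj.
Qed.

Definition of_sing k : sing R m k.+1 -> singular_chain R M k := ext (@bundle k).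
HB.instance Definition _ k := GRing.Additive.on (@of_sing k).

Lemma of_singK k (c : singular_chain R M k) : of_sing (to_sing c) = c.
Proof.
move: c; apply: (@eq_additive _ _ (@of_sing k \o @to_sing k) idfun) => s /=.
rewrite /to_sing ext1 /of_sing ext1 (bundleE (unbundle_sing_in s)).
congr (<< _ >>); apply/continuousEP => u /=; rewrite -[RHS]gK; congr f.
by apply: val_inj => /=; exact: unbundleE.
Qed.

Lemma boundary_of_sing k (b : sing R m k.+2) : supp_in (sing_in X) b ->
  Defs.boundary (of_sing b) = of_sing (sbd b).
Proof.
move: b; apply: (@eq_additive_in _ _ _ (@Defs.boundary R M k \o @of_sing k.+1)
  (@of_sing k \o @sbd R m k.+1)) => s sX /=.
rewrite sbd_faces /of_sing ext1 (bundleE sX) /Defs.boundary liftU scale1r.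
rewrite /simplex_boundary raddf_sum; apply: eq_bigr => i _ /=.
rewrite !scale_mulz raddfMz /= ext1; congr (_ *~ _).
have faceS t : dsimp R k.+1 t -> dsimp R k.+2 (face_row i t).
  by move=> /dsimpP[u <-]; exact: (dsimp_set_val (face i u)).
have sfX : sing_in X (restr (s \o face_row i)).
  have [cs sXt _] := sX; apply: sing_in_restr => [|t /faceS/sXt //].
  apply: cont_on_comp cs faceS; apply: cont_on_continuous.
  have -> : face_row i = comb k.+1 (take i (units R k.+2) ++ drop i.+1
    (units R k.+2)).
    by apply/funext => t; rewrite face_row_comb.
  exact: continuous_comb.
rewrite (bundleE sfX); congr (<< _ >>); apply/continuousEP => u /=.
congr f; apply: val_inj => /=; rewrite restrT //; exact: dsimp_set_val.
Qed.

End Transfer.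

(** * Relations between singular cycles of the triangulated space *)

Section SingularRank.
Variables (R : realType) (n m : nat) (K : {set {set 'I_m}}).
Hypothesis n_gt0 : (0 < n)%N.
Hypothesis cxK : simplicial_complex K.
Hypothesis linkK : forall v, v \in vertices K ->
  combinatorial_sphere R (2 * n).-1 (link K v).

Lemma singular_relation sigma r (c : 'I_r -> sing R m n.+1) :
  sigma \in K -> #|sigma| = (2 * n).+1 ->
  ('C(#|vertices K| - (2 * n + 2), n.+1) < r)%N ->
  (forall i, supp_in (sing_in (@realization R m K)) (c i)) ->
  (forall i, sbd (c i) = 0) ->
  exists2 a : 'I_r -> int, (exists i, a i != 0) &
    exists b : sing R m n.+2, supp_in (sing_in (@realization R m K)) b /\
      sbd b = \sum_i a i *: c i.
Proof.
move=> sK sc Cr cX cc.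
have [v0 _] : exists v, v \in sigma by apply/card_gt0P; rewrite sc.
have many := vertices_many n_gt0 cxK linkK sK sc.
pose L := away_from K sigma.
have cxL : simplicial_complex L := away_from_complex cxK sigma.
have step i : exists zb : {freeg (seq 'I_m) / int} * sing R m n.+2,
    [/\ of_size n.+1 zb.1, supp_in (in_cx L) zb.1, bd zb.1 = 0,
      supp_in (sing_in (@realization R m K)) zb.2
    & c i = affine_sing R n.+1 zb.1 + sbd zb.2].
  have [z [b [kz Kz bz bX Ec]]] := simplicial_approx v0 cxK (cX i) (cc i).
  have [|z' [b' [kz' Kz' kb' Kb' Ez]]] :=
    push_off_face n_gt0 cxK linkK (vs := enum sigma) (enum_uniq _) _ kz Kz bz.
    rewrite /in_cx (_ : [set x in _]%SET = sigma) //.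
    by apply/finset.setP => x; rewrite inE mem_enum.
  exists (z', affine_sing R n.+2 b' + b); split => //=.
  - apply: supp_inW Kz' => l [lK ls]; apply/in_cx_away_from; split => // x xl.
    by have := ls _ xl; rewrite mem_enum.
  - by move: bz; rewrite Ez raddfD /= bd_bd addr0.
  - by apply: supp_inD => //; exact: affine_sing_in.
  by rewrite Ec Ez !raddfD /= -sbd_affine // addrA.
have [zb zbP] := choice step.
have VL : vertices L = (vertices K :\: sigma)%SET.
  apply/finset.setP => x; rewrite !inE andbC; congr andb.
  apply/fintype.subsetP/idP => [/(_ x)|xs y];
    first by rewrite !inE eqxx => /(_ isT).
  by rewrite !inE => /eqP ->.
have cVL : #|vertices L| = (#|vertices K| - (2 * n).+1)%N.
  rewrite VL cardsD (finset.setIidPr _) ?sc //.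
  by apply/fintype.subsetP => x xs; exact: (face_vertex cxK sK xs).
(* The [2n + 1] vertices of [sigma] and the one spared by [cycles_relation] add up to the [2n + 2]
   subtracted in the binomial coefficient. *)
have [|||a a0 [b [kb Lb bb]]] := @cycles_relation m L cxL n.+1 r
  (fun i => (zb i).1).
- by rewrite cVL; lia.
- by rewrite cVL -subnS -addn2.
- by move=> i; case: (zbP i).
exists a => //.
exists (affine_sing R n.+2 b + \sum_i a i *: (zb i).2); split.
  apply: supp_inD.
    apply: affine_sing_in => //; apply: supp_inW Lb => l /in_cx_away_from[].
    by [].
  by apply: supp_in_sum => i _; apply: supp_inZ; case: (zbP i).
rewrite raddfD /= sbd_affine // bb !raddf_sum -big_split /=.
apply: eq_bigr => i _; case: (zbP i) => _ _ _ _ ->.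
by rewrite !scale_mulz !raddfMz /= -mulrzDl.
Qed.

End SingularRank.

Theorem corollary4p2 (R : realType) (n : nat) (M : topologicalType)
    (A : set (chart R (2 * n) M)) (r : nat) (k : int) :
  (1 <= n)%N ->
  closed_pl_manifold A ->
  n_connected R M n.-1 ->
  homology_rank R M n r ->
  minimal_admissible n r k ->
  forall (m : nat) (K : {set {set 'I_m}}),
    combinatorial_triangulation R (2 * n) K M ->
    (3 * n + 3)%:Z + k <= #|vertices K|%:Z.
Proof.
move=> n0 _ [[x0 _] _] [[z [zc zind]] _] [_ kmin] m K
  [cxK [f [g [cf cg fK gK]]] linkK].
have [v vK] : exists v, v \in vertices K.
  have /realizationE[[_ y1] yK] : realization K (set_val (g x0)) by exact: set_valP.
  have [i yi] : exists i, set_val (g x0) ord0 i != 0.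
    apply: contrapT => /forallNP h; move: y1; rewrite big1 => [/eqP|i _].
      by rewrite eq_sym oner_eq0.
    by apply/eqP; apply: contrapT => /negP; exact: h.
  by exists i; apply: (face_vertex cxK yK); rewrite inE.
have [sigma [sK _ sc]] := facet_through n0 linkK vK.
have many := vertices_many n0 cxK linkK sK sc.
(* Otherwise the [r] independent classes, carried to the realization, would satisfy a nontrivial
   relation, and the chain realizing it could be carried back to [M]. *)
have rank_le : (r <= 'C(#|vertices K| - (2 * n + 2), n.+1))%N.
  rewrite leqNgt; apply/negP => Cr.
  have cycle_to_sing k' (c : singular_chain R M k') : (0 < k')%N ->
      singular_cycle c -> sbd (to_sing g c) = 0.
    by case: k' c => [//|k'] c _ /= cc; rewrite sbd_to_sing // cc raddf0.
  have zc' i : sbd (to_sing g (z i)) = 0 by exact: cycle_to_sing.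
  have [a [i ai] [b [bX bb]]] := singular_relation n0 cxK linkK sK sc Cr
    (fun i => to_sing_in cg (c := z i)) zc'.
  move: ai; rewrite (zind a) ?eqxx //.
  exists (of_sing cf b); rewrite (boundary_of_sing cf bX) bb.
  rewrite -[RHS](of_singK cf cg gK); congr of_sing; rewrite raddf_sum.
  by apply: eq_bigr => j _; rewrite !scale_mulz raddfMz.
move: rank_le; set q := (#|vertices K| - (2 * n + 2))%N => rank_le.
have Eq : #|vertices K| = (2 * n + 2 + q)%N by rewrite subnKC.
(* For this candidate the upper entry [n + k + 1] becomes [q], and the symmetry of binomial
   coefficients yields [C(q, n + 1)]. *)
have : k <= q%:Z - (n.+1)%:Z.
  apply: kmin; rewrite /admissible.
  have E : n%:Z + (q%:Z - (n.+1)%:Z) + 1 = q%:Z by lia.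
  rewrite E; split => //; have [nq|qn] := leqP n.+1 q.
    have -> : q%:Z - (n.+1)%:Z = (q - n.+1)%:Z by lia.
    by rewrite /= bin_sub.
  (* Here [q <= n], so the candidate is negative; [rank_le] then says that [r] is 0. *)
  by rewrite (leq_trans rank_le) // bin_small.
lia.
Qed.
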